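(* Fix $p\in(0,1)$. Let $m=m(n)\ge n$, $d=d(n)$ be positive integers and $q=q(n)\in(0,1]$. (1) If $\log(n)^3\ll d\ll nmq^4$, then counting signed four-cycles distinguishes $\mathbb W(n,m,q,p,d)$ from $\mathbb M(n,m,p)$: there are thresholds $t_n\in\mathbb R$ such that $$\mathbb P_{M\sim\mathbb M(n,m,p)}\big(C_4(M)\ge t_n\big)+\mathbb P_{M\sim\mathbb W(n,m,q,p,d)}\big(C_4(M)<t_n\big)\to0\quad\text{as }n\to\infty.$$ (2) If $\log(n)^3\ll d\ll nmq^2$, then counting signed four-cycles within the mask distinguishes $\mathbb W_{\mathbf M}(n,m,p,d)$ from $\mathbb M(n,m,p)$ when the mask $\mathbf M\sim\mathbb M(n,m,q)$ is known: there are thresholds $t_n\in\mathbb R$ such that $$\mathbb P\big(C_4^{\mathbf M}(M_0)\ge t_n\big)+\mathbb P\big(C_4^{\mathbf M}(M_1)<t_n\big)\to0\quad\text{as }n\to\infty,$$ where $\mathbf M\sim\mathbb M(n,m,q)$, $M_0\sim\mathbb M(n,m,p)$ is independent of $\mathbf M$, and, conditionally on $\mathbf M$, $M_1\sim\mathbb W_{\mathbf M}(n,m,p,d)$.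
   Context: For functions of $n$, $f\gg g$ (equivalently $g\ll f$) means $f(n)/g(n)\to\infty$ as $n\to\infty$. $\mathbb M(n,m,p)$: the law of a random $n\times m$ $\{0,1\}$-matrix with i.i.d. $\mathrm{Bern}(p)$ entries. $\mathbb W(n,m,p,d)$: let $R$ be the set of $n$ rows and $L$ the set of $m$ columns. Draw independent vectors $(\mathbf x_u)_{u\in R}$, $(\mathbf x_u)_{u\in L}$ from $\mathcal N(0,\mathbf I_d)$. Let $\tau=\tau(d,p)$ be such that $\mathbb P(d^{-1/2}\langle \mathbf x,\mathbf y\rangle\le\tau)=p$ for independent $\mathbf x,\mathbf y\sim\mathcal N(0,\mathbf I_d)$. The entry in row $u$ and column $v$ is $\mathbf 1(d^{-1/2}\langle\mathbf x_u,\mathbf x_v\rangle\le\tau)$. For $\mathbf M\in\{0,1\}^{n\times m}$, $\mathbb W_{\mathbf M}(n,m,p,d)$ is the law of $W\odot\mathbf M+B\odot(1-\mathbf M)$ with independent $W\sim\mathbb W(n,m,p,d)$, $B\sim\mathbb M(n,m,p)$ and $\odot$ the entrywise product. $\mathbb W(n,m,q,p,d)$ is the mixture of $\mathbb W_{\mathbf M}(n,m,p,d)$ over $\mathbf M\sim\mathbb M(n,m,q)$. Signed four-cycle count: $C_4(M):=\sum_{1\le i<j\le n}\sum_{1\le k<l\le m}(M_{i,k}-p)(M_{i,l}-p)(M_{j,k}-p)(M_{j,l}-p)$. Its restriction $C_4^{\mathbf M}(M)$ to the mask is the same sum restricted to those $(i,j,k,l)$ for which $\mathbf M_{i,k}=\mathbf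 M_{i,l}=\mathbf M_{j,k}=\mathbf M_{j,l}=1$. *)

(* Defs.v *)
From HB Require Import structures.
From mathcomp Require Import all_boot all_order all_algebra.
From mathcomp Require Import all_classical all_reals all_analysis.

Set Implicit Arguments.
Unset Strict Implicit.
Unset Printing Implicit Defensive.

Import Order.TTheory GRing.Theory Num.Theory.
Import numFieldNormedType.Exports.

Local Open Scope classical_set_scope.
Local Open Scope ring_scope.

Definition tuple_cons d (T : measurableType d) n (z : T * n.-tuple T) :
  n.+1.-tuple T := [the n.+1.-tuple T of z.1 :: z.2].

Section tuple_cons_mfun.
Context d (T : measurableType d) (n : nat).

Let measurable_tuple_cons : measurable_fun setT (@tuple_cons d T n).
Proof. exact: measurable_cons. Qed.

HB.instance Definition _ := isMeasurableFun.Build _ _ _ _ (@tuple_cons d T n)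
  measurable_tuple_cons.

End tuple_cons_mfun.

(* The law of n independent samples from P; see iid_probE. *)
Fixpoint iid_prob d (T : measurableType d) (R : realType)
    (P : probability T R) n : probability (n.-tuple T) R :=
  if n is n'.+1 then
    distribution (P \x iid_prob P n')%E (@tuple_cons d T n')
  else \d_([tuple] : 0.-tuple T).

Lemma iid_probE d (T : measurableType d) (R : realType) (P : probability T R)
    n (A : 'I_n -> set T) : (forall i, measurable (A i)) ->
  iid_prob P n [set t | forall i, A i (tnth t i)] = (\prod_(i < n) P (A i))%E.
Proof.
elim: n A => [|n IHn] A mA /=.
  by rewrite big_ord0 diracE mem_set//= => -[].
have mB : measurable [set t : n.-tuple T | forall i, A (lift ord0 i) (tnth t i)].
  rewrite (_ : mkset _ = \big[setI/setT]_(i < n)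
      ((@tnth n T ^~ i) @^-1` A (lift ord0 i))).
    apply: bigsetI_measurable => i _.
    by rewrite -[X in measurable X]setTI; exact: measurable_tnth.
  rewrite -bigcap_seq/=; apply/seteqP; split => t /= At i => [_|]; first exact: At.
  by apply: At => /=; exact: mem_index_enum.
rewrite big_ord_recl -IHn//= -product_measure1E//.
rewrite /distribution /pushforward /=; congr (_ _).
apply/seteqP; split => -[x t] /=.
  move=> At; split; first exact: (At ord0).
  by move=> i; have := At (lift ord0 i); rewrite tnthS.
move=> [Ax At] i; have [j ->|->//] := unliftP ord0 i.
by rewrite tnthS; exact: At.
Qed.

Section laws.
Variable R : realType.

(* Standard Gaussian vectors of R^d are encoded as d-tuples, since tuples
   carry the product sigma-algebra. *)
Notation gvec d := (d.-tuple (measurableTypeR R)).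

Definition gauss_vec d : probability (gvec d) R :=
  iid_prob (@normal_prob R 0 1) d.

Definition scaled_dot d (x y : gvec d) : R :=
  (Num.sqrt d%:R)^-1 * \sum_(k < d) (tnth x k : R) * (tnth y k : R).

Definition is_threshold d (p t : R) : Prop :=
  (gauss_vec d \x gauss_vec d)%E
    [set z : gvec d * gvec d | scaled_dot z.1 z.2 <= t] = p%:E.

(* A law on the finite type of n x m {0,1}-matrices is given by its mass
   function. *)
Definition mx_law n m := 'M[bool]_(n, m) -> R.

Definition Pr n m (mu : mx_law n m) (E : pred 'M[bool]_(n, m)) : R :=
  \sum_(A | E A) mu A.

(* M(n, m, p) *)
Definition bern_law n m (p : R) : mx_law n m := fun A =>
  \prod_(i < n) \prod_(j < m) bernoulli_pmf p (A i j).

(* W(n, m, p, d), where t is the threshold tau(d, p) *)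
Definition geom_mx n m d (t : R)
    (z : n.-tuple (gvec d) * m.-tuple (gvec d)) : 'M[bool]_(n, m) :=
  \matrix_(u < n, v < m) (scaled_dot (tnth z.1 u) (tnth z.2 v) <= t).

Definition geom_law n m d (t : R) : mx_law n m := fun A =>
  fine ((iid_prob (gauss_vec d) n \x iid_prob (gauss_vec d) m)%E
    [set z | geom_mx t z = A]).

(* W o M + B o (1 - M) *)
Definition mask_mx n m (M W B : 'M[bool]_(n, m)) : 'M[bool]_(n, m) :=
  \matrix_(i, j) (if M i j then W i j else B i j).

(* W_M(n, m, p, d) *)
Definition masked_law n m (p : R) d (t : R) (M : 'M[bool]_(n, m)) :
    mx_law n m := fun A =>
  \sum_(W : 'M[bool]_(n, m)) \sum_(B : 'M[bool]_(n, m) | mask_mx M W B == A)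
    geom_law d t W * bern_law p B.

(* W(n, m, q, p, d) *)
Definition mixed_law n m (q p : R) d (t : R) : mx_law n m := fun A =>
  \sum_(M : 'M[bool]_(n, m)) bern_law q M * masked_law p d t M A.

(* P(E M A), where M ~ M(n, m, q) and, conditionally on M, A ~ mu M *)
Definition Pr_mask n m (q : R) (mu : 'M[bool]_(n, m) -> mx_law n m)
    (E : 'M[bool]_(n, m) -> pred 'M[bool]_(n, m)) : R :=
  \sum_(M : 'M[bool]_(n, m)) bern_law q M * Pr (mu M) (E M).

Definition signed_cycle n m (p : R) (A : 'M[bool]_(n, m)) i j k l : R :=
  ((A i k)%:R - p) * ((A i l)%:R - p) * ((A j k)%:R - p) * ((A j l)%:R - p).

Definition C4 n m (p : R) (A : 'M[bool]_(n, m)) : R :=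
  \sum_(i < n) \sum_(j < n | (i < j)%N) \sum_(k < m) \sum_(l < m | (k < l)%N)
    signed_cycle p A i j k l.

Definition C4_mask n m (p : R) (M A : 'M[bool]_(n, m)) : R :=
  \sum_(i < n) \sum_(j < n | (i < j)%N) \sum_(k < m) \sum_(l < m | (k < l)%N
      && [&& M i k, M i l, M j k & M j l])
    signed_cycle p A i j k l.

Definition much_less (f g : nat -> R) : Prop :=
  g n / f n @[n --> \oo] --> +oo.

End laws.

(* Main.v *)
Require Import Defs.
From HB Require Import structures.
From mathcomp Require Import all_boot all_order all_algebra.
From mathcomp Require Import all_classical all_reals all_analysis.
From mathcomp Require Import measurable_realfun random_variable probability_measure.
From mathcomp Require Import ring lra zify.

Set Implicit Arguments.
Unset Strict Implicit.
Unset Printing Implicit Defensive.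

Import Order.TTheory GRing.Theory Num.Theory.
Import numFieldNormedType.Exports.

Local Open Scope classical_set_scope.
Local Open Scope ring_scope.

(** The proof is a second moment argument. Write [s(x,y)] for the centred
    geometric edge, the indicator of [<x,y> <= tau sqrt d] minus [p]
    ([edge_dev]), and [h(x,x')] for the mean of [s(x,y) s(x',y)] over a common
    neighbour [y] ([corr]). Let [kappa] and [H] be the second and fourth
    moments of [h] over independent [x], [x'] ([corr_moment]). Given the latent
    vectors, the mask and the noise are independent from entry to entry, so a
    signed four-cycle of the planted matrix has mean [q^4 kappa], while under
    the null law the count is centred. The threshold is half the planted mean
    [mu], of order [n^2 m^2 q^4 kappa], and by Chebyshev's inequality
    ([markov_sqr]) it remains to see that both variances are small before
    [mu^2].

    Two facts about Gaussian vectors are used, with constants depending on [p]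
    only.

    - [corr_moment2_lower]: [kappa >= c / d]. The function [h] is tested against
      [<x,x'>], which by Cauchy-Schwarz bounds [kappa] below by
      [(E h <x,x'>)^2 / d]. As [h] is a Gram kernel, [E h <x,x'>] is a sum of
      squares of projections of [s], and a second use of Cauchy-Schwarz bounds
      it below by [(E s <x,y>)^2 / d]. Finally [E s <x,y>] is of order [sqrt d]:
      [s] has mean zero, so [<x,y> / sqrt d] may be recentred at [tau], and the
      product then has a constant sign ([edge_dev_dot_lower]).

    - [corr_moment4_upper]: [H <= C / d^2], hence [H <= (C / c^2) kappa^2]. For
      fixed [x] and [x'] the pair [(<x,y>, <x',y>)] is Gaussian
      ([gauss_pair_law]), so [h] is, up to the fluctuations of [|x|] and [|x'|],
      the covariance of two half-plane indicators whose correlation is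
      [<x,x'> / d] ([cov4_bound]).

    The variance of the count is a sum of covariances of pairs of cycles, which
    depend on how the two pairs of rows and the two pairs of columns meet
    ([cycle_cov_le]). Cycles without common row or column use different latent
    vectors and are uncorrelated. If the columns are disjoint but the rows
    meet, the covariance is at most [q^8 H], and likewise with rows and columns exchanged.
    If both meet, a common entry contributes its second moment, at most [v],
    instead of two factors [q s].
    After summation and division by [mu^2] the error is at most a constant times
    [1/n + L + L^2], with [L = v^2 / (n m q^4 kappa)] ([detection_error_le]).

    The two parts of the theorem are treated together by giving entries outside
    the mask a weight [g] ([weighted_C4]): [g = 1] is the plain count, for which
    [v = 1], and [g = 0] is the count within the mask, for which [v = q]. Since
    [kappa >= c / d], the number [L] is at most a constant times
    [d / (n m q^4)], respectively [d / (n m q^2)]. *)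

(** * Integrals against probability measures *)

Notation L1 P f := (integrable P setT (EFin \o f)).

Section integration.
Context d (T : measurableType d) (R : realType) (P : probability T R).
Implicit Types f g : T -> R.

Lemma L1_dominated f g : measurable_fun setT f -> L1 P g ->
  (forall x, `|f x| <= g x) -> L1 P f.
Proof.
move=> mf ig fg; apply: (le_integrable measurableT _ _ ig).
  exact/measurable_EFinP.
by move=> x _ /=; rewrite lee_fin (le_trans (fg x))// ler_norm.
Qed.

Lemma L1_cst r : L1 P (fun=> r).
Proof. by apply: finite_measure_integrable_cst. Qed.

Lemma L1_bounded f M : measurable_fun setT f -> (forall x, `|f x| <= M) ->
  L1 P f.
Proof. by move=> mf fM; apply: (L1_dominated mf (L1_cst M)). Qed.

Lemma L1_measurable f : L1 P f -> measurable_fun setT f.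
Proof. by move=> /measurable_int /measurable_EFinP. Qed.

Lemma EFin_Rintegral f : L1 P f ->
  (\int[P]_x (f x)%:E = (\int[P]_x f x)%:E)%E.
Proof. by move=> iF; rewrite /Rintegral fineK//; exact: integrable_fin_num. Qed.

Lemma L1D f g : L1 P f -> L1 P g -> L1 P (fun x => f x + g x).
Proof.
move=> iF ig; rewrite (_ : _ \o _ = (EFin \o f) \+ (EFin \o g))%E//.
exact: integrableD.
Qed.

Lemma L1B f g : L1 P f -> L1 P g -> L1 P (fun x => f x - g x).
Proof.
move=> iF ig; rewrite (_ : _ \o _ = (EFin \o f) \- (EFin \o g))%E//.
exact: integrableB.
Qed.

Lemma L1Z r f : L1 P f -> L1 P (fun x => r * f x).
Proof.
move=> iF; rewrite (_ : _ \o _ = (fun x => r%:E * (EFin \o f) x))%E//.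
exact: integrableZl.
Qed.

Lemma L1_sum (I : Type) (s : seq I) (Q : pred I) (F : I -> T -> R) :
  (forall i, Q i -> L1 P (F i)) -> L1 P (fun x => \sum_(i <- s | Q i) F i x).
Proof.
move=> iF; elim: s => [|i s IHs].
  by under [X in EFin \o X]funext => x do rewrite big_nil; exact: L1_cst.
under [X in EFin \o X]funext => x do rewrite big_cons.
by case: (boolP (Q i)) => [Qi|//]; apply: L1D => //; exact: iF.
Qed.

Lemma Rintegral_cstT r : \int[P]_x r = r.
Proof. by rewrite Rintegral_cst//= probability_setT mulr1. Qed.

Lemma Rintegral_sum (I : Type) (s : seq I) (Q : pred I) (F : I -> T -> R) :
  (forall i, Q i -> L1 P (F i)) ->
  \int[P]_x (\sum_(i <- s | Q i) F i x) = \sum_(i <- s | Q i) \int[P]_x F i x.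
Proof.
move=> iF; elim: s => [|i s IHs].
  by under eq_Rintegral do rewrite big_nil; rewrite big_nil Rintegral_cstT.
rewrite big_cons; under eq_Rintegral do rewrite big_cons.
case: ifPn => // Qi; rewrite RintegralD ?IHs//; first exact: iF.
exact: L1_sum.
Qed.

Lemma le_RintegralT f g : L1 P f -> L1 P g -> (forall x, f x <= g x) ->
  \int[P]_x f x <= \int[P]_x g x.
Proof. by move=> iF ig fg; apply: le_Rintegral => // x _. Qed.

Lemma normr_Rintegral_le f M : measurable_fun setT f ->
  (forall x, `|f x| <= M) -> `|\int[P]_x f x| <= M.
Proof.
move=> mf fM; have iF := L1_bounded mf fM.
apply: (le_trans (le_normr_Rintegral measurableT iF)).
rewrite -[leRHS]Rintegral_cstT; apply: le_RintegralT => //; last exact: L1_cst.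
by apply: (L1_bounded (M := M)) => [|x]; [exact: measurableT_comp|rewrite normr_id].
Qed.

Lemma Rintegral_indic (A : set T) : measurable A ->
  \int[P]_x \1_A x = fine (P A).
Proof. by move=> mA; rewrite /Rintegral integral_indic// setIT. Qed.

End integration.

Lemma abse_fine_le (R : realType) (x : \bar R) : (`|(fine x)%:E| <= `|x|)%E.
Proof. by case: x => [r||] /=; rewrite ?normr0 ?lexx ?leey. Qed.

Section fubini.
Context d1 d2 (T1 : measurableType d1) (T2 : measurableType d2) (R : realType).
Variables (P1 : probability T1 R) (P2 : probability T2 R).
Implicit Types f : T1 * T2 -> R.

Lemma measurable_section1 d (X : measurableType d) (f : T1 * T2 -> X) x :
  measurable_fun setT f -> measurable_fun setT (fun y => f (x, y)).
Proof. by move=> mf; exact: (measurableT_comp mf (pair1_measurable x)). Qed.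

Lemma measurable_section2 d (X : measurableType d) (f : T1 * T2 -> X) y :
  measurable_fun setT f -> measurable_fun setT (fun x => f (x, y)).
Proof. by move=> mf; exact: (measurableT_comp mf (pair2_measurable y)). Qed.

Lemma L1_fst (g : T1 -> R) : L1 P1 g -> L1 (P1 \x P2)%E (g \o fst).
Proof.
move=> ig; have mg := L1_measurable ig.
apply/integrable12ltyP.
  by apply/measurable_EFinP/measurableT_comp.
under eq_integral do rewrite /= integral_cst//= probability_setT mule1.
by have /integrableP[] := ig.
Qed.

Lemma L1_snd (g : T2 -> R) : L1 P2 g -> L1 (P1 \x P2)%E (g \o snd).
Proof.
move=> ig; have mg := L1_measurable ig.
apply/integrable21ltyP.
  by apply/measurable_EFinP/measurableT_comp.
under eq_integral do rewrite /= integral_cst//= probability_setT mule1.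
by have /integrableP[] := ig.
Qed.

Lemma L1_prod (f : T1 -> R) (g : T2 -> R) : L1 P1 f -> L1 P2 g ->
  L1 (P1 \x P2)%E (fun z => f z.1 * g z.2).
Proof.
move=> iF ig; have mf := L1_measurable iF; have mg := L1_measurable ig.
apply/integrable12ltyP.
  by apply/measurable_EFinP; apply: measurable_funM; exact: measurableT_comp.
under eq_integral.
  move=> x _.
  under eq_integral do rewrite /= normrM EFinM.
  rewrite ge0_integralZl//; last first.
    by apply/measurable_EFinP; exact: measurableT_comp.
  over.
rewrite ge0_integralZr//; last 2 first.
- by apply/measurable_EFinP; exact: measurableT_comp.
- exact: integral_ge0.
have /integrableP[_ ifoo] := iF; have /integrableP[_ igoo] := ig.
by rewrite lte_mul_pinfty// ?integral_ge0// ge0_fin_numE// integral_ge0.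
Qed.

(** The inner integral may be infinite for [x] in a null set, where its real
    part is read as [0]; the outer integral does not see the difference. *)
Lemma Fubini12 f : L1 (P1 \x P2)%E f ->
  \int[(P1 \x P2)%E]_z f z = \int[P1]_x \int[P2]_y f (x, y).
Proof.
move=> iF; rewrite /Rintegral -integral12_prod_meas1//; congr fine.
apply: ae_eq_integral => //.
- exact: measurable_int (integrable_fubini_F iF).
- apply/measurable_EFinP; apply: measurableT_comp => //.
  exact: measurable_int (integrable_fubini_F iF).
have := integrable_ae measurableT (integrable_fubini_F iF).
by apply: filterS => x /(_ I) fx _; rewrite fineK.
Qed.

Lemma integrable_fubini_G f : L1 (P1 \x P2)%E f ->
  P2.-integrable setT (fubini_G P1 (EFin \o f)).
Proof.
move=> iF; have mf := measurable_int _ iF.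
have mG := measurable_fubini_G iF.
apply/integrableP; split => //.
apply: le_lt_trans ((integrable21ltyP P1 P2 mf).1 iF).
apply: ge0_le_integral => //.
- exact: measurableT_comp.
- apply: (measurable_fun_fubini_tonelli_G (abse \o (EFin \o f))) => //.
    exact: measurableT_comp.
  by move=> z; exact: abse_ge0.
- by move=> y _; apply: le_abse_integral => //; exact: measurable_section2.
Qed.

Lemma Fubini21 f : L1 (P1 \x P2)%E f ->
  \int[(P1 \x P2)%E]_z f z = \int[P2]_y \int[P1]_x f (x, y).
Proof.
move=> iF; rewrite /Rintegral -integral21_prod_meas1//; congr fine.
apply: ae_eq_integral => //.
- exact: measurable_int (integrable_fubini_G iF).
- apply/measurable_EFinP; apply: measurableT_comp => //.
  exact: measurable_int (integrable_fubini_G iF).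
have := integrable_ae measurableT (integrable_fubini_G iF).
by apply: filterS => x /(_ I) fx _; rewrite fineK.
Qed.

Lemma Rintegral_swap f : L1 (P1 \x P2)%E f ->
  \int[P1]_x \int[P2]_y f (x, y) = \int[P2]_y \int[P1]_x f (x, y).
Proof. by move=> iF; rewrite -Fubini12// Fubini21. Qed.

Lemma L1_section1 f : L1 (P1 \x P2)%E f ->
  L1 P1 (fun x => \int[P2]_y f (x, y)).
Proof.
move=> iF; have mF := measurable_int _ (integrable_fubini_F iF).
apply: (le_integrable measurableT _ _ (integrable_fubini_F iF)).
  by apply/measurable_EFinP; apply: measurableT_comp mF.
by move=> x _ /=; exact: abse_fine_le.
Qed.

Lemma L1_section2 f : L1 (P1 \x P2)%E f ->
  L1 P2 (fun y => \int[P1]_x f (x, y)).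
Proof.
move=> iF; have mF := measurable_int _ (integrable_fubini_G iF).
apply: (le_integrable measurableT _ _ (integrable_fubini_G iF)).
  by apply/measurable_EFinP; apply: measurableT_comp mF.
by move=> x _ /=; exact: abse_fine_le.
Qed.

Lemma measurable_Rintegral1 f M : measurable_fun setT f ->
  (forall z, `|f z| <= M) -> measurable_fun setT (fun x => \int[P2]_y f (x, y)).
Proof. by move=> mf fM; exact/L1_measurable/L1_section1/(L1_bounded _ mf fM). Qed.

End fubini.

(** * Independent samples *)

Section iid.
Context d (T : measurableType d) (R : realType) (P : probability T R).

Lemma Rintegral_iidS n (f : n.+1.-tuple T -> R) (M : R) : measurable_fun setT f ->
  (forall t, `|f t| <= M) ->
  \int[iid_prob P n.+1]_t f t =
  \int[P]_x \int[iid_prob P n]_t f (tuple_cons (x, t)).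
Proof.
move=> mf fM; have mfc : measurable_fun setT (f \o @tuple_cons d T n).
  by apply: measurableT_comp.
have ifc : L1 (P \x iid_prob P n)%E (f \o @tuple_cons d T n).
  by apply: (L1_bounded _ (M := M)) => // z; exact: fM.
rewrite -(Fubini12 ifc) /Rintegral /=; congr fine.
by rewrite integral_distribution//; exact/measurable_EFinP.
Qed.

Lemma Rintegral_iid0 (f : 0.-tuple T -> R) :
  \int[iid_prob P 0]_t f t = f [tuple].
Proof.
rewrite /Rintegral /= integral_dirac//; first by rewrite diracT mul1e.
rewrite (_ : (fun x => _) = cst (f [tuple])%:E)//.
by apply/funext => t; rewrite (tuple0 t).
Qed.

Lemma measurable_cylinder n (A : 'I_n -> set T) :
  (forall i, measurable (A i)) ->
  measurable [set t : n.-tuple T | forall i, A i (tnth t i)].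
Proof.
move=> mA; rewrite (_ : mkset _ = \big[setI/setT]_(i < n)
    ((@tnth n T ^~ i) @^-1` A i)).
  apply: bigsetI_measurable => i _.
  by rewrite -[X in measurable X]setTI; exact: measurable_tnth.
rewrite -bigcap_seq/=; apply/seteqP; split => t /= At i => [_|]; first exact: At.
by apply: At => /=; exact: mem_index_enum.
Qed.

(** Cylinders are stable under intersection and generate the product
    sigma-algebra. *)
Lemma iid_prob_unique n (mu : probability (n.-tuple T) R) :
    (forall A : 'I_n -> set T, (forall i, measurable (A i)) ->
      mu [set t | forall i, A i (tnth t i)] = (\prod_(i < n) P (A i))%E) ->
  forall B, measurable B -> iid_prob P n B = mu B.
Proof.
move=> muE; pose G := [set B : set (n.-tuple T) | exists A : 'I_n -> set T,
  (forall i, measurable (A i)) /\ B = [set t | forall i, A i (tnth t i)]].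
have GT : G setT.
  by exists (fun=> setT); split => //; apply/seteqP; split.
apply: (measure_unique G (fun=> setT)) => //.
- apply/seteqP; split.
    apply: smallest_sub; first exact: smallest_sigma_algebra.
    rewrite -bigcup_seq; apply: bigcup_sub => i _ _ [Y mY <-].
    apply: sub_gen_smallest; exists (fun j => if j == i then Y else setT).
    split; first by move=> j; case: ifP.
    apply/seteqP; split => [t /= [_ Yt] j|t /= Yt]; first by case: eqP => // ->.
    by split => //; have := Yt i; rewrite eqxx.
  apply: smallest_sub; first exact: sigma_algebra_measurable.
  by move=> _ [A [mA ->]]; exact: measurable_cylinder.
- move=> _ _ [A [mA ->]] [B [mB ->]]; exists (fun i => A i `&` B i); split.
    by move=> i; exact: measurableI.
  apply/seteqP; split => t /=; first by move=> [At Bt] i; split.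
  by move=> ABt; split => i; have [] := ABt i.
- by rewrite bigcup_const//; exists 0%N.
- move=> _ [A [mA ->]]; exact: etrans (iid_probE P mA) (esym (muE _ mA)).
- by move=> _; rewrite /= (@probability_setT _ _ _ (iid_prob P n)) ltry.
Qed.

Section subtuple.
Variables (n a : nat) (s : 'I_a -> 'I_n).

Definition subtuple (t : n.-tuple T) : a.-tuple T := [tuple tnth t (s i) | i < a].

Let measurable_subtuple : measurable_fun setT subtuple.
Proof.
apply/measurable_fun_tnthP => i; rewrite (_ : _ \o _ = @tnth n T ^~ (s i)).
  exact: measurable_tnth.
by apply/funext => t /=; rewrite tnth_mktuple.
Qed.

HB.instance Definition _ := isMeasurableFun.Build _ _ _ _ subtuple
  measurable_subtuple.

(** Distinct coordinates of an i.i.d. sample again form an i.i.d. sample: on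
    cylinders, the coordinates outside the image of [s] contribute factors [1]. *)
Lemma Rintegral_subtuple (f : a.-tuple T -> R) (M : R) : injective s ->
  measurable_fun setT f -> (forall t, `|f t| <= M) ->
  \int[iid_prob P n]_t f (subtuple t) = \int[iid_prob P a]_t f t.
Proof.
move=> s_inj mf fM.
have mfs : measurable_fun setT (f \o subtuple) by exact: measurableT_comp.
rewrite /Rintegral; congr fine.
rewrite -[LHS](@integral_distribution _ _ _ _ _ (iid_prob P n)
  subtuple (EFin \o f)); last 2 first.
- exact/measurable_EFinP.
- by apply: (L1_bounded _ (M := M)) => // z; exact: fM.
apply: eq_measure_integral => B mB _; apply/esym; apply: iid_prob_unique => //.
move=> A mA.
(* [A'] is the cylinder over [A], unconstrained off the image of [s]. *)
pose A' j := if [pick i | s i == j] is Some i then A i else setT.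
have A's i : A' (s i) = A i.
  rewrite /A'; case: pickP => [i' /eqP /s_inj ->//|/(_ i)].
  by rewrite eqxx.
transitivity (iid_prob P n (subtuple @^-1` [set t | forall i, A i (tnth t i)])).
  by [].
rewrite (_ : _ @^-1` _ = [set t | forall j, A' j (tnth t j)]); last first.
  apply/seteqP; split => t /= At i.
    rewrite /A'; case: pickP => // i' /eqP <-.
    by have := At i'; rewrite tnth_mktuple.
  by have := At (s i); rewrite A's /= tnth_mktuple.
rewrite (@iid_probE _ _ _ P); last by move=> j; rewrite /A'; case: pickP.
rewrite (bigID (fun j => j \in codom s)) /= [X in (_ * X)%E]big1 ?mule1; last first.
  move=> j sj; rewrite /A'; case: pickP => [i /eqP sij|_].
    by rewrite -sij codom_f in sj.
  by rewrite probability_setT.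
have us : uniq (codom s) by rewrite map_inj_uniq ?enum_uniq.
rewrite -(big_uniq _ us)/= big_map big_enum/=.
by apply: eq_bigr => i _; rewrite A's.
Qed.
End subtuple.

Lemma measurable_tuple_cons_fun n :
  measurable_fun setT (@tuple_cons d T n).
Proof. by []. Qed.

Lemma Rintegral_iid_prod n (g : 'I_n -> T -> R) (M : R) : 0 <= M ->
  (forall i, measurable_fun setT (g i)) -> (forall i x, `|g i x| <= M) ->
  \int[iid_prob P n]_t \prod_(i < n) g i (tnth t i) =
  \prod_(i < n) \int[P]_x g i x.
Proof.
move=> M0; elim: n g => [|n IHn] g mg gM.
  by rewrite Rintegral_iid0 !big_ord0.
have mprod k (h : 'I_k -> T -> R) : (forall i, measurable_fun setT (h i)) ->
    measurable_fun setT (fun t : k.-tuple T => \prod_(i < k) h i (tnth t i)).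
  move=> mh; apply: measurable_prod => i _.
  by apply: measurableT_comp => //; exact: measurable_tnth.
have prodM k (h : 'I_k -> T -> R) (t : k.-tuple T) :
    (forall i x, `|h i x| <= M) -> `|\prod_(i < k) h i (tnth t i)| <= M ^+ k.
  move=> hM; rewrite normr_prod -[k in leRHS]card_ord -prodr_const.
  by apply: ler_prod => i _; rewrite normr_ge0/=.
rewrite (Rintegral_iidS (mprod _ _ mg) (M := M ^+ n.+1)); last first.
  by move=> t; exact: prodM.
rewrite big_ord_recl -IHn// -RintegralZr//; last first.
  by apply: (L1_bounded _ (mg _) (M := M)).
apply: eq_Rintegral => x _; rewrite -RintegralZl//; last first.
  apply: (L1_bounded _ (M := M ^+ n)).
    exact: (mprod _ (fun i => g (lift ord0 i))).
  by move=> t; exact: (prodM _ (fun i => g (lift ord0 i))).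
apply: eq_Rintegral => t _; rewrite big_ord_recl; congr (_ * _).
by apply: eq_bigr => i _; rewrite tnthS.
Qed.

Lemma Rintegral_iid_pair n (i j : 'I_n) (f : T * T -> R) (M : R) : i != j ->
  measurable_fun setT f -> (forall z, `|f z| <= M) ->
  \int[iid_prob P n]_t f (tnth t i, tnth t j) =
  \int[P]_x \int[P]_y f (x, y).
Proof.
move=> ij mf fM.
pose F (t : 2.-tuple T) := f (tnth t ord0, tnth t ord_max).
have mF : measurable_fun setT F.
  apply: measurableT_comp => //.
  by apply: measurable_fun_pair => /=; exact: measurable_tnth.
pose s (k : 'I_2) := if k == ord0 then i else j.
have s_inj : injective s.
  move=> [[|[|//]] ?] [[|[|//]] ?]; rewrite /s/= => ss; apply/val_inj => //=.
    by rewrite ss eqxx in ij.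
  by rewrite ss eqxx in ij.
transitivity (\int[iid_prob P n]_t F (subtuple s t)).
  by apply: eq_Rintegral => t _; rewrite /F !tnth_mktuple.
rewrite (Rintegral_subtuple s_inj mF (M := M)); last by move=> t; exact: fM.
rewrite (Rintegral_iidS mF (M := M)); last by move=> t; exact: fM.
apply: eq_Rintegral => x _.
have mFx : measurable_fun setT (fun t : 1.-tuple T => F (tuple_cons (x, t))).
  apply: measurableT_comp => //; exact: (measurable_section1 x (measurable_tuple_cons_fun (n := 1))).
rewrite (Rintegral_iidS mFx (M := M)); last by move=> t; exact: fM.
apply: eq_Rintegral => y _.
by rewrite Rintegral_iid0 /F.
Qed.

Lemma Rintegral_iid_pairs n (i j k l : 'I_n) (f g : T * T -> R) (M : R) :
  uniq [:: i; j; k; l] ->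
  measurable_fun setT f -> measurable_fun setT g ->
  (forall z, `|f z| <= M) -> (forall z, `|g z| <= M) ->
  \int[iid_prob P n]_t (f (tnth t i, tnth t j) * g (tnth t k, tnth t l)) =
  (\int[P]_x \int[P]_y f (x, y)) * (\int[P]_x \int[P]_y g (x, y)).
Proof.
move=> ijkl mf mg fM gM.
pose s (a : 'I_4) := nth i [:: i; j; k; l] a.
have s_inj : injective s.
  by move=> a b /eqP; rewrite /s nth_uniq//= => /eqP /val_inj.
pose pr a b : 4.-tuple T -> T * T := fun t => (tnth t (inord a), tnth t (inord b)).
have mpr a b : measurable_fun setT (pr a b).
  by apply: measurable_fun_pair; exact: measurable_tnth.
pose F (t : 4.-tuple T) := f (pr 0 1 t)%N * g (pr 2 3 t)%N.
have M0 : 0 <= M by apply: le_trans (fM (point, point)).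
have mF : measurable_fun setT F.
  by apply: measurable_funM; exact: measurableT_comp.
have FM t : `|F t| <= M * M by rewrite normrM ler_pM.
transitivity (\int[iid_prob P n]_t F (subtuple s t)).
  by apply: eq_Rintegral => t _; rewrite /F /pr !tnth_mktuple /s !inordK.
rewrite (Rintegral_subtuple s_inj mF (M := M * M))//.
rewrite (Rintegral_iidS mF (M := M * M))//.
have mc n' x : measurable_fun setT (fun t : n'.-tuple T => tuple_cons (x, t)).
  exact: (measurable_section1 x (measurable_tuple_cons_fun (n := n'))).
have if2 x : L1 P (fun y => f (x, y)).
  by apply: (L1_bounded _ (M := M)) => //; exact: measurable_section1.
have ig2 x : L1 P (fun y => g (x, y)).
  by apply: (L1_bounded _ (M := M)) => //; exact: measurable_section1.
have tnthE m (x : T) (t : m.-tuple T) a : (a < m)%N ->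
    tnth (tuple_cons (x, t)) (inord a.+1) = nth x t a.
  by move=> am; rewrite (tnth_nth x)/= inordK.
have pr01 x y (t : 2.-tuple T) :
    pr 0 1 (tuple_cons (x, tuple_cons (y, t))) = (x, y).
  by rewrite /pr !(tnth_nth x)/= !inordK.
have pr23 x y (t : 2.-tuple T) :
    pr 2 3 (tuple_cons (x, tuple_cons (y, t))) = (tnth t ord0, tnth t ord_max).
  by rewrite /pr !(tnth_nth x)/= !inordK.
rewrite -RintegralZr//; last first.
  by apply: L1_section1; exact: (L1_bounded _ (M := M)).
apply: eq_Rintegral => x _.
rewrite (Rintegral_iidS (M := M * M))//; last first.
  exact: (measurableT_comp mF (mc _ x)).
rewrite -RintegralZr//.
apply: eq_Rintegral => y _.
rewrite -(Rintegral_iid_pair (n := 2) (i := ord0) (j := ord_max) _ mg (M := M))//.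
rewrite -RintegralZl//; last first.
  apply: (L1_bounded _ (M := M)) => //; apply: measurableT_comp => //.
  by apply: measurable_fun_pair => /=; exact: measurable_tnth.
by apply: eq_Rintegral => t _; rewrite /F pr01 pr23.
Qed.
End iid.

(** * Rotation invariance of the planar normal law *)

Section gaussian_rotation.
Context (R : realType).
Local Open Scope ereal_scope.
Local Notation RR := (measurableTypeR R).
Local Notation mu := (@lebesgue_measure R).
Local Notation N := (normal_prob 0 1 : probability RR R).
Local Notation phi := (@normal_pdf R 0 1).

(** The standard normal density is a version of the Radon-Nikodym derivative of
    the normal law. *)
Lemma ge0_integral_normal (f : RR -> \bar R) : measurable_fun setT f ->
  (forall x, 0 <= f x) -> \int[N]_x f x = \int[mu]_x (f x * (phi x)%:E).
Proof.
move=> mf f0; have dom := @normal_prob_dominates R 0 1.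
rewrite -(Radon_Nikodym_SigmaFinite.change_of_variables dom)//.
have iRN := Radon_Nikodym_SigmaFinite.f_integrable dom.
apply: ae_eq_integral => //.
- by apply: emeasurable_funM => //; exact: measurable_int iRN.
- apply: emeasurable_funM => //; apply/measurable_EFinP.
  exact: measurable_normal_pdf.
- apply: ae_eqe_mul2l; apply: integral_ae_eq => //.
    by apply/measurable_EFinP; exact: measurable_normal_pdf.
  by move=> E _ mE; rewrite -Radon_Nikodym_SigmaFinite.f_integral.
Qed.

(** The image of Lebesgue measure under [x |-> a x + b], multiplied by [a],
    gives every interval its length. *)
Let ge0_integral_lebesgue_affine_pos (a b : R) (f : RR -> \bar R) : (0 < a)%R ->
  measurable_fun setT f -> (forall x, 0 <= f x) ->
  a%:E * \int[mu]_x f (a * x + b)%R = \int[mu]_x f x.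
Proof.
move=> a0 mf f0.
pose g (x : RR) : RR := (a * x + b)%R.
have mg : measurable_fun setT g.
  by apply: measurable_funD => //; exact: measurable_funM.
have k0 : (0 <= a)%R by exact: ltW.
have := ge0_integral_pushforward mg mu measurableT mf (fun y _ => f0 y).
rewrite preimage_setT => /= <-.
rewrite -(@ge0_integral_mscale _ _ _ _ _ measurableT (NngNum k0))//.
  apply/esym; apply: eq_measure_integral => A mA _; apply: lebesgue_measure_unique => //.
  move=> _ [[x y] _ <-].
  rewrite -[RHS]/(a%:E * mu (g @^-1` _)).
  rewrite (_ : g @^-1` _ = [set` Interval (BRight ((x - b) / a)%R) (BRight ((y - b) / a)%R)]); last first.
    apply/seteqP; split => z /=; rewrite !in_itv/= /g;
      by rewrite ltr_pdivrMr// ler_pdivlMr// ltrBlDr lerBrDr mulrC.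
  rewrite !lebesgue_measure_itv/= !lte_fin ltr_pM2r ?invr_gt0// ltrD2r.
  case: ifPn => xy; last by rewrite mule0.
  rewrite -EFinD -EFinM; congr EFin; field; exact: lt0r_neq0.
Qed.

Let ge0_integral_lebesgue_opp (f : RR -> \bar R) :
  measurable_fun setT f -> (forall x, 0 <= f x) ->
  \int[mu]_x f (- x)%R = \int[mu]_x f x.
Proof.
move=> mf f0.
pose g (x : RR) : RR := (- x)%R.
have mg : measurable_fun setT g by exact: measurableT_comp.
have := ge0_integral_pushforward mg mu measurableT mf (fun y _ => f0 y).
rewrite preimage_setT => /= <-.
apply/esym; apply: eq_measure_integral => A mA _; apply: lebesgue_measure_unique => //.
  move=> _ [[x y] _ <-].
  rewrite -[RHS]/(mu (g @^-1` _)).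
  rewrite (_ : g @^-1` _ = [set` Interval (BLeft (- y)%R) (BLeft (- x)%R)]); last first.
    apply/seteqP; split => z /=; rewrite !in_itv/= /g;
      by rewrite ltrNr lerNl andbC.
  rewrite !lebesgue_measure_itv/= !lte_fin ltrN2.
by case: ifPn => // xy; rewrite -!EFinD opprK addrC.
Qed.

Lemma ge0_integral_lebesgue_affine (a b : R) (f : RR -> \bar R) : a != 0%R ->
  measurable_fun setT f -> (forall x, 0 <= f x) ->
  `|a|%:E * \int[mu]_x f (a * x + b)%R = \int[mu]_x f x.
Proof.
move=> a0 mf f0; have [|] := ltP 0%R a => a_0.
  by rewrite gtr0_norm//; exact: ge0_integral_lebesgue_affine_pos.
have {}a_0 : (0 < - a)%R by rewrite oppr_gt0 lt_neqAle a0.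
rewrite ler0_norm; last by rewrite -oppr_ge0 ltW.
rewrite -[RHS](ge0_integral_lebesgue_affine_pos b a_0)//; congr (_ * _).
rewrite -(ge0_integral_lebesgue_opp (f := fun x => f (- a * x + b)%R))//.
  by apply: eq_integral => x _; rewrite mulrNN.
by apply: measurableT_comp => //; apply: measurable_funD.
Qed.

Lemma normal_pdf01N x : phi (- x)%R = phi x.
Proof. by rewrite normal_pdfE ?oner_neq0// /normal_fun !subr0 sqrrN. Qed.

Lemma ge0_integral_normalN (f : RR -> \bar R) :
  measurable_fun setT f -> (forall x, 0 <= f x) ->
  \int[N]_x f (- x)%R = \int[N]_x f x.
Proof.
move=> mf f0; have mfN : measurable_fun setT (fun x : RR => f (- x)%R).
  exact: measurableT_comp.
rewrite (ge0_integral_normal mfN); last by move=> x; exact: f0.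
rewrite (ge0_integral_normal mf f0).
have mK : measurable_fun setT (fun x : RR => f x * (phi x)%:E).
  by apply: emeasurable_funM => //; apply/measurable_EFinP; exact: measurable_normal_pdf.
rewrite -[RHS](ge0_integral_lebesgue_opp mK); last first.
  by move=> x; rewrite mule_ge0 ?lee_fin ?normal_pdf_ge0.
by apply: eq_integral => x _; rewrite normal_pdf01N.
Qed.

Lemma normal_pdf01M (x y : R) : (phi x * phi y =
  normal_peak 1 ^+ 2 * expR (- (x ^+ 2 + y ^+ 2) / 2))%R.
Proof.
rewrite normal_pdfE ?oner_neq0// /normal_fun !subr0 mulrACA -expr2 -expRD.
by rewrite expr1n -mulrDl opprD.
Qed.

Lemma normal_pdf01_rotation (a b x y : R) : (a ^+ 2 + b ^+ 2 = 1)%R ->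
  (phi (a * x + b * y) * phi (a * y - b * x) = phi x * phi y)%R.
Proof.
move=> ab1; rewrite !normal_pdf01M.
have -> : ((a * x + b * y) ^+ 2 + (a * y - b * x) ^+ 2 =
  (a ^+ 2 + b ^+ 2) * (x ^+ 2 + y ^+ 2))%R by ring.
by rewrite ab1 mul1r.
Qed.

(** For [a <> 0] substitute [x' = a x + b y] at fixed [y], then
    [y' = y / a - (b / a) x'] at fixed [x']: the two factors [|1/a|] and [|a|]
    cancel. For [a = 0] the map exchanges the coordinates up to signs. *)
Lemma ge0_lebesgue_rotation (a b : R) (f : RR * RR -> \bar R) :
  (a ^+ 2 + b ^+ 2 = 1)%R -> measurable_fun setT f -> (forall z, 0 <= f z) ->
  \int[mu]_x \int[mu]_y f (a * x + b * y, a * y - b * x)%R =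
  \int[mu]_x \int[mu]_y f (x, y).
Proof.
move=> ab1 mf f0.
have mf2 (g h : RR * RR -> RR) : measurable_fun setT g -> measurable_fun setT h ->
    measurable_fun setT (fun z => f (g z, h z)).
  by move=> mg mh; apply: measurableT_comp => //; exact: measurable_fun_pair.
have mlin (c e : R) : measurable_fun setT (fun z : RR * RR => c * z.1 + e * z.2)%R.
  by apply: measurable_funD; exact: measurable_funM.
have mrow (x : RR) (g h : RR * RR -> RR) :
    measurable_fun setT g -> measurable_fun setT h ->
    measurable_fun setT (fun y : RR => f (g (x, y), h (x, y))).
  by move=> mg mh; exact: (measurable_section1 x (mf2 _ _ mg mh)).
have mcol (y : RR) (g h : RR * RR -> RR) :
    measurable_fun setT g -> measurable_fun setT h ->
    measurable_fun setT (fun x : RR => f (g (x, y), h (x, y))).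
  by move=> mg mh; exact: (measurable_section2 y (mf2 _ _ mg mh)).
have [a0|a0] := eqVneq a 0%R.
  have b1 : `|b|%R = 1%R.
    apply/eqP; rewrite -sqrp_eq1// real_normK ?num_real//.
    by rewrite -ab1 a0 expr0n/= add0r.
  have b0 : b != 0%R by rewrite -normr_eq0 b1 oner_neq0.
  have b0N : (- b)%R != 0%R by rewrite oppr_eq0.
  transitivity (\int[mu]_x \int[mu]_y f (y, - b * x)%R).
    apply: eq_integral => x _; rewrite a0.
    under eq_integral do rewrite !mul0r !add0r -mulNr.
    rewrite -[RHS](ge0_integral_lebesgue_affine (f := fun y => f (y, - b * x)%R) 0 b0)//; last first.
      have := mrow x snd (fun z => - b * z.1)%R; apply => //.
      exact: measurable_funM.
    by rewrite b1 mul1e; under [RHS]eq_integral do rewrite addr0.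
  rewrite (fubini_tonelli (m1 := mu) (m2 := mu) (fun z : RR * RR => f (z.2, - b * z.1)%R)); last 2 first.
  - by apply: mf2 => //; exact: measurable_funM.
  - by move=> z; exact: f0.
  apply: eq_integral => y _.
  rewrite -[RHS](ge0_integral_lebesgue_affine (f := fun x => f (y, x)) 0 b0N)//; last first.
    exact: measurable_section1.
  by rewrite normrN b1 mul1e; under [RHS]eq_integral do rewrite addr0.
have aV0 : a^-1%R != 0%R by rewrite invr_eq0.
rewrite (fubini_tonelli (m1 := mu) (m2 := mu) (fun z : RR * RR => f (a * z.1 + b * z.2, a * z.2 - b * z.1)%R)); last 2 first.
- apply: mf2; first exact: mlin.
  by under eq_fun do rewrite addrC -mulNr; exact: mlin.
- by move=> z; exact: f0.
transitivity (\int[mu]_y \int[mu]_x (`|a^-1|%:E * f (x, a^-1 * y + (- b / a) * x)%R)).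
  apply: eq_integral => y _; rewrite ge0_integralZl//=; last first.
    apply: (mcol y fst (fun z => a^-1 * z.2 + (- b / a) * z.1)%R) => //.
    by apply: measurable_funD; exact: measurable_funM.
  rewrite -[in RHS](ge0_integral_lebesgue_affine (f := fun x => f (x, a^-1 * y + (- b / a) * x)%R) (b * y) a0)//; last first.
    apply: (mcol y fst (fun z => a^-1 * z.2 + (- b / a) * z.1)%R) => //.
    by apply: measurable_funD; exact: measurable_funM.
  rewrite muleA -EFinM -normrM mulVf// normr1 mul1e.
  apply: eq_integral => x _; congr (f (_, _)).
  have -> : (a * y - b * x = (a ^+ 2 * y - a * b * x) / a)%R by field.
  have -> : (a ^+ 2 = 1 - b ^+ 2)%R by rewrite -ab1 addrK.
  by field.
rewrite (fubini_tonelli (m1 := mu) (m2 := mu) (fun z : RR * RR => `|a^-1|%:E * f (z.2, a^-1 * z.1 + (- b / a) * z.2)%R)); last 2 first.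
- by apply: emeasurable_funM => //; apply: mf2 => //; exact: mlin.
- by move=> z; rewrite mule_ge0// lee_fin.
apply: eq_integral => x _; rewrite ge0_integralZl//=; last first.
  apply: (mcol x snd (fun z => a^-1 * z.1 + (- b / a) * z.2)%R) => //.
  exact: mlin.
rewrite -[RHS](ge0_integral_lebesgue_affine (f := fun y => f (x, y)) (- b / a * x) aV0)//.
exact: measurable_section1.
Qed.

(** The product density depends on [x^2 + y^2] only, and Lebesgue measure is
    invariant. *)
Lemma ge0_normal_rotation (a b : R) (f : RR * RR -> \bar R) :
  (a ^+ 2 + b ^+ 2 = 1)%R -> measurable_fun setT f -> (forall z, 0 <= f z) ->
  \int[N]_x \int[N]_y f (a * x + b * y, a * y - b * x)%R =
  \int[N]_x \int[N]_y f (x, y).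
Proof.
move=> ab1 mf f0.
have mphi : measurable_fun setT (EFin \o phi).
  by apply/measurable_EFinP; exact: measurable_normal_pdf.
have phi0 x : 0 <= (phi x)%:E by rewrite lee_fin normal_pdf_ge0.
pose K (z : RR * RR) := f z * (phi z.1 * phi z.2)%:E.
have mK : measurable_fun setT K.
  apply: emeasurable_funM => //; apply/measurable_EFinP.
  by apply: measurable_funM; (apply: measurableT_comp => //; exact: measurable_normal_pdf).
have K0 z : 0 <= K z by rewrite mule_ge0// EFinM mule_ge0.
have NE (g : RR * RR -> \bar R) : measurable_fun setT g -> (forall z, 0 <= g z) ->
    \int[N]_x \int[N]_y g (x, y) =
    \int[mu]_x \int[mu]_y (g (x, y) * (phi x * phi y)%:E).
  move=> mg g0; rewrite ge0_integral_normal; last 2 first.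
  - exact: measurable_fun_fubini_tonelli_F.
  - by move=> x; exact: integral_ge0.
  apply: eq_integral => x _; rewrite ge0_integral_normal//; last first.
    exact: measurable_section1.
  rewrite -ge0_integralZr//; last 2 first.
  - by apply: emeasurable_funM => //; exact: measurable_section1.
  - by move=> y _; rewrite mule_ge0.
  by apply: eq_integral => y _; rewrite -muleA -EFinM (mulrC (phi y)).
rewrite (NE f mf f0) -[RHS](ge0_lebesgue_rotation ab1 mK K0).
rewrite (NE (fun z : RR * RR => f (a * z.1 + b * z.2, a * z.2 - b * z.1)%R)); last 2 first.
- apply: measurableT_comp => //; apply: measurable_fun_pair => /=.
    by apply: measurable_funD; exact: measurable_funM.
  by apply: measurable_funB; exact: measurable_funM.
- by move=> z; exact: f0.
apply: eq_integral => x _; apply: eq_integral => y _.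
by rewrite /K /= normal_pdf01_rotation.
Qed.

End gaussian_rotation.

(** * The joint law of two inner products *)

Section gaussian_vectors.
Context (R : realType).
Local Notation RR := (measurableTypeR R).
Local Notation N := (normal_prob 0 1 : probability RR R).
Notation gvec d := (d.-tuple RR).

Definition dot d (x y : gvec d) : R :=
  \sum_(k < d) (tnth x k : R) * (tnth y k : R).

Lemma dotS d (x0 y0 : RR) (x y : gvec d) :
  dot (tuple_cons (x0, x)) (tuple_cons (y0, y)) =
  (x0 : R) * (y0 : R) + dot x y.
Proof.
rewrite /dot big_ord_recl; congr (_ + _).
by apply: eq_bigr => i _; rewrite !tnthS.
Qed.

Lemma dot_ge0 d (x : gvec d) : 0 <= dot x x.
Proof. by apply: sumr_ge0 => k _; rewrite -expr2 sqr_ge0. Qed.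

Lemma measurable_dot d :
  measurable_fun setT (fun z : gvec d * gvec d => dot z.1 z.2 : RR).
Proof.
apply: measurable_sum => k; apply: measurable_funM.
  by apply: (measurableT_comp (@measurable_tnth _ RR d k)).
by apply: (measurableT_comp (@measurable_tnth _ RR d k)).
Qed.

Lemma measurable_dotr d (x : gvec d) :
  measurable_fun setT (fun y : gvec d => dot x y : RR).
Proof. exact: (measurable_section1 x (@measurable_dot d)). Qed.

Lemma scaled_dotE d (x y : gvec d) :
  scaled_dot x y = (Num.sqrt d%:R)^-1 * dot x y.
Proof. by []. Qed.

Lemma ge0_integral_iidS d (T : measurableType d) (P : probability T R) n
    (f : n.+1.-tuple T -> \bar R) : measurable_fun setT f ->
  (forall t, 0 <= f t)%E ->
  (\int[iid_prob P n.+1]_t f t =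
   \int[P]_x \int[iid_prob P n]_t f (tuple_cons (x, t)))%E.
Proof.
move=> mf f0 /=.
rewrite (ge0_integral_distribution (P := (P \x iid_prob P n)%E) (@tuple_cons d T n) mf f0).
rewrite (@fubini_tonelli1 _ _ _ _ _ P (iid_prob P n))//.
  exact: measurableT_comp.
by move=> z; exact: f0.
Qed.

(** Polar coordinates of the point [(x, a)]. They turn a combination
    [x y0 + a u] of two independent normal variables into [r] times one. *)
Lemma unit_direction (x a : R) : exists r al be : R,
  [/\ 0 <= r, r ^+ 2 = x ^+ 2 + a ^+ 2, al ^+ 2 + be ^+ 2 = 1,
      r * al = x & r * be = a].
Proof.
have r2 : 0 <= x ^+ 2 + a ^+ 2 by rewrite addr_ge0// sqr_ge0.
have [r0|r0] := eqVneq (x ^+ 2 + a ^+ 2) 0.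
  exists 0, 1, 0; split => //.
  - by rewrite expr0n/= r0.
  - by rewrite expr1n expr0n addr0.
  - move: r0 => /eqP; rewrite paddr_eq0 ?sqr_ge0// => /andP[+ _].
    by rewrite sqrf_eq0 => /eqP ->; rewrite mul0r.
  - move: r0 => /eqP; rewrite paddr_eq0 ?sqr_ge0// => /andP[_].
    by rewrite sqrf_eq0 => /eqP ->; rewrite mul0r.
set r := Num.sqrt (x ^+ 2 + a ^+ 2).
have rE : r ^+ 2 = x ^+ 2 + a ^+ 2 by rewrite sqr_sqrtr.
have rn0 : r != 0 by rewrite -sqrf_eq0 rE.
exists r, (x / r), (a / r); split => //.
- by rewrite sqrtr_ge0.
- by rewrite !expr_div_n -mulrDl -rE divff// rE.
- by rewrite mulrC divfK.
- by rewrite mulrC divfK.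
Qed.

(** The inner products of a Gaussian vector with [x] and [x'] form a centred
    Gaussian pair, written here through the Cholesky factor [(a, 0), (b, c)] of
    its covariance matrix. In the induction on the dimension a new coordinate
    [y0] is merged with [u] by a rotation; what is left of it in the second
    component is merged with [w] by another one. Only rotations of the plane
    are needed in this way. *)
Lemma gauss_pair_law d (x x' : gvec d) : exists a b c : R,
  [/\ (0 <= a) && (0 <= c), a ^+ 2 = dot x x, a * b = dot x x', b ^+ 2 + c ^+ 2 = dot x' x' &
  forall g : RR * RR -> \bar R, measurable_fun setT g -> (forall z, 0 <= g z)%E ->
    (\int[gauss_vec R d]_y g (dot x y, dot x' y) =
     \int[N]_u \int[N]_w g ((a * u)%R, (b * u + c * w)%R))%E].
Proof.
elim: d x x' => [|d IHd] x x'.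
  have d0 (y z : gvec 0) : dot y z = 0 by rewrite /dot big_ord0.
  exists 0, 0, 0; split; rewrite ?lexx ?d0 ?mulr0 ?expr0n/= ?addr0//.
  move=> g mg g0; rewrite /gauss_vec /=.
  under eq_integral do rewrite !d0.
  rewrite integral_dirac//= diracT mul1e.
  under [RHS]eq_integral do under eq_integral do rewrite !mul0r addr0.
  under [RHS]eq_integral do rewrite integral_cst//= probability_setT mule1.
  by rewrite integral_cst//= probability_setT mule1.
case/tupleP: x => x0 x; case/tupleP: x' => x0' x'.
have [a [b [c [_ aE abE bcE IH]]]] := IHd x x'.
rewrite -[[tuple of x0 :: x]]/(tuple_cons (x0, x)).
rewrite -[[tuple of x0' :: x']]/(tuple_cons (x0', x')).
have [r [al [be [r0 rE albe ral rbe]]]] := unit_direction x0 a.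
(* In the rotated coordinates, [x0' y0 + b u] has components [b'] and [c']. *)
pose b' := x0' * al + b * be; pose c' := b * al - x0' * be.
have [s [al' [be' [s0 sE albe' sal sbe]]]] := unit_direction c' c.
exists r, b', s; split; rewrite ?dotS -?expr2//.
- by rewrite r0.
- by rewrite rE aE.
- by rewrite -abE -ral -rbe /b'; ring.
- rewrite sE -bcE /b' /c'.
  transitivity ((x0' ^+ 2 + b ^+ 2) * (al ^+ 2 + be ^+ 2) + c ^+ 2); first by ring.
  by rewrite albe; ring.
move=> g mg g0.
have mgc (D : measure_display) (X : measurableType D) (h k : X -> RR) :
    measurable_fun setT h -> measurable_fun setT k ->
    measurable_fun setT (fun z => g (h z, k z)).
  by move=> mh mk; apply: measurableT_comp => //; exact: measurable_fun_pair.
rewrite ge0_integral_iidS; last 2 first.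
- by apply: mgc; exact: measurable_dotr.
- by move=> t; exact: g0.
transitivity (\int[N]_y0 \int[N]_u \int[N]_w
    g ((x0 * y0 + a * u)%R, (x0' * y0 + (b * u + c * w))%R))%E.
  apply: eq_integral => y0 _; under eq_integral do rewrite !dotS.
  rewrite (IH (fun z => g ((x0 * y0 + z.1)%R, (x0' * y0 + z.2)%R)))//.
  by apply: mgc; apply: measurable_funD.
pose G (z : RR * RR) := (\int[N]_w g ((r * z.1)%R, (b' * z.1 + (c' * z.2 + c * w))%R))%E.
have mG : measurable_fun setT G.
  apply: (@measurable_fun_fubini_tonelli_F _ _ _ _ R N
    (fun q : (RR * RR) * RR => g ((r * q.1.1)%R, (b' * q.1.1 + (c' * q.1.2 + c * q.2))%R))).
    apply: mgc.
      by apply: measurable_funM => //; exact: measurableT_comp.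
    apply: measurable_funD; first by apply: measurable_funM => //; exact: measurableT_comp.
    apply: measurable_funD; first by apply: measurable_funM => //; exact: measurableT_comp.
    by apply: measurable_funM => //; exact: measurableT_comp.
  by move=> q; exact: g0.
have G0 z : (0 <= G z)%E by apply: integral_ge0.
transitivity (\int[N]_y0 \int[N]_u G ((al * y0 + be * u)%R, (al * u - be * y0)%R))%E.
  apply: eq_integral => y0 _; apply: eq_integral => u _; apply: eq_integral => w _.
  congr (g (_, _)).
    by rewrite /= -ral -rbe; ring.
  rewrite /= /b' /c'.
  transitivity ((al ^+ 2 + be ^+ 2) * (x0' * y0 + b * u) + c * w); last by ring.
  by rewrite albe; ring.
rewrite (ge0_normal_rotation albe mG G0).
apply: eq_integral => u _.
pose H (z : RR * RR) := g ((r * u)%R, (b' * u + s * z.1)%R).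
have mH : measurable_fun setT H.
  by apply: mgc => //; apply: measurable_funD => //; exact: measurable_funM.
have H0 z : (0 <= H z)%E by exact: g0.
transitivity (\int[N]_t \int[N]_w H ((al' * t + be' * w)%R, (al' * w - be' * t)%R))%E.
  apply: eq_integral => t _; apply: eq_integral => w _; rewrite /H/=.
  congr (g (_, _)); rewrite -sal -sbe; ring.
rewrite (ge0_normal_rotation albe' mH H0); apply: eq_integral => t _.
by rewrite /H/= integral_cst//= probability_setT mule1.
Qed.

Lemma gauss_dot_law d (x : gvec d) (g : RR -> \bar R) :
  measurable_fun setT g -> (forall z, 0 <= g z)%E ->
  (\int[gauss_vec R d]_y g (dot x y) =
   \int[N]_u g ((Num.sqrt (dot x x) * u)%R))%E.
Proof.
move=> mg g0; have [a [b [c [/andP[a0 _] aE _ _ law]]]] := gauss_pair_law x x.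
have -> : Num.sqrt (dot x x) = a by rewrite -aE sqrtr_sqr ger0_norm.
rewrite (law (fun z => g z.1))//; last exact: measurableT_comp.
apply: eq_integral => u _ /=.
by rewrite integral_cst//= probability_setT mule1.
Qed.

End gaussian_vectors.

(** * The standard normal law *)

Lemma indic_bool (T : Type) (R : realType) (q : pred T) x :
  \1_[set y | q y] x = (q x)%:R :> R.
Proof.
by rewrite indicE; have [qx|qx] := boolP (q x); [rewrite mem_set|rewrite memNset//; exact/negP].
Qed.

Lemma normr_bool_le1 (R : realType) (b : bool) : `|b%:R| <= 1 :> R.
Proof. by case: b; rewrite ?normr1 ?normr0. Qed.

Section normal_facts.
Context (R : realType).
Local Notation RR := (measurableTypeR R).
Local Notation mu := (@lebesgue_measure R).
Local Notation N := (normal_prob 0 1 : probability RR R).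
Local Notation phi := (@normal_pdf R 0 1).

Lemma normal_peak1_le1 : normal_peak 1 <= 1 :> R.
Proof.
rewrite /normal_peak invf_le1; last first.
  by rewrite sqrtr_gt0 expr1n mul1r mulrn_wgt0// pi_gt0.
rewrite -[leLHS]sqrtr1 ler_wsqrtr// expr1n mul1r -mulr_natr.
have := @pi_ge2 R; lra.
Qed.

(** Makes [u^8] times the standard density comparable to a normal density of
    larger variance. *)
Lemma pow8_le_expR (u : R) : u ^+ 8 <= 16 ^+ 4 * expR (u ^+ 2 / 4).
Proof.
have e1 : u ^+ 2 / 16 <= expR (u ^+ 2 / 16).
  by apply: le_trans (expR_ge1Dx _); rewrite lerDr.
have e4 : expR (u ^+ 2 / 4) = expR (u ^+ 2 / 16) ^+ 4.
  by rewrite -expRM_natl; congr expR; field.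
have u0 : 0 <= u ^+ 2 / 16 by rewrite divr_ge0// sqr_ge0.
have : (u ^+ 2 / 16) ^+ 4 <= expR (u ^+ 2 / 16) ^+ 4.
  by rewrite lerXn2r ?nnegrE// expR_ge0.
by rewrite e4 expr_div_n -exprM ler_pdivrMr ?exprn_gt0// mulrC.
Qed.

(** Up to a constant, [u^8] times the density is below the density of the
    normal law of variance [2]. *)
Lemma L1_normal_pow8 : L1 N (fun u : RR => (u : R) ^+ 8).
Proof.
have m8 : measurable_fun setT (fun u : RR => (u : R) ^+ 8 : RR).
  exact: measurable_funX.
apply/integrableP; split; first exact/measurable_EFinP.
rewrite ge0_integral_normal//; last first.
  by apply: measurableT_comp => //; exact/measurable_EFinP.
have s0 : Num.sqrt 2 != 0 :> R by rewrite gt_eqF// sqrtr_gt0.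
pose C := 16 ^+ 4 / normal_peak (Num.sqrt 2) : R.
apply: (@le_lt_trans _ _ (\int[mu]_x (C%:E * (normal_pdf 0 (Num.sqrt 2) x)%:E))%E).
  apply: ge0_le_integral => //.
  - by move=> x _; rewrite mule_ge0// lee_fin normal_pdf_ge0.
  - apply: emeasurable_funM; last first.
      by apply/measurable_EFinP; exact: measurable_normal_pdf.
    by apply: measurableT_comp => //; exact/measurable_EFinP.
  - apply: emeasurable_funM => //.
    by apply/measurable_EFinP; exact: measurable_normal_pdf.
  move=> x _; rewrite /= -!EFinM lee_fin ger0_norm ?exprn_even_ge0//.
  rewrite !normal_pdfE ?oner_neq0// /normal_fun !subr0.
  rewrite [leRHS]mulrA /C divfK ?gt_eqF ?normal_peak_gt0//.
  rewrite sqr_sqrtr// expr1n.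
  have -> : expR (- x ^+ 2 / (1 *+ 2)) =
      expR (- (x ^+ 2 / 4)) * expR (- x ^+ 2 / (2 *+ 2)).
    by rewrite -expRD; congr expR; field.
  rewrite (mulrA (normal_peak 1)) [leLHS]mulrA ler_pM2r ?expR_gt0//.
  have p8 := pow8_le_expR x.
  have e0 := expR_gt0 (- (x ^+ 2 / 4)).
  rewrite mulrC -mulrA; apply: (@le_trans _ _ (expR (- (x ^+ 2 / 4)) * x ^+ 8)).
    rewrite ler_piMl// ?normal_peak1_le1// mulr_ge0 ?expR_ge0//.
    by rewrite exprn_even_ge0.
  rewrite mulrC -ler_pdivlMr// -expRN opprK//.
rewrite ge0_integralZl//; last 3 first.
- by apply/measurable_EFinP; exact: measurable_normal_pdf.
- by move=> x _; rewrite lee_fin normal_pdf_ge0.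
- by rewrite lee_fin divr_ge0// normal_peak_ge0.
by rewrite integral_normal_pdf mule1 ltry.
Qed.

Lemma L1_normal_pow k : (k <= 8)%N -> L1 N (fun u : RR => (u : R) ^+ k).
Proof.
move=> k8; apply: (@L1_dominated _ _ _ _ _ (fun u : RR => 1 + (u : R) ^+ 8)).
- exact: measurable_funX.
- apply: L1D; [exact: L1_cst|exact: L1_normal_pow8].
move=> u; rewrite normrX -[X in 1 + X]ger0_norm ?exprn_even_ge0// normrX.
have [u1|u1] := leP `|u : R| 1.
  by apply: (@le_trans _ _ 1); [exact: exprn_ile1|rewrite lerDl exprn_ge0].
by rewrite (le_trans (ler_weXn2l (ltW u1) k8))// lerDr.
Qed.

Lemma Rintegral_normal_id : \int[N]_u (u : R) = 0.
Proof.
rewrite /Rintegral integralE.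
have m1 : measurable_fun setT (fun u : RR => (u : R)%:E) by apply/measurable_EFinP.
have mp := measurable_funepos m1.
rewrite -(ge0_integral_normalN mp); last by move=> x; exact: funepos_ge0.
have iNE : (\int[N]_x (fun u : RR => (u : R)%:E)^\- x =
    \int[N]_x (fun u : RR => (u : R)%:E)^\+ (- x)%R)%E.
  by apply: eq_integral => x _; rewrite funeposE funenegE EFinN.
rewrite iNE subee// -iNE.
apply: integrable_neg_fin_num => //.
exact: (L1_normal_pow (k := 1)).
Qed.

Lemma normal_itv_le (a b B : R) : a <= b ->
  (forall x, a < x <= b -> phi x <= B) ->
  \int[N]_u (a < (u : R) <= b)%R%:R <= B * (b - a).
Proof.
move=> ab phiB.
have mab : measurable [set` Interval (BRight a) (BRight b)] by exact: measurable_itv.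
have -> : \int[N]_u (a < (u : R) <= b)%R%:R = fine (N [set` Interval (BRight a) (BRight b)]).
  rewrite -Rintegral_indic//; apply: eq_Rintegral => u _.
  by rewrite indic_bool in_itv.
have : (N [set` Interval (BRight a) (BRight b)] <= (B * (b - a))%:E)%E.
  rewrite /normal_prob.
  apply: (@le_trans _ _ (\int[mu]_(x in [set` Interval (BRight a) (BRight b)]) B%:E)%E).
    apply: ge0_le_integral => //.
    - by move=> x _; rewrite lee_fin normal_pdf_ge0.
    - by apply/measurable_funTS/measurable_EFinP; exact: measurable_normal_pdf.
  rewrite integral_cst//.
  have := @lebesgue_measure_itv R (Interval (BRight a) (BRight b)).
  rewrite /= lte_fin => ->.
  case: ifPn => // ab'; rewrite ?mule0 -?EFinD -?EFinM//.
  have -> : b = a by apply/eqP; rewrite eq_le ab andbT leNgt.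
  by rewrite subrr mulr0.
move=> /fine_le; apply => //.
exact: fin_num_measure.
Qed.

Lemma normal_pdf_le1 x : phi x <= 1.
Proof. exact: le_trans (normal_pdf_ub 0 x (oner_neq0 R)) normal_peak1_le1. Qed.

Lemma normal_pdf_le_inv x : x != 0 -> phi x <= `|x|^-1.
Proof.
move=> x0; rewrite normal_pdfE ?oner_neq0// /normal_fun subr0.
have nx0 : 0 < `|x| by rewrite normr_gt0.
rewrite -[leRHS]mul1r ler_pdivlMr// -mulrA.
have e0 := expR_gt0 (- x ^+ 2 / (1 ^+ 2 *+ 2) : R).
apply: (@le_trans _ _ (expR (- x ^+ 2 / (1 ^+ 2 *+ 2)) * `|x|)).
  by rewrite ler_piMl ?normal_peak1_le1// mulr_ge0// ltW.
rewrite mulrC -ler_pdivlMr// div1r -expRN expr1n mulNr opprK.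
apply: le_trans (expR_ge1Dx _).
have -> : x ^+ 2 = `|x| ^+ 2 by rewrite real_normK// num_real.
have := sqr_ge0 (`|x| - 1); rewrite -mulr_natr; nra.
Qed.

Definition ncdf (t : R) : R := \int[N]_u ((u : R) <= t)%R%:R.

Lemma measurable_itv_indic d (T : measurableType d) (f : T -> RR) (b : RR) :
  measurable_fun setT f ->
  measurable_fun setT (fun x => ((f x : R) <= (b : R))%R%:R : RR).
Proof.
move=> mf; rewrite (_ : (fun x => _) = \1_(f @^-1` [set` Interval -oo%O (BRight (b : R))])).
  apply: measurable_indic; rewrite -[X in measurable X]setTI.
  by apply: mf => //; exact: measurable_itv.
by apply/funext => x; rewrite indic_bool/= in_itv.
Qed.

Lemma ncdf_sub (a b : R) : a <= b ->
  ncdf b - ncdf a = \int[N]_u (a < (u : R) <= b)%R%:R.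
Proof.
move=> ab; rewrite /ncdf -RintegralB//.
- apply: eq_Rintegral => u _; have [ua|au] := leP (u : R) a.
    by rewrite (le_trans ua ab)/= subrr.
  by rewrite /= subr0.
- apply: (L1_bounded _ (M := 1)); first exact: measurable_itv_indic.
  by move=> u; exact: normr_bool_le1.
- apply: (L1_bounded _ (M := 1)); first exact: measurable_itv_indic.
  by move=> u; exact: normr_bool_le1.
Qed.

Lemma ncdf_lipschitz (a b : R) : `|ncdf b - ncdf a| <= `|b - a|.
Proof.
wlog ab : a b / a <= b.
  by move=> W; have [/W//|/ltW/W] := leP a b; rewrite distrC (distrC a).
rewrite ncdf_sub// (ger0_norm (x := b - a)) ?subr_ge0//.
rewrite ger0_norm; last by apply: Rintegral_ge0.
rewrite -[leRHS]mul1r; apply: normal_itv_le => // x _; exact: normal_pdf_le1.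
Qed.

(** Between [a] and [l a] the density is at most [1 / |a|], on an interval of
    length [(l - 1) |a|]. *)
Lemma ncdf_scale (a l : R) : 1 <= l -> `|ncdf (l * a) - ncdf a| <= l - 1.
Proof.
move=> l1; have l0 : 0 < l by exact: lt_le_trans l1.
have [a0|a0|->] := ltgtP a 0; last by rewrite mulr0 subrr normr0 subr_ge0.
- have laa : l * a <= a by rewrite -[leRHS]mul1r ler_wnM2r// ltW.
  rewrite distrC ncdf_sub// ger0_norm; last by apply: Rintegral_ge0.
  apply: (@le_trans _ _ (`|a|^-1 * (a - l * a))).
    apply: normal_itv_le => // x /andP[_ xa].
    have x0 : x < 0 by exact: le_lt_trans a0.
    rewrite (le_trans (normal_pdf_le_inv _)) ?lt_eqF// lef_pV2 ?posrE ?normr_gt0 ?lt_eqF//.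
    by rewrite !ltr0_norm// lerN2.
  rewrite ltr0_norm// invrN mulNr -mulrN opprB -[X in l * a - X]mul1r -mulrBl.
  by rewrite mulrC mulfK// lt_eqF.
- have laa : a <= l * a by rewrite -[leLHS]mul1r ler_wpM2r// ltW.
  rewrite ncdf_sub// ger0_norm; last by apply: Rintegral_ge0.
  apply: (@le_trans _ _ (`|a|^-1 * (l * a - a))).
    apply: normal_itv_le => // x /andP[xa _].
    have x0 : 0 < x by exact: lt_trans xa.
    rewrite (le_trans (normal_pdf_le_inv _)) ?gt_eqF// lef_pV2 ?posrE ?normr_gt0 ?gt_eqF//.
    by rewrite !gtr0_norm// ltW.
  rewrite gtr0_norm// -[X in l * a - X]mul1r -mulrBl.
  by rewrite mulrC mulfK// gt_eqF.
Qed.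

(** The density is at most [1], so at least half of the mass lies outside
    [[-1/4, 1/4]]. *)
Lemma normal_var_gt0 : 0 < \int[N]_u (u : R) ^+ 2.
Proof.
have i4 : \int[N]_u ((- 4^-1) < (u : R) <= 4^-1)%R%:R <= 1 * (4^-1 - - 4^-1).
  by apply: normal_itv_le => [|x _]; [lra|exact: normal_pdf_le1].
have mI : measurable_fun setT (fun u : RR => ((- 4^-1) < (u : R) <= 4^-1)%R%:R : RR).
  rewrite (_ : (fun x => _) = \1_([set` Interval (BRight (- 4^-1 : R)) (BRight (4^-1 : R))])).
    by apply: measurable_indic; exact: measurable_itv.
  by apply/funext => x; rewrite indic_bool in_itv.
have iI : L1 N (fun u : RR => ((- 4^-1) < (u : R) <= 4^-1)%R%:R).
  apply: (L1_bounded _ (M := 1)) => // u.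
  exact: normr_bool_le1.
apply: (@lt_le_trans _ _ (\int[N]_u (16^-1 * (1 - ((- 4^-1) < (u : R) <= 4^-1)%R%:R)))).
  rewrite RintegralZl//; last by apply: L1B => //; exact: L1_cst.
  rewrite RintegralB//; last exact: L1_cst.
  by rewrite (Rintegral_cstT N); move: i4; set I := Rintegral _ _ _ => i4; lra.
apply: le_RintegralT.
- by apply: L1Z; apply: L1B => //; exact: L1_cst.
- exact: (L1_normal_pow (k := 2)).
move=> u; have [_|] := boolP (- 4^-1 < (u : R) <= 4^-1); first by rewrite subrr mulr0 sqr_ge0.
rewrite negb_and -leNgt -ltNge subr0 mulr1 => /orP[] u4; nra.
Qed.

End normal_facts.

(** * Moments of inner products *)

Section power_integrability.
Context d (T : measurableType d) (R : realType) (P : probability T R).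

Lemma L1_pow (f : T -> R) m k : measurable_fun setT f -> (k <= m.*2)%N ->
  L1 P (fun x => f x ^+ m.*2) -> L1 P (fun x => f x ^+ k).
Proof.
move=> mf km iF; apply: (@L1_dominated _ _ _ _ _ (fun x => 1 + f x ^+ m.*2)).
- exact: measurable_funX.
- by apply: L1D => //; exact: L1_cst.
move=> x; have e0 : 0 <= f x ^+ m.*2 by rewrite exprn_even_ge0// odd_double.
rewrite normrX; have [f1|f1] := leP `|f x| 1.
  by apply: (@le_trans _ _ 1); [exact: exprn_ile1|rewrite lerDl].
rewrite (le_trans (ler_weXn2l (ltW f1) km))// -normrX ger0_norm// lerDr//.
Qed.

End power_integrability.

Section product_moments.
Context d1 d2 (T1 : measurableType d1) (T2 : measurableType d2) (R : realType).
Variables (P1 : probability T1 R) (P2 : probability T2 R).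

Lemma Rintegral_prod (f : T1 -> R) (g : T2 -> R) : L1 P1 f -> L1 P2 g ->
  \int[(P1 \x P2)%E]_z (f z.1 * g z.2) = (\int[P1]_x f x) * (\int[P2]_y g y).
Proof.
move=> iF ig; rewrite (Fubini12 (f := fun z => f z.1 * g z.2)); last exact: L1_prod.
rewrite -RintegralZr//; apply: eq_Rintegral => x _.
by rewrite -RintegralZl.
Qed.

Lemma L1_iterated (f : T1 * T2 -> R) (g : T1 -> R) : measurable_fun setT f ->
  (forall z, 0 <= f z) -> L1 P1 g ->
  (forall x, (\int[P2]_y (f (x, y))%:E = (g x)%:E)%E) ->
  L1 (P1 \x P2)%E f /\ \int[(P1 \x P2)%E]_z f z = \int[P1]_x g x.
Proof.
move=> mf f0 ig fg; have mF : measurable_fun setT (EFin \o f) by exact/measurable_EFinP.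
have g0 x : 0 <= g x.
  by rewrite -lee_fin -fg; apply: integral_ge0 => y _; rewrite lee_fin.
have iF : L1 (P1 \x P2)%E f.
  apply/integrable12ltyP => //.
  under eq_integral => x _.
    under eq_integral => y _ do rewrite /= ger0_norm//.
    rewrite fg -[g x]ger0_norm//.
    over.
  by have /integrableP[] := ig.
split => //; rewrite (Fubini12 iF); apply: eq_Rintegral => x _.
by rewrite /Rintegral fg.
Qed.

End product_moments.

Section iid_moments.
Context d (T : measurableType d) (R : realType) (P : probability T R).

Lemma L1_iidS n (f : n.+1.-tuple T -> R) : measurable_fun setT f ->
  L1 (P \x iid_prob P n)%E (f \o @tuple_cons d T n) ->
  L1 (iid_prob P n.+1) f /\
  \int[iid_prob P n.+1]_t f t =
  \int[(P \x iid_prob P n)%E]_z f (tuple_cons z).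
Proof.
move=> mf ifc; have mF : measurable_fun setT (EFin \o f) by exact/measurable_EFinP.
split; last first.
  rewrite /Rintegral /=; congr fine.
  by rewrite integral_distribution//; exact/measurable_EFinP.
apply/integrableP; split => //=.
rewrite (ge0_integral_distribution (P := (P \x iid_prob P n)%E) (@tuple_cons d T n)
  (f := fun t => `|(f t)%:E|%E))//.
- by have /integrableP[] := ifc.
- exact: measurableT_comp.
Qed.

Variables (f : T -> R) (B : R).
Hypotheses (mf : measurable_fun setT f) (f4 : L1 P (fun x => f x ^+ 4)).
Hypotheses (f1 : \int[P]_x f x = 0).
Hypotheses (f4B : \int[P]_x f x ^+ 4 <= B).
Hypotheses (f2B : (\int[P]_x f x ^+ 2) ^+ 2 <= B).

Definition iid_sum n (t : n.-tuple T) : R := \sum_(k < n) f (tnth t k).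

Lemma measurable_iid_sum n : measurable_fun setT (@iid_sum n).
Proof.
apply: measurable_sum => k; apply: measurableT_comp => //.
exact: measurable_tnth.
Qed.

Lemma iid_sumS n x (t : n.-tuple T) :
  iid_sum (tuple_cons (x, t)) = f x + iid_sum t.
Proof.
rewrite /iid_sum big_ord_recl; congr (_ + _).
by apply: eq_bigr => i _; rewrite tnthS.
Qed.

(** Expanding [(f x + S)^4] by independence, the terms that contain a first
    moment vanish and at most [3 n^2] terms survive. A common bound [B] on
    [E f^4] and [(E f^2)^2] keeps the induction linear. *)
Lemma iid_sum_moments n :
  [/\ L1 (iid_prob P n) (fun t => iid_sum t ^+ 4),
      \int[iid_prob P n]_t iid_sum t = 0,
      \int[iid_prob P n]_t iid_sum t ^+ 2 = n%:R * \int[P]_x f x ^+ 2 &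
      \int[iid_prob P n]_t iid_sum t ^+ 4 <= 3 * n%:R ^+ 2 * B].
Proof.
elim: n => [|n [i4 e1 e2 e4]].
  have s0 (t : 0.-tuple T) : iid_sum t = 0 by rewrite /iid_sum big_ord0.
  split.
  - apply: (L1_bounded _ (M := 0)) => [|t]; last by rewrite s0 expr0n normr0.
    by apply: measurable_funX; exact: measurable_iid_sum.
  - by rewrite Rintegral_iid0 s0.
  - by rewrite Rintegral_iid0 s0 expr0n/= mul0r.
  - by rewrite Rintegral_iid0 s0 !expr0n/= mulr0 mul0r.
set Q := iid_prob P n.
have mS := @measurable_iid_sum n.
have ifk k : (k <= 4)%N -> L1 P (fun x => f x ^+ k).
  by move=> k4; exact: (L1_pow (m := 2) mf k4).
have iSk k : (k <= 4)%N -> L1 Q (fun t => iid_sum t ^+ k).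
  by move=> k4; exact: (L1_pow (m := 2) mS k4).
have ifS k l : (k <= 4)%N -> (l <= 4)%N ->
    L1 (P \x Q)%E (fun z => f z.1 ^+ k * iid_sum z.2 ^+ l).
  by move=> k4 l4; apply: (L1_prod (f := fun x => f x ^+ k) (g := fun t => iid_sum t ^+ l));
    [exact: ifk|exact: iSk].
have EfS k l : (k <= 4)%N -> (l <= 4)%N ->
    \int[(P \x Q)%E]_z (f z.1 ^+ k * iid_sum z.2 ^+ l) =
    (\int[P]_x f x ^+ k) * (\int[Q]_t iid_sum t ^+ l).
  by move=> k4 l4; rewrite (Rintegral_prod (f := fun x => f x ^+ k) (g := fun t => iid_sum t ^+ l));
    [|exact: ifk|exact: iSk].
have Ef1 : \int[P]_x f x ^+ 1 = 0 by [].
have ES1 : \int[Q]_t iid_sum t ^+ 1 = 0 by [].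
have Ef0 : \int[P]_x f x ^+ 0 = 1 by exact: Rintegral_cstT.
have ES0 : \int[Q]_t iid_sum t ^+ 0 = 1 by exact: Rintegral_cstT.
have expand m : (m <= 4)%N -> L1 (iid_prob P n.+1) (fun t => iid_sum t ^+ m) /\
    \int[iid_prob P n.+1]_t iid_sum t ^+ m =
    \sum_(i < m.+1) ((\int[P]_x f x ^+ (m - i)) * (\int[Q]_t iid_sum t ^+ i)) *+ 'C(m, i).
  move=> m4; have m4i (i : 'I_m.+1) : (i <= 4)%N.
    by rewrite (leq_trans _ m4)// -ltnS.
  have m4s (i : 'I_m.+1) : (m - i <= 4)%N by rewrite (leq_trans (leq_subr _ _)).
  have eqS : (fun t : n.+1.-tuple T => iid_sum t ^+ m) \o @tuple_cons d T n =
     (fun z => \sum_(i < m.+1) 'C(m, i)%:R * (f z.1 ^+ (m - i) * iid_sum z.2 ^+ i)).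
    apply/funext => -[x t]/=; rewrite iid_sumS exprDn.
    by apply: eq_bigr => i _; rewrite mulr_natl.
  have iS : L1 (P \x Q)%E ((fun t : n.+1.-tuple T => iid_sum t ^+ m) \o @tuple_cons d T n).
    by rewrite eqS; apply: L1_sum => i _; apply: L1Z; exact: ifS.
  have [|i1 ->] := L1_iidS _ iS.
    by apply: measurable_funX; exact: measurable_iid_sum.
  split => //; transitivity (\int[(P \x Q)%E]_z (\sum_(i < m.+1)
      'C(m, i)%:R * (f z.1 ^+ (m - i) * iid_sum z.2 ^+ i))).
    by apply: eq_Rintegral => z _; have := congr1 (@^~ z) eqS.
  rewrite Rintegral_sum; last by move=> i _; apply: L1Z; exact: ifS.
  by apply: eq_bigr => i _; rewrite RintegralZl ?EfS// ?mulr_natl//; exact: ifS.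
have [i41 E4] := expand 4%N isT.
have [_ E2] := expand 2%N isT.
have [_ E1] := expand 1%N isT.
split => //.
- have -> : 0 = \int[iid_prob P n.+1]_t iid_sum t ^+ 1; last by [].
  rewrite E1 !big_ord_recl big_ord0 /= subn0 subnn Ef1 ES1 mul0r mulr0 !mul0rn !addr0//.
- rewrite E2 !big_ord_recl big_ord0/= /bump/= !subn0 !add1n ?subnn.
  rewrite (_ : (2 - 1 = 1)%N)// Ef1 Ef0 ES0 mul0r mul0rn e2 bin0 binn !mulr1n.
  by rewrite -natr1; ring.
- rewrite E4 !big_ord_recl big_ord0/= /bump/= !subn0 !add1n ?subnn.
  rewrite (_ : (4 - 1 = 3)%N)// (_ : (4 - 2 = 2)%N)// (_ : (4 - 3 = 1)%N)//.
  rewrite Ef1 Ef0 ES0 ES1 mul0r mulr0 !mul0rn e2 bin0 binn !mulr1n.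
  rewrite (_ : 'C(4, 2) = 6%N)//.
  move: e4 f4B f2B; set S4 := Rintegral _ _ _; set A4 := Rintegral _ _ _.
  set A2 := Rintegral _ _ _ => e4 h4 h2.
  have -> : n.+1%:R = n%:R + 1 :> R by rewrite natr1.
  have n0 : 0 <= n%:R :> R by [].
  have h2' : n%:R * A2 ^+ 2 <= n%:R * B by rewrite ler_wpM2l.
  have B0 : 0 <= B by rewrite (le_trans _ h2)// sqr_ge0.
  have -> : A4 * 1 + (0 + (A2 * (n%:R * A2) *+ 6 + (0 + (1 * S4 + 0)))) =
     A4 + 6 * (n%:R * A2 ^+ 2) + S4 by rewrite -mulr_natr; ring.
  have -> : 3 * (n%:R + 1) ^+ 2 * B = 3 * n%:R ^+ 2 * B + 6 * (n%:R * B) + 3 * B.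
    by ring.
  lra.
Qed.

End iid_moments.

Lemma quartic_sub_le (R : realType) (a b : R) :
  (a - b) ^+ 4 <= 8 * (a ^+ 4 + b ^+ 4).
Proof.
have sq (x y : R) : (x + y) ^+ 2 <= 2 * (x ^+ 2 + y ^+ 2).
  by have := sqr_ge0 (x - y); nra.
have h : (a - b) ^+ 2 <= 2 * (a ^+ 2 + b ^+ 2) by have := sq a (- b); rewrite sqrrN.
have h2 : ((a - b) ^+ 2) ^+ 2 <= (2 * (a ^+ 2 + b ^+ 2)) ^+ 2.
  by rewrite lerXn2r ?nnegrE ?sqr_ge0// mulr_ge0// addr_ge0// sqr_ge0.
have := sq (a ^+ 2) (b ^+ 2); rewrite -!exprM in h2 *.
rewrite exprMn in h2; lra.
Qed.

Section gaussian_moments.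
Context (R : realType).
Local Notation RR := (measurableTypeR R).
Local Notation N := (normal_prob 0 1 : probability RR R).
Local Notation G d := (gauss_vec R d).
Notation gvec d := (d.-tuple RR).

(** The number [1], kept as the integral that defines it. *)
Definition normal_var : R := \int[N]_u (u : R) ^+ 2.
Definition normal_m4 : R := \int[N]_u (u : R) ^+ 4.
Let s2 := normal_var.
Let s4 := normal_m4.
Let A2 : R := \int[N]_u ((u : R) ^+ 2 - s2) ^+ 2.
Let A4 : R := \int[N]_u ((u : R) ^+ 2 - s2) ^+ 4.

Let msq : measurable_fun setT (fun u : RR => (u : R) ^+ 2 - s2 : RR).
Proof. by apply: measurable_funB => //; exact: measurable_funX. Qed.

Let isq4 : L1 N (fun u : RR => ((u : R) ^+ 2 - s2) ^+ 4).
Proof.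
apply: (@L1_dominated _ _ _ _ _ (fun u : RR => 8 * ((u : R) ^+ 8 + s2 ^+ 4))).
- exact: measurable_funX.
- by apply: L1Z; apply: L1D; [exact: L1_normal_pow|exact: L1_cst].
move=> u; rewrite ger0_norm ?exprn_even_ge0//.
rewrite (_ : (u : R) ^+ 8 = ((u : R) ^+ 2) ^+ 4); last by rewrite -exprM.
exact: quartic_sub_le.
Qed.

Let sq_sum d (x : gvec d) :
  iid_sum (fun u : RR => (u : R) ^+ 2 - s2) x = dot x x - d%:R * s2.
Proof.
rewrite /iid_sum sumrB sumr_const card_ord mulr_natl; congr (_ - _).
Qed.

(** The squared norm is a sum of [d] independent squares. *)
Lemma gauss_sqnorm_moments d :
  [/\ L1 (G d) (fun x => (dot x x - d%:R * s2) ^+ 4),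
      \int[G d]_x (dot x x - d%:R * s2) = 0,
      \int[G d]_x (dot x x - d%:R * s2) ^+ 2 = d%:R * A2 &
      \int[G d]_x (dot x x - d%:R * s2) ^+ 4 <= 3 * d%:R ^+ 2 * (A4 + A2 ^+ 2)].
Proof.
have f1 : \int[N]_u ((u : R) ^+ 2 - s2) = 0.
  rewrite RintegralB//; last 2 first.
  - exact: (@L1_normal_pow R 2).
  - exact: L1_cst.
  by rewrite (Rintegral_cstT N) subrr.
have [||i4 e1 e2 e4] := @iid_sum_moments _ RR R N (fun u : RR => (u : R) ^+ 2 - s2)
  (A4 + A2 ^+ 2) msq isq4 f1 _ _ d.
- by rewrite lerDl sqr_ge0.
- by rewrite lerDr; apply: Rintegral_ge0 => u _; rewrite exprn_even_ge0.
have E k : (fun x : gvec d => iid_sum (fun u : RR => (u : R) ^+ 2 - s2) x ^+ k) =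
   (fun x => (dot x x - d%:R * s2) ^+ k) by apply/funext => x; rewrite sq_sum.
rewrite E in i4; split => //.
- by rewrite -[RHS]e1; apply: eq_Rintegral => x _; rewrite sq_sum.
- by rewrite -[RHS]e2; apply: eq_Rintegral => x _; rewrite sq_sum.
- apply: le_trans e4; rewrite le_eqVlt; apply/orP; left; apply/eqP.
  by apply: eq_Rintegral => x _; rewrite sq_sum.
Qed.

Let msqn d : measurable_fun setT (fun x : gvec d => dot x x - d%:R * s2 : RR).
Proof.
apply: measurable_funB => //.
have -> : (fun x : gvec d => dot x x : RR) =
  (fun z : gvec d * gvec d => dot z.1 z.2 : RR) \o (fun x => (x, x)) by [].
by apply: measurableT_comp; [exact: measurable_dot|exact: measurable_fun_pair].
Qed.

Lemma L1_sqnorm_dev d k : (k <= 4)%N ->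
  L1 (G d) (fun x => (dot x x - d%:R * s2) ^+ k).
Proof.
move=> k4; have [i4 _ _ _] := gauss_sqnorm_moments d.
exact: (L1_pow (m := 2) (@msqn d) k4 i4).
Qed.

Lemma L1_sqnorm d : L1 (G d) (fun x => dot x x).
Proof.
have -> : (fun x : gvec d => dot x x) =
  (fun x => (dot x x - d%:R * s2) ^+ 1 + d%:R * s2).
  by apply/funext => x; rewrite expr1 subrK.
by apply: L1D; [exact: L1_sqnorm_dev|exact: L1_cst].
Qed.

Lemma Rintegral_sqnorm d : \int[G d]_x dot x x = d%:R * s2.
Proof.
have [_ e1 _ _] := gauss_sqnorm_moments d.
apply/eqP; rewrite -subr_eq0 -[X in _ - X](Rintegral_cstT (G d)) -RintegralB//.
- by rewrite e1.
- exact: L1_sqnorm.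
- exact: L1_cst.
Qed.

Lemma L1_sqnorm2 d : L1 (G d) (fun x => dot x x ^+ 2).
Proof.
have -> : (fun x : gvec d => dot x x ^+ 2) =
  (fun x => (dot x x - d%:R * s2) ^+ 2 +
     ((2 * d%:R * s2) * dot x x - (d%:R * s2) ^+ 2)).
  by apply/funext => x; ring.
apply: L1D; first exact: L1_sqnorm_dev.
by apply: L1B; [apply: L1Z; exact: L1_sqnorm|exact: L1_cst].
Qed.

Lemma Rintegral_sqnorm2 d :
  \int[G d]_x dot x x ^+ 2 = d%:R * A2 + (d%:R * s2) ^+ 2.
Proof.
have [_ _ e2 _] := gauss_sqnorm_moments d.
transitivity (\int[G d]_x ((dot x x - d%:R * s2) ^+ 2 +
     ((2 * d%:R * s2) * dot x x - (d%:R * s2) ^+ 2))).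
  by apply: eq_Rintegral => x _; ring.
rewrite RintegralD//; last 2 first.
- exact: L1_sqnorm_dev.
- by apply: L1B; [apply: L1Z; exact: L1_sqnorm|exact: L1_cst].
rewrite RintegralB//; last 2 first.
- by apply: L1Z; exact: L1_sqnorm.
- exact: L1_cst.
rewrite RintegralZl//; last exact: L1_sqnorm.
by rewrite e2 Rintegral_sqnorm (Rintegral_cstT (G d)); ring.
Qed.

Lemma gauss_dot_Rintegral d (x : gvec d) (g : RR -> R) :
  measurable_fun setT (g : RR -> RR) -> (forall z, 0 <= g z) ->
  \int[G d]_y g (dot x y) = \int[N]_u g (Num.sqrt (dot x x) * (u : R)).
Proof.
move=> mg g0; rewrite /Rintegral; congr fine.
rewrite (gauss_dot_law x (g := fun z => (g z)%:E))//.
exact/measurable_EFinP.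
Qed.

Let pow_dot k d (x : gvec d) : (k <= 4)%N ->
  (\int[G d]_y (dot x y ^+ k.*2)%:E =
   (dot x x ^+ k * \int[N]_u (u : R) ^+ k.*2)%:E)%E.
Proof.
move=> k4; have k8 : (k.*2 <= 8)%N by rewrite -[8%N]/(4.*2) leq_double.
rewrite (gauss_dot_law x (g := fun z => ((z : R) ^+ k.*2)%:E)); last 2 first.
- by apply/measurable_EFinP; exact: measurable_funX.
- by move=> z; rewrite lee_fin exprn_even_ge0// odd_double.
have i2 := @L1_normal_pow R _ k8.
have -> : (dot x x ^+ k * \int[N]_u (u : R) ^+ k.*2)%:E =
   (\int[N]_u (dot x x ^+ k * (u : R) ^+ k.*2)%:E)%E.
  rewrite -RintegralZl// /Rintegral fineK//.
  by apply: integrable_fin_num => //; exact: L1Z.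
apply: eq_integral => u _; congr (_%:E).
by rewrite exprMn -muln2 mulnC exprM sqr_sqrtr// dot_ge0.
Qed.

(** Given [x], the variable [<x,y>] is [|x|] times a standard normal one. *)
Lemma dot2_moment d :
  L1 (G d \x G d)%E (fun z => dot z.1 z.2 ^+ 2) /\
  \int[(G d \x G d)%E]_z dot z.1 z.2 ^+ 2 = d%:R * s2 ^+ 2.
Proof.
have [|z|||i ->] := @L1_iterated _ _ _ _ _ (G d) (G d) (fun z => dot z.1 z.2 ^+ 2)
  (fun x => dot x x ^+ 1 * s2).
- by apply: measurable_funX; exact: measurable_dot.
- exact: sqr_ge0.
- by under [X in EFin \o X]funext do rewrite mulrC; apply: L1Z; exact: L1_sqnorm.
- by move=> x; rewrite -(pow_dot (k := 1)).
split => //; rewrite RintegralZr ?Rintegral_sqnorm//; last exact: L1_sqnorm.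
by ring.
Qed.

Lemma dot4_moment d :
  L1 (G d \x G d)%E (fun z => dot z.1 z.2 ^+ 4) /\
  \int[(G d \x G d)%E]_z dot z.1 z.2 ^+ 4 =
    (d%:R * A2 + (d%:R * s2) ^+ 2) * s4.
Proof.
have [|z|||i ->] := @L1_iterated _ _ _ _ _ (G d) (G d) (fun z => dot z.1 z.2 ^+ 4)
  (fun x => dot x x ^+ 2 * s4).
- by apply: measurable_funX; exact: measurable_dot.
- by rewrite exprn_even_ge0.
- by under [X in EFin \o X]funext do rewrite mulrC; apply: L1Z; exact: L1_sqnorm2.
- by move=> x; rewrite -(pow_dot (k := 2)).
split => //; rewrite RintegralZr ?Rintegral_sqnorm2//; exact: L1_sqnorm2.
Qed.

Lemma sqnorm_dev_bounds : exists2 K : R, 0 <= K & forall d,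
  \int[G d]_x (dot x x - d%:R * s2) ^+ 2 <= K * d%:R /\
  \int[G d]_x (dot x x - d%:R * s2) ^+ 4 <= K * d%:R ^+ 2.
Proof.
have A20 : 0 <= A2 by apply: Rintegral_ge0 => u _; exact: sqr_ge0.
have A40 : 0 <= A4 by apply: Rintegral_ge0 => u _; rewrite exprn_even_ge0.
exists (A2 + 3 * (A4 + A2 ^+ 2)) => [|d].
  by rewrite addr_ge0// mulr_ge0// addr_ge0// sqr_ge0.
have [_ _ -> e4] := gauss_sqnorm_moments d.
have n0 : 0 <= d%:R :> R by [].
split; first by rewrite mulrC ler_wpM2r// lerDl mulr_ge0// addr_ge0// sqr_ge0.
apply: (le_trans e4); rewrite mulrAC ler_wpM2r ?sqr_ge0// lerDr//.
Qed.

Lemma dot4_bound : exists2 K : R, 0 <= K & forall d, (0 < d)%N ->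
  \int[(G d \x G d)%E]_z dot z.1 z.2 ^+ 4 <= K * d%:R ^+ 2.
Proof.
have A20 : 0 <= A2 by apply: Rintegral_ge0 => u _; exact: sqr_ge0.
have s40 : 0 <= s4 by apply: Rintegral_ge0 => u _; rewrite exprn_even_ge0.
exists ((A2 + s2 ^+ 2) * s4) => [|d d0].
  by rewrite mulr_ge0// addr_ge0// sqr_ge0.
have [_ ->] := dot4_moment d; rewrite mulrAC ler_wpM2r//.
have d1 : 1 <= d%:R :> R by rewrite ler1n.
rewrite exprMn mulrDl [X in _ <= _ + X]mulrC lerD2r mulrC ler_wpM2l// expr2 ler_peMl//.
Qed.

End gaussian_moments.

(** * Lower bound on the correlation of two rows *)

Section kernel.
Context d (T : measurableType d) (R : realType) (P : probability T R).
Variable s : T * T -> R.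
Hypotheses (ms : measurable_fun setT s) (s1 : forall z, `|s z| <= 1).

(** For a centred edge indicator [s], this measures how strongly the edges from
    [z.1] and [z.2] to a common neighbour are correlated. *)
Definition corr (z : T * T) : R := \int[P]_y (s (z.1, y) * s (z.2, y)).

Definition corr_moment k : R := \int[(P \x P)%E]_z corr z ^+ k.

Lemma measurable_corr_integrand :
  measurable_fun setT (fun q : (T * T) * T => s (q.1.1, q.2) * s (q.1.2, q.2)).
Proof.
apply: measurable_funM.
  apply: (measurableT_comp ms); apply: measurable_fun_pair => //.
  exact: measurableT_comp.
apply: (measurableT_comp ms); apply: measurable_fun_pair => //.
exact: measurableT_comp.
Qed.

Lemma normrM_le1 (a b : R) : `|a| <= 1 -> `|b| <= 1 -> `|a * b| <= 1.
Proof. by move=> a1 b1; rewrite normrM mulr_ile1. Qed.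

Lemma measurable_corr : measurable_fun setT corr.
Proof.
apply: (measurable_Rintegral1 (P \x P)%E P measurable_corr_integrand (M := 1)).
by move=> q; exact: normrM_le1.
Qed.

Lemma measurable_kernel_row x : measurable_fun setT (fun y => s (x, y)).
Proof. exact: measurable_section1. Qed.

Lemma measurable_kernel_col y : measurable_fun setT (fun x => s (x, y)).
Proof. exact: measurable_section2. Qed.

Lemma L1_kernel_pair x x' : L1 P (fun y => s (x, y) * s (x', y)).
Proof.
apply: (L1_bounded _ (M := 1)) => [|y]; last exact: normrM_le1.
by apply: measurable_funM; exact: measurable_kernel_row.
Qed.

Lemma normr_corr_le1 z : `|corr z| <= 1.
Proof.
apply: normr_Rintegral_le => [|y]; last exact: normrM_le1.
by apply: measurable_funM; exact: measurable_kernel_row.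
Qed.

Lemma L1_corr k : L1 (P \x P)%E (fun z => corr z ^+ k).
Proof.
apply: (L1_bounded _ (M := 1)) => [|z].
  by apply: measurable_funX; exact: measurable_corr.
by rewrite normrX exprn_ile1// normr_corr_le1.
Qed.

Section kernel_test.
Variables (a g : T -> R).
Hypotheses (ma : measurable_fun setT a) (ig : L1 P g) (ag : forall x, `|a x| <= g x).

Let u y := \int[P]_x (s (x, y) * a x).

Let dom (f : T * T -> R) z : `|f z| <= 1 -> `|f z * a z.1| <= (g \o fst) z.
Proof.
by move=> f1; rewrite normrM (le_trans _ (ag _))// ler_piMl.
Qed.

Let mfa (f : T * T -> R) : measurable_fun setT f ->
  measurable_fun setT (fun z => f z * a z.1).
Proof. by move=> mf; apply: measurable_funM => //; exact: measurableT_comp. Qed.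

Lemma L1_kernel_test : L1 (P \x P)%E (fun z => s z * a z.1).
Proof.
by apply: (L1_dominated (mfa ms) (L1_fst P ig)) => z; exact: dom.
Qed.

Let iu : L1 P u. Proof. exact: L1_section2 L1_kernel_test. Qed.

Let ia : L1 P a. Proof. exact: L1_dominated ma ig ag. Qed.

Let u_le y : `|u y| <= \int[P]_x g x.
Proof.
have isa : L1 P (fun x => s (x, y) * a x).
  apply: (L1_dominated _ ig) => [|x].
    by apply: measurable_funM => //; exact: measurable_kernel_col.
  by rewrite normrM (le_trans _ (ag _))// ler_piMl.
apply: (le_trans (le_normr_Rintegral measurableT isa)).
apply: le_RintegralT => // [|x].
  apply: (L1_dominated _ ig) => [|x]; first exact: measurableT_comp (L1_measurable isa).
  by rewrite normr_id normrM (le_trans _ (ag _))// ler_piMl.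
by rewrite normrM (le_trans _ (ag _))// ler_piMl.
Qed.

(** The kernel [corr] is the Gram kernel of the rows of [s]. *)
Lemma corr_test :
  \int[(P \x P)%E]_z (corr z * (a z.1 * a z.2)) = \int[P]_y u y ^+ 2.
Proof.
have mu := L1_measurable iu.
rewrite (Fubini12 (f := fun z => corr z * (a z.1 * a z.2))); last first.
  apply: (L1_dominated _ (L1_prod (P1 := P) (P2 := P) ig ig)) => [|z].
    apply: measurable_funM; first exact: measurable_corr.
    by apply: measurable_funM; exact: measurableT_comp.
  rewrite normrM normrM (@le_trans _ _ (1 * (`|a z.1| * `|a z.2|)))//.
    by rewrite ler_wpM2r ?mulr_ge0// normr_corr_le1.
  by rewrite mul1r ler_pM.
have row x : \int[P]_x' (corr (x, x') * (a x * a x')) =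
    \int[P]_y ((s (x, y) * u y) * a x).
  transitivity (\int[P]_x' \int[P]_y ((s (x', y) * a x') * s (x, y) * a x)).
    apply: eq_Rintegral => x' _; rewrite -RintegralZr//; last exact: L1_kernel_pair.
    by apply: eq_Rintegral => y _; ring.
  rewrite (Rintegral_swap (f := fun z => (s z * a z.1) * s (x, z.2) * a x)); last first.
    under [X in EFin \o X]funext do rewrite mulrC; apply: L1Z.
    apply: (L1_dominated _ (L1_fst P ig)) => [|z].
      apply: measurable_funM; first exact: mfa.
      exact: (measurableT_comp (measurable_kernel_row x)).
    by rewrite normrM (le_trans _ (dom (f := s) (s1 z)))// ler_piMr.
  apply: eq_Rintegral => y _.
  rewrite (mulrC (s (x, y))) -mulrA -RintegralZr.
  - by apply: eq_Rintegral => x' _; ring.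
  - by [].
  - apply: (L1_dominated _ ig) => [|x'].
      by apply: measurable_funM => //; exact: measurable_kernel_col.
    by rewrite normrM (le_trans _ (ag _))// ler_piMl.
under eq_Rintegral do rewrite row.
rewrite (Rintegral_swap (f := fun z => s z * u z.2 * a z.1)); last first.
  apply: (L1_dominated _ (L1_fst P (L1Z (\int[P]_x g x) ig))) => [|z].
    apply: mfa; apply: measurable_funM => //.
    by apply: measurableT_comp.
  rewrite normrM normrM /=; apply: ler_pM => //.
  by rewrite (le_trans _ (u_le z.2))// ler_piMl.
apply: eq_Rintegral => y _; rewrite expr2 -[in RHS]RintegralZl//.
  by apply: eq_Rintegral => x _; ring.
apply: (L1_dominated _ ig) => [|x'].
  by apply: measurable_funM => //; exact: measurable_kernel_col.
by rewrite normrM (le_trans _ (ag _))// ler_piMl.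
Qed.

(** Cauchy-Schwarz in the form [u^2 >= 2 ga u a - ga^2 a^2], with [ga] left to
    be optimised after summation over several test functions [a]. *)
Lemma corr_test_ge (ga : R) : L1 P (fun x => a x ^+ 2) ->
  2 * ga * \int[(P \x P)%E]_z (s z * (a z.1 * a z.2)) - ga ^+ 2 * \int[P]_x a x ^+ 2
  <= \int[(P \x P)%E]_z (corr z * (a z.1 * a z.2)).
Proof.
move=> ia2; have mu := L1_measurable iu.
have iua : L1 P (fun y => u y * a y).
  apply: (L1_dominated _ (L1Z (\int[P]_x g x) ig)) => [|y].
    exact: measurable_funM.
  by rewrite normrM ler_pM.
have iu2 : L1 P (fun y => u y ^+ 2).
  apply: (L1_bounded _ (M := (\int[P]_x g x) ^+ 2)) => [|y].
    exact: measurable_funX.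
  by rewrite normrX lerXn2r ?nnegrE// (le_trans _ (u_le y)).
have -> : \int[(P \x P)%E]_z (s z * (a z.1 * a z.2)) = \int[P]_y (u y * a y).
  rewrite (Fubini21 (f := fun z => s z * (a z.1 * a z.2))); last first.
    apply: (L1_dominated _ (L1_prod (P1 := P) (P2 := P) ig ig)) => [|z].
      by apply: measurable_funM => //; apply: measurable_funM; exact: measurableT_comp.
    rewrite normrM normrM (@le_trans _ _ (1 * (`|a z.1| * `|a z.2|)))//.
      by rewrite ler_wpM2r ?mulr_ge0.
    by rewrite mul1r ler_pM.
  apply: eq_Rintegral => y _; rewrite -RintegralZr//.
    by apply: eq_Rintegral => x _; rewrite mulrA.
  apply: (L1_dominated _ ig) => [|x'].
    by apply: measurable_funM => //; exact: measurable_kernel_col.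
  by rewrite normrM (le_trans _ (ag _))// ler_piMl.
rewrite corr_test -RintegralZl// -RintegralZl// -RintegralB//; last 2 first.
- exact: L1Z.
- exact: L1Z.
apply: le_RintegralT => // [|y]; first by apply: L1B; exact: L1Z.
by have := sqr_ge0 (u y - ga * a y); nra.
Qed.

End kernel_test.
End kernel.

Section gaussian_kernel.
Context (R : realType).
Local Notation RR := (measurableTypeR R).
Local Notation N := (normal_prob 0 1 : probability RR R).
Local Notation G d := (gauss_vec R d).
Notation gvec d := (d.-tuple RR).

Definition edge_dev d (p t : R) (z : gvec d * gvec d) : R :=
  (scaled_dot z.1 z.2 <= t)%R%:R - p.

Lemma measurable_scaled_dot d :
  measurable_fun setT (fun z : gvec d * gvec d => scaled_dot z.1 z.2 : RR).
Proof. by apply: measurable_funM => //; exact: measurable_dot. Qed.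

Lemma measurable_edge d (t : R) :
  measurable_fun setT (fun z : gvec d * gvec d => (scaled_dot z.1 z.2 <= t)%R%:R : RR).
Proof. exact: measurable_itv_indic (@measurable_scaled_dot d). Qed.

Lemma measurable_edge_dev d p t : measurable_fun setT (@edge_dev d p t : _ -> RR).
Proof. by apply: measurable_funB => //; exact: measurable_edge. Qed.

Lemma normr_bool_sub_le1 (p : R) (b : bool) : 0 < p < 1 -> `|b%:R - p| <= 1.
Proof. by move=> /andP[p0 p1]; rewrite ler_norml; case: b => /=; lra. Qed.

Lemma normr_edge_dev_le1 d p t (z : gvec d * gvec d) : 0 < p < 1 ->
  `|edge_dev p t z| <= 1.
Proof. exact: normr_bool_sub_le1. Qed.

Lemma Rintegral_edge d p t : is_threshold d p t ->
  \int[(G d \x G d)%E]_z (scaled_dot z.1 z.2 <= t)%R%:R = p.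
Proof.
move=> tp; transitivity (\int[(G d \x G d)%E]_z
    \1_[set z : gvec d * gvec d | scaled_dot z.1 z.2 <= t] z).
  by apply: eq_Rintegral => z _; rewrite indic_bool.
rewrite Rintegral_indic ?[X in fine X]tp//.
have := @measurable_edge d t; move=> /(_ measurableT [set 1] (measurable_set1 1)).
rewrite setTI; congr measurable; apply/seteqP; split => z /=.
  by case: (_ <= _) => // /eqP; rewrite eq_sym oner_eq0.
by move=> ->.
Qed.

Lemma L1_edge d t : L1 (G d \x G d)%E (fun z : gvec d * gvec d => (scaled_dot z.1 z.2 <= t)%R%:R).
Proof.
apply: (L1_bounded _ (M := 1)) => [|z]; first exact: measurable_edge.
exact: normr_bool_le1.
Qed.

Let s2 := normal_var R.

Lemma Rintegral_scaled_dot_sub2 d t : (0 < d)%N ->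
  \int[(G d \x G d)%E]_z (scaled_dot z.1 z.2 - t) ^+ 2 = s2 ^+ 2 + t ^+ 2.
Proof.
move=> d0; have dn0 : d%:R != 0 :> R by rewrite pnatr_eq0 -lt0n.
set c := (Num.sqrt d%:R)^-1 : R.
have c2 : c ^+ 2 = d%:R^-1 by rewrite exprVn sqr_sqrtr.
have iu1 := @L1_normal_pow R 1 isT; have iu2 := @L1_normal_pow R 2 isT.
have row (x : gvec d) : (\int[G d]_y ((scaled_dot x y - t) ^+ 2)%:E =
    (d%:R^-1 * s2 * dot x x + t ^+ 2)%:E)%E.
  rewrite (gauss_dot_law x (g := fun z => ((c * (z : R) - t) ^+ 2)%:E)); last 2 first.
  - apply/measurable_EFinP; apply: measurable_funX.
    by apply: measurable_funB => //; exact: measurable_funM.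
  - by move=> z; rewrite lee_fin sqr_ge0.
  set r := Num.sqrt (dot x x).
  have E (u : RR) : (c * (r * u) - t) ^+ 2 = (c * r) ^+ 2 * (u : R) ^+ 2 +
     (- 2 * c * r * t * (u : R) ^+ 1 + t ^+ 2) by ring.
  under eq_integral do rewrite E.
  have i1 : L1 N (fun u : RR => - 2 * c * r * t * (u : R) ^+ 1 + t ^+ 2).
    by apply: L1D; [exact: L1Z|exact: L1_cst].
  rewrite EFin_Rintegral; last by apply: L1D => //; exact: L1Z.
  rewrite RintegralD//; last exact: L1Z.
  rewrite RintegralD//; last 2 first.
  - exact: L1Z.
  - exact: L1_cst.
  rewrite RintegralZl// RintegralZl// (Rintegral_cstT N) (Rintegral_normal_id R).
  by rewrite mulr0 add0r exprMn c2 sqr_sqrtr ?dot_ge0// mulrAC.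
have [||||_ ->] := @L1_iterated _ _ _ _ _ (G d) (G d) (fun z => (scaled_dot z.1 z.2 - t) ^+ 2)
  (fun x => d%:R^-1 * s2 * dot x x + t ^+ 2).
- by apply: measurable_funX; apply: measurable_funB => //; exact: measurable_scaled_dot.
- by move=> z; exact: sqr_ge0.
- by apply: L1D; [apply: L1Z; exact: L1_sqnorm|exact: L1_cst].
- exact: row.
rewrite RintegralD//; last 2 first.
- by apply: L1Z; exact: L1_sqnorm.
- exact: L1_cst.
rewrite RintegralZl//; last exact: L1_sqnorm.
rewrite Rintegral_sqnorm (Rintegral_cstT (G d)) -/s2; field.
exact: dn0.
Qed.

Lemma L1_scaled_dot_pow d k : (k <= 4)%N ->
  L1 (G d \x G d)%E (fun z => scaled_dot z.1 z.2 ^+ k).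
Proof.
move=> k4; have -> : (fun z : gvec d * gvec d => scaled_dot z.1 z.2 ^+ k) =
    (fun z => (Num.sqrt d%:R)^-1 ^+ k * dot z.1 z.2 ^+ k).
  by apply/funext => z; rewrite scaled_dotE exprMn.
apply: L1Z; apply: (L1_pow (m := 2)) => //; first exact: measurable_dot.
by have [] := dot4_moment R d.
Qed.

Lemma scaled_dot_pow d k (z : gvec d * gvec d) :
  scaled_dot z.1 z.2 ^+ k.*2 = d%:R^-1 ^+ k * dot z.1 z.2 ^+ k.*2.
Proof.
have c2 : (Num.sqrt d%:R)^-1 ^+ 2 = d%:R^-1 :> R by rewrite exprVn sqr_sqrtr.
by rewrite scaled_dotE exprMn; congr (_ * _); rewrite -[k.*2]mul2n exprM c2.
Qed.

Lemma L1_dist_pow d t k : (k <= 4)%N ->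
  L1 (G d \x G d)%E (fun z => (scaled_dot z.1 z.2 - t) ^+ k).
Proof.
move=> k4; apply: (L1_pow (m := 2)) => //.
  by apply: measurable_funB => //; exact: measurable_scaled_dot.
apply: (@L1_dominated _ _ _ _ _ (fun z => 8 * (scaled_dot z.1 z.2 ^+ 4 + t ^+ 4))).
- by apply: measurable_funX; apply: measurable_funB => //; exact: measurable_scaled_dot.
- by apply: L1Z; apply: L1D; [exact: L1_scaled_dot_pow|exact: L1_cst].
by move=> z; rewrite ger0_norm ?exprn_even_ge0// quartic_sub_le.
Qed.

(** Let [W = <x,y> / sqrt d - t]. Since [E W^4] is at most a constant times
    [(E W^2)^2], the variable [W] is typically of the size of its root mean
    square. The inequality [|W| >= b W^2 - b^3 W^4] expresses this by moments:
    for [b] of order [(E W^2)^(-1/2)] the mean of the right side is bounded below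
    uniformly in [d] and [t]. *)
Lemma dist_threshold_lower : exists2 c : R, 0 < c & forall d t, (0 < d)%N ->
  exists b : R, c <= \int[(G d \x G d)%E]_z
    (b * (scaled_dot z.1 z.2 - t) ^+ 2 - b ^+ 3 * (scaled_dot z.1 z.2 - t) ^+ 4)
    /\ 0 <= b.
Proof.
have s20 : 0 < s2 := normal_var_gt0 R.
have [K K0 KE] := dot4_bound R.
pose C := 8 * (K / s2 ^+ 4 + 1).
have C0 : 0 < C by rewrite mulr_gt0// ltr_wpDl// divr_ge0// exprn_ge0// ltW.
exists (s2 / (2 * Num.sqrt (2 * C))).
  by rewrite divr_gt0// mulr_gt0// sqrtr_gt0 mulr_gt0.
move=> d t d0; pose v := s2 ^+ 2 + t ^+ 2.
have v0 : 0 < v by rewrite ltr_pwDl ?exprn_gt0// sqr_ge0.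
(* With this [b], the fourth moment term is at most half of [b v]. *)
pose b := (Num.sqrt (2 * C * v))^-1.
have b0 : 0 <= b by rewrite invr_ge0 sqrtr_ge0.
exists b; split => //.
have Cv : 0 <= 2 * C * v by apply: ltW; apply: mulr_gt0 => //; exact: mulr_gt0.
have b2 : b ^+ 2 = (2 * C * v)^-1 by rewrite exprVn sqr_sqrtr.
have dn0 : 0 < d%:R :> R by rewrite ltr0n.
rewrite RintegralB//; last 2 first.
- by apply: L1Z; exact: L1_dist_pow.
- by apply: L1Z; exact: L1_dist_pow.
rewrite RintegralZl//; last exact: L1_dist_pow.
rewrite RintegralZl//; last exact: L1_dist_pow.
rewrite Rintegral_scaled_dot_sub2// -/v.
set m4 := Rintegral _ _ _.
have m4C : m4 <= C * v ^+ 2.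
  apply: (@le_trans _ _ (8 * (K + t ^+ 4))).
    apply: (@le_trans _ _ (\int[(G d \x G d)%E]_z (8 * (scaled_dot z.1 z.2 ^+ 4 + t ^+ 4)))).
      apply: le_RintegralT.
      - exact: L1_dist_pow.
      - by apply: L1Z; apply: L1D; [exact: L1_scaled_dot_pow|exact: L1_cst].
      - by move=> z; exact: quartic_sub_le.
    rewrite RintegralZl//; last by apply: L1D; [exact: L1_scaled_dot_pow|exact: L1_cst].
    rewrite RintegralD//; [|exact: L1_scaled_dot_pow|exact: L1_cst].
    rewrite (Rintegral_cstT (G d \x G d)%E) ler_wpM2l// lerD2r.
    under eq_Rintegral do rewrite (scaled_dot_pow 2).
    rewrite RintegralZl//; last by have [] := dot4_moment R d.
    by rewrite exprVn mulrC ler_pdivrMr ?exprn_gt0// KE.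
  rewrite /C -mulrA ler_wpM2l//.
  have v2 : s2 ^+ 4 + t ^+ 4 <= v ^+ 2.
    rewrite /v sqrrD -!exprM [leRHS]addrAC lerDl mulrn_wge0// mulr_ge0//; exact: sqr_ge0.
  have t4 : 0 <= t ^+ 4 by rewrite exprn_even_ge0.
  have s4 : 0 < s2 ^+ 4 by rewrite exprn_gt0.
  rewrite mulrDl mul1r lerD//; last by rewrite (le_trans _ v2)// lerDr ltW.
  rewrite -[leLHS](divfK (lt0r_neq0 s4)) ler_wpM2l ?divr_ge0 ?(ltW s4)//.
  by rewrite (le_trans _ v2)// lerDl.
have -> : b ^+ 3 * m4 = b * (b ^+ 2 * m4) by rewrite exprS mulrA.
have bm : b ^+ 2 * m4 <= v / 2.
  apply: (@le_trans _ _ (b ^+ 2 * (C * v ^+ 2))).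
    by rewrite ler_wpM2l// sqr_ge0.
  rewrite b2 le_eqVlt; apply/orP; left; apply/eqP; field.
  by rewrite !lt0r_neq0.
apply: (@le_trans _ _ (b * (v / 2))); last first.
  rewrite -mulrBr ler_wpM2l//; lra.
have sv : Num.sqrt (2 * C * v) = Num.sqrt (2 * C) * Num.sqrt v.
  by rewrite sqrtrM// mulr_ge0// ltW.
have vv : v = Num.sqrt v ^+ 2 by rewrite sqr_sqrtr// ltW.
have sv0 : 0 < Num.sqrt v by rewrite sqrtr_gt0.
have sC0 : 0 < Num.sqrt (2 * C) by rewrite sqrtr_gt0 mulr_gt0.
have -> : b * (v / 2) = Num.sqrt v / (2 * Num.sqrt (2 * C)).
  rewrite /b sv [X in _ * (X / 2)]vv; field; by rewrite !lt0r_neq0.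
rewrite ler_pM2r ?invr_gt0 ?mulr_gt0//.
apply: (@le_trans _ _ (Num.sqrt (s2 ^+ 2))); first by rewrite sqrtr_sqr ler_norm.
by rewrite ler_wsqrtr// lerDl sqr_ge0.
Qed.

(** The edge is centred, so the inner product may be recentred at the
    threshold. With [W = <x,y> / sqrt d - t] the product [- s W] is then
    nonnegative, equal to [(1 - p) |W|] on edges and to [p |W|] elsewhere. *)
Lemma edge_dev_dot_lower (p : R) : 0 < p < 1 -> exists2 c : R, 0 < c &
  forall d t, (0 < d)%N -> is_threshold d p t ->
  c * Num.sqrt d%:R <= - \int[(G d \x G d)%E]_z (edge_dev p t z * dot z.1 z.2).
Proof.
move=> p01; have [c c0 cE] := dist_threshold_lower.
pose q := Num.min p (1 - p).
have q0 : 0 < q by rewrite lt_min subr_gt0.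
exists (q * c); first exact: mulr_gt0.
move=> d t d0 tp; have [b [bE b0]] := cE d t d0.
have dn0 : 0 < d%:R :> R by rewrite ltr0n.
have sd0 : 0 < Num.sqrt d%:R :> R by rewrite sqrtr_gt0.
have iZ : L1 (G d \x G d)%E (fun z => scaled_dot z.1 z.2).
  exact: (@L1_scaled_dot_pow d 1).
have iT k : (k <= 4)%N -> L1 (G d \x G d)%E (fun z => (scaled_dot z.1 z.2 - t) ^+ k).
  exact: L1_dist_pow.
have bdd (f : gvec d * gvec d -> R) : L1 (G d \x G d)%E f ->
    L1 (G d \x G d)%E (fun z => edge_dev p t z * f z).
  move=> iF; have mf := L1_measurable iF.
  apply: (@L1_dominated _ _ _ _ _ (fun z => `|f z|)).
  - by apply: measurable_funM => //; exact: measurable_edge_dev.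
  - apply: (L1_dominated _ (g := fun z => `|f z|)) => [||z].
    + exact: measurableT_comp.
    + by have := integrable_norm iF.
    + by rewrite normr_id.
  - by move=> z; rewrite normrM ler_piMl// normr_edge_dev_le1.
have isd : L1 (G d \x G d)%E (edge_dev p t).
  apply: (L1_bounded _ (M := 1)) => [|z]; first exact: measurable_edge_dev.
  exact: normr_edge_dev_le1.
have Es : \int[(G d \x G d)%E]_z edge_dev p t z = 0.
  rewrite RintegralB//; [|exact: L1_edge|exact: L1_cst].
  by rewrite (Rintegral_edge tp) (Rintegral_cstT (G d \x G d)%E) subrr.
have ET : - (\int[(G d \x G d)%E]_z (edge_dev p t z * (scaled_dot z.1 z.2 - t))) =
    - \int[(G d \x G d)%E]_z (edge_dev p t z * scaled_dot z.1 z.2).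
  under eq_Rintegral do rewrite mulrBr.
  rewrite RintegralB//; [|exact: bdd|].
    by rewrite RintegralZr// Es mul0r subr0.
  by under [X in EFin \o X]funext do rewrite mulrC; exact: L1Z.
have -> : - (\int[(G d \x G d)%E]_z (edge_dev p t z * dot z.1 z.2)) =
    Num.sqrt d%:R * - \int[(G d \x G d)%E]_z (edge_dev p t z * scaled_dot z.1 z.2).
  rewrite mulrN -RintegralZl//; last exact: bdd.
  congr (- _); apply: eq_Rintegral => z _; rewrite scaled_dotE mulrCA mulVKf//.
  exact: lt0r_neq0.
rewrite mulrC ler_pM2l// -ET -mulN1r -RintegralZl//; last first.
  by apply: bdd; exact: (iT 1%N).
have iRHS : L1 (G d \x G d)%E (fun z => b * (scaled_dot z.1 z.2 - t) ^+ 2 -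
    b ^+ 3 * (scaled_dot z.1 z.2 - t) ^+ 4).
  by apply: L1B; apply: L1Z; exact: iT.
apply: (@le_trans _ _ (q * \int[(G d \x G d)%E]_z
    (b * (scaled_dot z.1 z.2 - t) ^+ 2 - b ^+ 3 * (scaled_dot z.1 z.2 - t) ^+ 4))).
  by rewrite ler_wpM2l// ltW.
rewrite -RintegralZl//; apply: le_RintegralT.
- exact: L1Z.
- by apply: L1Z; apply: bdd; exact: (iT 1%N).
move=> z; set w := scaled_dot z.1 z.2 - t.
have wb : b * w ^+ 2 - b ^+ 3 * w ^+ 4 <= `|w|.
  have -> : w ^+ 2 = `|w| ^+ 2 by rewrite real_normK// num_real.
  have -> : w ^+ 4 = `|w| ^+ 4.
    by rewrite -[4%N]/(2 * 2)%N !exprM real_normK// num_real.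
  have w0 : 0 <= `|w| by [].
  have [bw1|bw1] := leP (b * `|w|) 1.
    apply: (@le_trans _ _ (b * `|w| ^+ 2)).
      by rewrite gerBl mulr_ge0// exprn_ge0.
    by rewrite expr2 mulrA ler_piMl.
  apply: (@le_trans _ _ 0) => //.
  have -> : b * `|w| ^+ 2 - b ^+ 3 * `|w| ^+ 4 =
     (b * `|w| ^+ 2) * (1 - (b * `|w|) ^+ 2) by ring.
  apply: mulr_ge0_le0; first by rewrite mulr_ge0// exprn_ge0.
  by rewrite subr_le0; apply: exprn_ege1; exact: ltW.
apply: (@le_trans _ _ (q * `|w|)); first by rewrite ler_wpM2l// ltW.
have [qp qp'] : q <= p /\ q <= 1 - p by rewrite !ge_min !lexx orbT.
rewrite mulN1r -mulNr /edge_dev opprB.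
have [zt|zt] := leP (scaled_dot z.1 z.2) t.
  have w0 : 0 <= - w by rewrite oppr_ge0 subr_le0.
  rewrite -normrN ger0_norm//.
  have -> : (p - true%:R) * w = (1 - p) * - w by rewrite /=; ring.
  by rewrite ler_wpM2r.
have w0 : 0 <= w by rewrite subr_ge0 ltW.
by rewrite ger0_norm// subr0 ler_wpM2r.
Qed.

(** Two optimisations over a free parameter: [corr_test_ge] for the [d]
    coordinate functions bounds [Q = E h <x,x'>] below by a constant, and
    [h^2 >= 2 be h <x,x'> - be^2 <x,x'>^2] passes from [Q] to [E h^2]. *)
Lemma corr_moment2_lower (p : R) : 0 < p < 1 -> exists2 c : R, 0 < c &
  forall d t, (0 < d)%N -> is_threshold d p t ->
  c / d%:R <= corr_moment (G d) (edge_dev p t) 2.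
Proof.
move=> p01; have [c c0 cE] := edge_dev_dot_lower p01.
have s20 : 0 < s2 := normal_var_gt0 R.
exists (c ^+ 4 / s2 ^+ 4); first by rewrite divr_gt0// exprn_gt0.
move=> d t d0 tp; have := cE d t d0 tp.
have dn0 : 0 < d%:R :> R by rewrite ltr0n.
set s := edge_dev p t; set Th := Rintegral _ _ _ => ThE.
have ms : measurable_fun setT s by exact: measurable_edge_dev.
have s1 z : `|s z| <= 1 by exact: normr_edge_dev_le1.
have mt k : measurable_fun setT (fun x : gvec d => tnth x k : RR).
  exact: measurable_tnth.
pose g (x : gvec d) := 1 + dot x x.
have ig : L1 (G d) g by apply: L1D; [exact: L1_cst|exact: L1_sqnorm].
have tg k (x : gvec d) : (tnth x k : R) ^+ 2 <= dot x x.
  rewrite /dot (bigD1 k)//= -expr2 lerDl.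
  by apply: sumr_ge0 => j _; rewrite -expr2 sqr_ge0.
have ag k (x : gvec d) : `|tnth x k : R| <= g x.
  rewrite /g; have := tg k x; rewrite -real_normK ?num_real//.
  by have := sqr_ge0 (`|tnth x k : R| - 1); have := normr_ge0 (tnth x k : R); nra.
have it2 k : L1 (G d) (fun x : gvec d => (tnth x k : R) ^+ 2).
  apply: (L1_dominated _ (L1_sqnorm R d)) => [|x]; first exact: (measurable_funX 2 (mt k)).
  by rewrite ger0_norm ?sqr_ge0.
have igg := L1_prod (P1 := G d) (P2 := G d) ig ig.
have iprod (f : gvec d * gvec d -> R) k : measurable_fun setT f ->
    (forall z, `|f z| <= 1) ->
    L1 (G d \x G d)%E (fun z => f z * ((tnth z.1 k : R) * (tnth z.2 k : R))).
  move=> mf f1; apply: (L1_dominated _ igg) => [|z].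
    apply: measurable_funM => //; apply: measurable_funM.
      exact: (measurableT_comp (mt k)).
    exact: (measurableT_comp (mt k)).
  rewrite normrM (@le_trans _ _ (`|(tnth z.1 k : R) * (tnth z.2 k : R)|))//.
    by rewrite ler_piMl.
  by rewrite normrM ler_pM.
have sumE (f : gvec d * gvec d -> R) : measurable_fun setT f ->
    (forall z, `|f z| <= 1) ->
    \int[(G d \x G d)%E]_z (f z * dot z.1 z.2) =
    \sum_(k < d) \int[(G d \x G d)%E]_z (f z * ((tnth z.1 k : R) * (tnth z.2 k : R))).
  move=> mf f1; rewrite -Rintegral_sum; last by move=> k _; exact: iprod.
  by apply: eq_Rintegral => z _; rewrite mulr_sumr.
pose Q := \int[(G d \x G d)%E]_z (corr (G d) s z * dot z.1 z.2).
have QE ga : 2 * ga * Th - ga ^+ 2 * (d%:R * s2) <= Q.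
  rewrite /Q /Th (sumE s)// (sumE (corr (G d) s)); last 2 first.
  - exact: measurable_corr.
  - exact: normr_corr_le1.
  rewrite -Rintegral_sqnorm.
  have -> : \int[G d]_x dot x x = \sum_(k < d) \int[G d]_x (tnth x k : R) ^+ 2.
    rewrite -Rintegral_sum; last by move=> k _; exact: it2.
    by apply: eq_Rintegral => x _; apply: eq_bigr => k _; rewrite expr2.
  rewrite !mulr_sumr -sumrB; apply: ler_sum => k _.
  exact: (corr_test_ge ms s1 (mt k) ig (ag k) ga (it2 k)).
have [iD2 ED2] := dot2_moment R d.
have icD : L1 (G d \x G d)%E (fun z => corr (G d) s z * dot z.1 z.2).
  have -> : (fun z : gvec d * gvec d => corr (G d) s z * dot z.1 z.2) =
      (fun z => \sum_(k < d) corr (G d) s z * ((tnth z.1 k : R) * (tnth z.2 k : R))).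
    by apply/funext => z; rewrite mulr_sumr.
  apply: L1_sum => k _; apply: iprod; first exact: measurable_corr.
  exact: normr_corr_le1.
have KE be : 2 * be * Q - be ^+ 2 * (d%:R * s2 ^+ 2) <= corr_moment (G d) s 2.
  rewrite -ED2 -RintegralZl// -RintegralZl// -RintegralB//; last 2 first.
  - exact: L1Z.
  - exact: L1Z.
  apply: le_RintegralT; first by apply: L1B; exact: L1Z.
    exact: L1_corr.
  by move=> z; have := sqr_ge0 (corr (G d) s z - be * dot z.1 z.2); nra.
have Q1 : c ^+ 2 / s2 <= Q.
  apply: le_trans (QE (Th / (d%:R * s2))).
  have -> : 2 * (Th / (d%:R * s2)) * Th - (Th / (d%:R * s2)) ^+ 2 * (d%:R * s2) =
    (- Th) ^+ 2 / d%:R / s2 by field; rewrite !lt0r_neq0.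
  rewrite ler_pM2r ?invr_gt0// ler_pdivlMr//.
  have -> : c ^+ 2 * d%:R = (c * Num.sqrt d%:R) ^+ 2 by rewrite exprMn sqr_sqrtr.
  rewrite lerXn2r ?nnegrE//; first by rewrite mulr_ge0// ?sqrtr_ge0// ltW.
  by rewrite (le_trans _ ThE)// mulr_ge0// ?sqrtr_ge0// ltW.
apply: le_trans (KE (Q / (d%:R * s2 ^+ 2))).
have -> : 2 * (Q / (d%:R * s2 ^+ 2)) * Q - (Q / (d%:R * s2 ^+ 2)) ^+ 2 * (d%:R * s2 ^+ 2) =
    Q ^+ 2 / s2 ^+ 2 / d%:R by field; rewrite !lt0r_neq0.
rewrite ler_pM2r ?invr_gt0//.
have -> : c ^+ 4 / s2 ^+ 4 = (c ^+ 2 / s2) ^+ 2 / s2 ^+ 2 by field; rewrite lt0r_neq0.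
rewrite ler_pM2r ?invr_gt0 ?exprn_gt0// lerXn2r ?nnegrE//.
  by rewrite divr_ge0 ?sqr_ge0// ltW.
by rewrite (le_trans _ Q1)// divr_ge0 ?sqr_ge0// ltW.
Qed.

End gaussian_kernel.

(** * Upper bound on the correlation of two rows *)

Section gaussian_correlation.
Context (R : realType).
Local Notation RR := (measurableTypeR R).
Local Notation N := (normal_prob 0 1 : probability RR R).
Local Notation G d := (gauss_vec R d).
Notation gvec d := (d.-tuple RR).

Let m1 : R := \int[N]_u `|u : R|.

Let iabs : L1 N (fun u : RR => `|u : R|).
Proof. exact: (integrable_norm (@L1_normal_pow R 1 isT)). Qed.

(** Given [u], the conditional probability [F u] of the second half-plane is a
    Lipschitz function of [u] with constant [|b| / c], and the covariance of an
    indicator with such a function is controlled by [E |F u - F v|]. *)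
Lemma halfplane_cov (A : pred RR) (F : R -> R) (T b c : R) : 0 < c ->
  measurable_fun setT (fun u : RR => (A u)%:R : RR) ->
  (forall u, F u = \int[N]_w (b * u + c * (w : R) <= T)%R%:R) ->
  `|\int[N]_u ((A u)%:R * F (u : R)) - (\int[N]_u (A u)%:R) * \int[N]_u F (u : R)|
  <= 2 * m1 * (`|b| / c).
Proof.
move=> c0 mA FI.
have FE u : F u = ncdf ((T - b * u) / c).
  rewrite FI; apply: eq_Rintegral => w _; congr ((_ : bool)%:R).
  by rewrite ler_pdivlMr// lerBrDl (mulrC (w : R)).
have FL u v : `|F u - F v| <= (`|b| / c) * (`|u| + `|v|).
  rewrite !FE; apply: (le_trans (ncdf_lipschitz _ _)).
  rewrite -mulrBl normrM (ger0_norm (x := c^-1)) ?invr_ge0 ?(ltW c0)//.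
  rewrite [leRHS]mulrAC ler_wpM2r ?invr_ge0 ?(ltW c0)//.
  have -> : T - b * u - (T - b * v) = b * (v - u) by ring.
  by rewrite normrM ler_wpM2l// (addrC `|u|) ler_normB.
have F1 u : `|F u| <= 1.
  rewrite FI; apply: normr_Rintegral_le => [|w]; last exact: normr_bool_le1.
  have ml : measurable_fun setT (fun w : RR => b * u + c * (w : R) : RR).
    by apply: measurable_funD => //; exact: measurable_funM.
  exact: measurable_itv_indic ml.
have mF : measurable_fun setT (fun u : RR => F (u : R) : RR).
  rewrite (funext FI : F = _).
  apply: (measurable_Rintegral1 N N (f := fun z : RR * RR => (b * z.1 + c * z.2 <= T)%R%:R) (M := 1)).
    apply: measurable_itv_indic; apply: measurable_funD; exact: measurable_funM.
  by move=> z; exact: normr_bool_le1.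
have iF : L1 N (fun u : RR => F (u : R)) by exact: (L1_bounded _ mF (M := 1)).
have iAF : L1 N (fun u : RR => (A u)%:R * F (u : R)).
  apply: (L1_bounded _ (M := 1)) => [|u]; first exact: measurable_funM.
  by apply: normrM_le1 => //; exact: normr_bool_le1.
have iA : L1 N (fun u : RR => (A u)%:R).
  by apply: (L1_bounded _ mA (M := 1)) => u; exact: normr_bool_le1.
rewrite -RintegralZr// -RintegralB//; last first.
  by under [X in EFin \o X]funext do rewrite mulrC; exact: L1Z.
have key u : `|(A u)%:R * F (u : R) - (A u)%:R * \int[N]_v F (v : R)| <=
    (`|b| / c) * (`|u : R| + m1).
  rewrite -mulrBr normrM (@le_trans _ _ (`|F (u : R) - \int[N]_v F (v : R)|))//.
    by rewrite ler_piMl// normr_bool_le1.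
  rewrite -[X in `|X - _|](Rintegral_cstT N) -RintegralB//; last exact: L1_cst.
  have iFF : L1 N (fun v : RR => F (u : R) - F (v : R)) by apply: L1B => //; exact: L1_cst.
  apply: (le_trans (le_normr_Rintegral measurableT iFF)).
  have -> : `|b| / c * (`|u : R| + m1) = \int[N]_v (`|b| / c * (`|u : R| + `|v : R|)).
    rewrite RintegralZl//; last by apply: L1D => //; exact: L1_cst.
    by rewrite RintegralD// ?(Rintegral_cstT N)//; exact: L1_cst.
  apply: le_RintegralT => [||v].
  - exact: (integrable_norm iFF).
  - by apply: L1Z; apply: L1D => //; exact: L1_cst.
  - exact: FL.
have iB : L1 N (fun u : RR => (A u)%:R * F (u : R) - (A u)%:R * \int[N]_v F (v : R)).
  apply: L1B => //.
  by under [X in EFin \o X]funext do rewrite mulrC; exact: L1Z.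
apply: (le_trans (le_normr_Rintegral measurableT iB)).
have -> : 2 * m1 * (`|b| / c) = \int[N]_u ((`|b| / c) * (`|u : R| + m1)).
  rewrite RintegralZl//; last by apply: L1D => //; exact: L1_cst.
  rewrite RintegralD// ?(Rintegral_cstT N)//; last exact: L1_cst.
  by rewrite -/m1; ring.
apply: le_RintegralT => [||u].
- exact: (integrable_norm iB).
- by apply: L1Z; apply: L1D => //; exact: L1_cst.
- exact: key.
Qed.

(** The edge probability of a vertex with latent vector [x]. Its mean is [p],
    and it depends on [x] through the norm only. *)
Definition row_mean d (t : R) (x : gvec d) : R :=
  \int[G d]_y (scaled_dot x y <= t)%R%:R.

Definition row_pair_mean d (t : R) (z : gvec d * gvec d) : R :=
  \int[G d]_y ((scaled_dot z.1 y <= t)%R%:R * (scaled_dot z.2 y <= t)%R%:R).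

Lemma measurable_edge_row d t (x : gvec d) :
  measurable_fun setT (fun y : gvec d => (scaled_dot x y <= t)%R%:R : RR).
Proof. exact: (measurable_section1 x (measurable_edge t)). Qed.

Lemma L1_edge_row d t (x : gvec d) :
  L1 (G d) (fun y : gvec d => (scaled_dot x y <= t)%R%:R).
Proof.
apply: (L1_bounded _ (M := 1)) => [|y]; first exact: measurable_edge_row.
exact: normr_bool_le1.
Qed.

Lemma L1_edge_pair d t (z : gvec d * gvec d) :
  L1 (G d) (fun y => (scaled_dot z.1 y <= t)%R%:R * (scaled_dot z.2 y <= t)%R%:R).
Proof.
apply: (L1_bounded _ (M := 1)) => [|y].
  by apply: measurable_funM; exact: measurable_edge_row.
by apply: normrM_le1; exact: normr_bool_le1.
Qed.

(** The first summand is the covariance of the two edges for the true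
    conditional means; the second one accounts for centring at [p]. *)
Lemma corr_decomp d p t (z : gvec d * gvec d) :
  corr (G d) (edge_dev p t) z =
  (row_pair_mean t z - row_mean t z.1 * row_mean t z.2) +
  (row_mean t z.1 - p) * (row_mean t z.2 - p).
Proof.
transitivity (row_pair_mean t z - p * row_mean t z.2 - p * row_mean t z.1 + p * p);
  last by ring.
rewrite /corr /row_pair_mean /row_mean.
rewrite -[p * p](Rintegral_cstT (G d)) -!RintegralZl//; [|exact: L1_edge_row|exact: L1_edge_row].
have i1 := L1_edge_pair t z.
have i2 := L1Z p (L1_edge_row t z.2).
have i3 := L1Z p (L1_edge_row t z.1).
have i4 := L1_cst (G d) (p * p).
rewrite -RintegralB// -RintegralB//; last exact: L1B.
rewrite -RintegralD//; last by apply: L1B => //; exact: L1B.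
by apply: eq_Rintegral => y _; rewrite /edge_dev /=; ring.
Qed.

Lemma row_mean_itv d t (x : gvec d) : 0 <= row_mean t x <= 1.
Proof.
rewrite Rintegral_ge0//=; apply: le_trans (ler_norm _) _.
apply: normr_Rintegral_le => [|y]; first exact: measurable_edge_row.
exact: normr_bool_le1.
Qed.

Lemma row_pair_mean_itv d t (z : gvec d * gvec d) : 0 <= row_pair_mean t z <= 1.
Proof.
rewrite Rintegral_ge0//=.
apply: le_trans (ler_norm _) _.
apply: normr_Rintegral_le => [|y]; last by apply: normrM_le1; exact: normr_bool_le1.
by apply: measurable_funM; exact: measurable_edge_row.
Qed.

Lemma scaled_dot_le d t (x y : gvec d) : (0 < d)%N ->
  (scaled_dot x y <= t) = (dot x y <= Num.sqrt d%:R * t).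
Proof.
move=> d0; rewrite scaled_dotE mulrC ler_pdivrMr ?sqrtr_gt0 ?ltr0n//.
by rewrite mulrC.
Qed.

Lemma row_meanE d t (x : gvec d) : (0 < d)%N -> row_mean t x =
  \int[N]_u (Num.sqrt (dot x x) * (u : R) <= Num.sqrt d%:R * t)%R%:R.
Proof.
move=> d0; rewrite -(gauss_dot_Rintegral x (g := fun z => ((z : R) <= Num.sqrt d%:R * t)%R%:R)).
- by apply: eq_Rintegral => y _; rewrite scaled_dot_le.
- exact: measurable_itv_indic.
- by [].
Qed.

Lemma cov_bound d t (z : gvec d * gvec d) : (0 < d)%N ->
  exists a b c : R, [/\ 0 <= c, a ^+ 2 = dot z.1 z.1, a * b = dot z.1 z.2,
    b ^+ 2 + c ^+ 2 = dot z.2 z.2 &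
    0 < c -> `|row_pair_mean t z - row_mean t z.1 * row_mean t z.2| <=
             2 * m1 * (`|b| / c)].
Proof.
move=> d0; have [a [b [c [/andP[a0 c0] aE abE bcE law]]]] := gauss_pair_law z.1 z.2.
exists a, b, c; split => // cp; set T := Num.sqrt d%:R * t.
pose A (u : RR) := a * (u : R) <= T.
have mA : measurable_fun setT (fun u : RR => (A u)%:R : RR).
  by apply: measurable_itv_indic; exact: measurable_funM.
have lawR (g : RR * RR -> R) : measurable_fun setT (g : _ -> RR) -> (forall q, 0 <= g q <= 1) ->
    \int[G d]_y g (dot z.1 y, dot z.2 y) = \int[N]_u \int[N]_w g (a * (u : R), b * u + c * (w : R)).
  move=> mg g01; have mgl : measurable_fun setT
      (fun q : RR * RR => g (a * q.1, b * q.1 + c * q.2) : RR).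
    apply: (measurableT_comp mg); apply: measurable_fun_pair; first exact: measurable_funM.
    by apply: measurable_funD; exact: measurable_funM.
  rewrite {1}/Rintegral (law (fun q => (g q)%:E)); last 2 first.
  - exact/measurable_EFinP.
  - by move=> q; rewrite lee_fin; case/andP: (g01 q).
  rewrite /Rintegral; congr fine; apply: eq_integral => u _.
  rewrite fineK//; apply: integrable_fin_num => //; apply: (L1_bounded _ (M := 1)).
    exact: (measurable_section1 u mgl).
  by move=> w; have /andP[g0 g1] := g01 (a * u, b * u + c * w); rewrite ger0_norm.
have b01 (q : bool) : (0 : R) <= q%:R <= 1 by case: q; rewrite ?lexx ?ler01.
have m1' : measurable_fun setT (fun q : RR * RR => ((q.1 : R) <= T)%R%:R : RR).
  exact: measurable_itv_indic.
have m2' : measurable_fun setT (fun q : RR * RR => ((q.2 : R) <= T)%R%:R : RR).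
  exact: measurable_itv_indic.
have := halfplane_cov cp mA (fun u => erefl (\int[N]_w (b * u + c * (w : R) <= T)%R%:R)).
have -> : row_pair_mean t z = \int[N]_u \int[N]_w ((A u)%:R * (b * (u : R) + c * (w : R) <= T)%R%:R).
  rewrite -(lawR (fun q => ((q.1 : R) <= T)%R%:R * ((q.2 : R) <= T)%R%:R)).
  - by apply: eq_Rintegral => y _; rewrite !scaled_dot_le.
  - exact: measurable_funM.
  - by move=> q; rewrite -natrM mulnb; exact: b01.
have -> : row_mean t z.1 = \int[N]_u (A u)%:R.
  transitivity (\int[N]_u \int[N]_w (A u)%:R :> R).
    rewrite -(lawR (fun q => ((q.1 : R) <= T)%R%:R) m1' (fun q => b01 _ _)).
    by apply: eq_Rintegral => y _; rewrite scaled_dot_le.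
  by apply: eq_Rintegral => u _; rewrite (Rintegral_cstT N).
have -> : row_mean t z.2 = \int[N]_u \int[N]_w (b * (u : R) + c * (w : R) <= T)%R%:R.
  rewrite -(lawR (fun q => ((q.2 : R) <= T)%R%:R) m2' (fun q => b01 _ _)).
  by apply: eq_Rintegral => y _; rewrite scaled_dot_le.
apply: le_trans; rewrite le_eqVlt; apply/orP; left; apply/eqP.
congr (`|_ - _|); apply: eq_Rintegral => u _; rewrite RintegralZl//.
apply: (L1_bounded _ (M := 1)) => [|w]; last exact: normr_bool_le1.
apply: measurable_itv_indic; apply: measurable_funD => //; exact: measurable_funM.
Qed.

Let s2 := normal_var R.

(** If [|x|^2] is close to its mean, [ncdf_scale] compares the two normal
    probabilities; otherwise the right side is at least [1]. *)
Lemma row_mean_dev d t (x : gvec d) : (0 < d)%N ->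
  `|row_mean t x - ncdf (t / Num.sqrt s2)| <=
  2 * (`|dot x x - d%:R * s2| / (d%:R * s2)).
Proof.
move=> d0; have s20 : 0 < s2 := normal_var_gt0 R.
have dn0 : 0 < d%:R :> R by rewrite ltr0n.
pose de : R := d%:R * s2; have de0 : 0 < de by rewrite mulr_gt0.
set th := t / Num.sqrt s2.
pose r := Num.sqrt (dot x x) / Num.sqrt de.
have r0 : 0 <= r by rewrite divr_ge0 ?sqrtr_ge0.
have sde : 0 < Num.sqrt de by rewrite sqrtr_gt0.
have r2 : r ^+ 2 = dot x x / de.
  by rewrite expr_div_n !sqr_sqrtr ?dot_ge0// ltW.
have -> : `|dot x x - d%:R * s2| / (d%:R * s2) = `|r ^+ 2 - 1|.
  rewrite r2 -/de -[X in _ / X](gtr0_norm de0) -normf_div mulrBl divff//.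
  exact: lt0r_neq0.
have rE : row_mean t x = \int[N]_u (r * (u : R) <= th)%R%:R.
  rewrite row_meanE//; apply: eq_Rintegral => u _; congr ((_ : bool)%:R).
  rewrite /r /th -mulrAC ler_pdivrMr// mulrAC ler_pdivlMr ?sqrtr_gt0//.
  rewrite /de sqrtrM// [Num.sqrt d%:R * _]mulrC mulrA.
  by rewrite ler_pM2r ?sqrtr_gt0.
have ncdf01 (a : R) : 0 <= ncdf a <= 1.
  rewrite Rintegral_ge0//=; apply: le_trans (ler_norm _) _.
  by apply: normr_Rintegral_le => [|u]; [exact: measurable_itv_indic|exact: normr_bool_le1].
have [rh|rh] := leP (r ^+ 2) 2^-1.
  apply: (@le_trans _ _ 1); last by rewrite ler0_norm; lra.
  by rewrite ler_norml; have := row_mean_itv t x; have := ncdf01 th; lra.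
have rh2 : 2^-1 < r.
  rewrite ltNge; apply/negP => rle; have : r ^+ 2 <= 2^-1 ^+ 2 by rewrite lerXn2r ?nnegrE//; lra.
  by lra.
have rgt0 : 0 < r by lra.
have rE2 : row_mean t x = ncdf (th / r).
  rewrite rE; apply: eq_Rintegral => u _; congr ((_ : bool)%:R).
  by rewrite [RHS]ler_pdivlMr// (mulrC (u : R)).
rewrite rE2; have [r1|r1] := leP 1 r.
  have := ncdf_scale (th / r) r1; rewrite mulrC divfK ?lt0r_neq0// distrC => /le_trans; apply.
  by rewrite ger0_norm; nra.
have rV1 : 1 <= r^-1 by rewrite invf_ge1// ltW.
have := ncdf_scale th rV1; rewrite mulrC => /le_trans; apply.
have rr : r * r^-1 = 1 by rewrite divff// lt0r_neq0.
by rewrite ler0_norm; nra.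
Qed.

Lemma measurable_row_mean d t : measurable_fun setT (fun x : gvec d => row_mean t x : RR).
Proof.
apply: (measurable_Rintegral1 (G d) (G d) (measurable_edge t) (M := 1)) => z.
exact: normr_bool_le1.
Qed.

Lemma Rintegral_row_mean d p t : is_threshold d p t ->
  \int[G d]_x row_mean t x = p.
Proof.
by move=> tp; rewrite -(Rintegral_edge tp) (Fubini12 (L1_edge d t)).
Qed.

(** The mean [p] minimises the quadratic deviation, so [p] may be replaced by
    the constant of [row_mean_dev]. *)
Lemma row_mean_var d p t K : (0 < d)%N -> is_threshold d p t ->
  \int[G d]_x (dot x x - d%:R * s2) ^+ 2 <= K * d%:R ->
  \int[G d]_x (row_mean t x - p) ^+ 2 <= 4 * K / s2 ^+ 2 / d%:R.
Proof.
move=> d0 tp KE; have s20 : 0 < s2 := normal_var_gt0 R.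
have dn0 : 0 < d%:R :> R by rewrite ltr0n.
pose de : R := d%:R * s2; have de0 : 0 < de by rewrite mulr_gt0.
set c0 := ncdf (t / Num.sqrt s2).
have mr : measurable_fun setT (fun x : gvec d => row_mean t x : RR) by exact: measurable_row_mean.
have ir : L1 (G d) (fun x => row_mean t x).
  apply: (L1_bounded _ mr (M := 1)) => x.
  by have /andP[? ?] := row_mean_itv t x; rewrite ger0_norm.
have ir2 (c : R) : L1 (G d) (fun x => (row_mean t x - c) ^+ 2).
  apply: (L1_bounded _ (M := (1 + `|c|) ^+ 2)) => [|x].
    by apply: measurable_funX; apply: measurable_funB.
  rewrite normrX lerXn2r ?nnegrE// (le_trans (ler_normB _ _))// lerD2r.
  by have /andP[? ?] := row_mean_itv t x; rewrite ger0_norm.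
apply: (@le_trans _ _ (\int[G d]_x (row_mean t x - c0) ^+ 2)).
  rewrite -subr_ge0 -RintegralB//.
  have -> : \int[G d]_x ((row_mean t x - c0) ^+ 2 - (row_mean t x - p) ^+ 2) =
      \int[G d]_x (2 * (p - c0) * row_mean t x + (c0 ^+ 2 - p ^+ 2)).
    by apply: eq_Rintegral => x _; ring.
  rewrite RintegralD//; [|exact: L1Z|exact: L1_cst].
  rewrite RintegralZl// (Rintegral_row_mean tp) (Rintegral_cstT (G d)).
  by have := sqr_ge0 (p - c0); nra.
apply: (@le_trans _ _ (\int[G d]_x (4 / de ^+ 2 * (dot x x - d%:R * s2) ^+ 2))).
  apply: le_RintegralT => [||x].
  - exact: ir2.
  - by apply: L1Z; exact: L1_sqnorm_dev.
  - have := row_mean_dev t x d0; rewrite -/c0 -/de.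
    rewrite -[(row_mean t x - c0) ^+ 2]real_normK ?num_real// => h.
    have -> : 4 / de ^+ 2 * (dot x x - de) ^+ 2 = (2 * (`|dot x x - de| / de)) ^+ 2.
      rewrite -[(dot x x - de) ^+ 2]real_normK ?num_real//; field; exact: lt0r_neq0.
    by rewrite lerXn2r ?nnegrE// mulr_ge0// divr_ge0// ltW.
rewrite RintegralZl//; last exact: L1_sqnorm_dev.
apply: (@le_trans _ _ (4 / de ^+ 2 * (K * d%:R))).
  by rewrite ler_wpM2l// divr_ge0// sqr_ge0.
rewrite le_eqVlt; apply/orP; left; apply/eqP; rewrite /de; field.
by rewrite !lt0r_neq0.
Qed.

(** If [|x|^2] or [|x'|^2] is below half of its mean, or [<x,x'>] is of order
    [d], the right side is at least the trivial bound [1]. In the remaining case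
    [c^2] is of order [d] and [cov_bound] gives a covariance of order
    [|<x,x'>| / d]. *)
Lemma cov4_bound d t (z : gvec d * gvec d) : (0 < d)%N ->
  (row_pair_mean t z - row_mean t z.1 * row_mean t z.2) ^+ 4 <=
  (64 * (16 * m1 ^+ 4 + 1)) / (d%:R * s2) ^+ 4 *
  (dot z.1 z.2 ^+ 4 + ((dot z.1 z.1 - d%:R * s2) ^+ 4 + (dot z.2 z.2 - d%:R * s2) ^+ 4)).
Proof.
move=> d0; have s20 : 0 < s2 := normal_var_gt0 R.
have dn0 : 0 < d%:R :> R by rewrite ltr0n.
have de0 : 0 < d%:R * s2 :> R by rewrite mulr_gt0.
have m10 : 0 <= m1 by apply: Rintegral_ge0 => u _.
have [a [b [c [c0 aE abE bcE cov]]]] := cov_bound t z d0.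
move: aE abE bcE cov; set X := dot z.1 z.1; set X' := dot z.2 z.2; set D := dot z.1 z.2.
set W := row_pair_mean t z - _; move: de0; set de := d%:R * s2 => de0 aE abE bcE cov.
have W1 : `|W| <= 1.
  rewrite ler_norml; have /andP[? ?] := row_pair_mean_itv t z.
  have /andP[? ?] := row_mean_itv t z.1; have /andP[? ?] := row_mean_itv t z.2.
  by rewrite /W; nra.
clearbody W X X' D de.
have W41 : W ^+ 4 <= 1.
  by rewrite -[leLHS]ger0_norm ?exprn_even_ge0// normrX exprn_ile1.
have D4 : 0 <= D ^+ 4 by rewrite exprn_even_ge0.
have X4 : 0 <= (X - de) ^+ 4 by rewrite exprn_even_ge0.
have X'4 : 0 <= (X' - de) ^+ 4 by rewrite exprn_even_ge0.
have m4 : 0 <= m1 ^+ 4 by rewrite exprn_ge0.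
have de4 : 0 < de ^+ 4 by rewrite exprn_gt0.
rewrite mulrAC ler_pdivlMr//.
(* Here the trivial bound [W^4 <= 1] suffices. *)
have far (Y : R) : Y <= de / 2 -> W ^+ 4 * de ^+ 4 <= 16 * (Y - de) ^+ 4.
  move=> Yd; apply: (@le_trans _ _ (de ^+ 4)); first by rewrite ler_piMl// ltW.
  have -> : 16 * (Y - de) ^+ 4 = (2 * (de - Y)) ^+ 4 by ring.
  by apply: lerXn2r; rewrite ?nnegrE; lra.
have [Xd|Xd] := leP X (de / 2).
  apply: (le_trans (far _ Xd)); nra.
have [X'd|X'd] := leP X' (de / 2).
  apply: (le_trans (far _ X'd)); nra.
have b2 : b ^+ 2 * de <= 2 * D ^+ 2.
  have -> : D ^+ 2 = X * b ^+ 2 by rewrite -abE -aE; ring.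
  by have := sqr_ge0 b; nra.
have D2 : 0 <= D ^+ 2 by exact: sqr_ge0.
have b20 : 0 <= b ^+ 2 by exact: sqr_ge0.
have DD : D ^+ 4 = (D ^+ 2) ^+ 2 by rewrite -exprM.
have [cd|cd] := leP (de / 4) (c ^+ 2); last first.
  have bd : de ^+ 2 <= 8 * D ^+ 2 by nra.
  have : (de ^+ 2) ^+ 2 <= (8 * D ^+ 2) ^+ 2.
    by rewrite lerXn2r ?nnegrE ?sqr_ge0// mulr_ge0.
  rewrite -exprM exprMn -DD => h.
  have : W ^+ 4 * de ^+ 4 <= de ^+ 4 by rewrite ler_piMl// ltW.
  by nra.
have cp : 0 < c.
  rewrite lt_neqAle c0 andbT eq_sym; apply/eqP => c00.
  by move: cd; rewrite c00 expr0n/=; lra.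
have := cov cp => Wb.
have W4 : W ^+ 4 * c ^+ 4 <= 16 * m1 ^+ 4 * b ^+ 4.
  have -> : 16 * m1 ^+ 4 * b ^+ 4 = (2 * m1 * (`|b| / c)) ^+ 4 * c ^+ 4.
    have -> : b ^+ 4 = `|b| ^+ 4 by rewrite -normrX ger0_norm// exprn_even_ge0.
    field; exact: lt0r_neq0.
  rewrite ler_wpM2r ?exprn_ge0//.
  rewrite -[leLHS]ger0_norm ?exprn_even_ge0// normrX lerXn2r ?nnegrE//.
  by rewrite mulr_ge0// ?divr_ge0// mulr_ge0.
have c4 : (de / 4) ^+ 2 <= c ^+ 4.
  have -> : c ^+ 4 = (c ^+ 2) ^+ 2 by rewrite -exprM.
  by rewrite lerXn2r ?nnegrE ?sqr_ge0// divr_ge0// ltW.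
have b4 : b ^+ 4 * de ^+ 2 <= 4 * D ^+ 4.
  have -> : b ^+ 4 * de ^+ 2 = (b ^+ 2 * de) ^+ 2 by ring.
  have -> : 4 * D ^+ 4 = (2 * D ^+ 2) ^+ 2 by ring.
  by rewrite lerXn2r ?nnegrE// mulr_ge0// ltW.
have W40 : 0 <= W ^+ 4 by rewrite exprn_even_ge0.
have step1 : W ^+ 4 * (de / 4) ^+ 2 <= 16 * m1 ^+ 4 * b ^+ 4.
  by apply: le_trans W4; rewrite ler_wpM2l.
have step2 : W ^+ 4 * de ^+ 4 <= 16 * 16 * (m1 ^+ 4 * (b ^+ 4 * de ^+ 2)).
  have -> : W ^+ 4 * de ^+ 4 = 16 * (W ^+ 4 * (de / 4) ^+ 2) * de ^+ 2 by field.
  have -> : 16 * 16 * (m1 ^+ 4 * (b ^+ 4 * de ^+ 2)) = 16 * (16 * m1 ^+ 4 * b ^+ 4) * de ^+ 2.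
    by ring.
  by rewrite ler_wpM2r ?sqr_ge0// ler_wpM2l.
have step3 : m1 ^+ 4 * (b ^+ 4 * de ^+ 2) <= m1 ^+ 4 * (4 * D ^+ 4) by rewrite ler_wpM2l.
have : 0 <= m1 ^+ 4 * ((X - de) ^+ 4 + (X' - de) ^+ 4) by rewrite mulr_ge0// addr_ge0.
nra.
Qed.

(** In [corr_decomp], the fourth power of the first term has mean of order
    [d^2 / d^4] by the moments of inner products and norms. The second term is
    a product of independent factors whose fourth moments are of order [1 / d]. *)
Lemma corr_moment4_upper (p : R) : 0 < p < 1 -> exists2 C : R, 0 <= C &
  forall d t, (0 < d)%N -> is_threshold d p t ->
  corr_moment (G d) (edge_dev p t) 4 <= C / d%:R ^+ 2.
Proof.
move=> p01; have s20 : 0 < s2 := normal_var_gt0 R.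
have [K K0 KE] := sqnorm_dev_bounds R.
have [K4 K40 K4E] := dot4_bound R.
have m10 : 0 <= m1 by apply: Rintegral_ge0 => u _.
pose C1 := (64 * (16 * m1 ^+ 4 + 1)) / s2 ^+ 4.
have C10 : 0 <= C1.
  apply: divr_ge0; last by apply: exprn_ge0; exact: ltW.
  by apply: mulr_ge0 => //; apply: addr_ge0 => //; apply: mulr_ge0 => //; exact: exprn_ge0.
pose C2 := (4 * K / s2 ^+ 2) ^+ 2.
exists (8 * (C1 * (K4 + (K + K)) + C2)).
  by rewrite mulr_ge0// addr_ge0 ?sqr_ge0// mulr_ge0// !addr_ge0.
move=> d t d0 tp; have [KE2 KE4] := KE d.
have dn0 : 0 < d%:R :> R by rewrite ltr0n.
have mr : measurable_fun setT (fun x : gvec d => row_mean t x : RR) by exact: measurable_row_mean.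
have rp1 (x : gvec d) : `|row_mean t x - p| <= 1.
  by rewrite ler_norml; have := row_mean_itv t x; lra.
have ir k : L1 (G d) (fun x => (row_mean t x - p) ^+ k).
  apply: (L1_bounded _ (M := 1)) => [|x].
    by apply: measurable_funX; exact: measurable_funB.
  by rewrite normrX exprn_ile1.
set c4 := (64 * (16 * m1 ^+ 4 + 1)) / (d%:R * s2) ^+ 4.
have [iD4 _] := dot4_moment R d.
have iX4 := L1_sqnorm_dev R d (isT : (4 <= 4)%N).
have i1 := L1_fst (G d) iX4; have i2 := L1_snd (G d) iX4.
have irr := L1_prod (P1 := G d) (P2 := G d) (ir 4) (ir 4).
have iA : L1 (G d \x G d)%E (fun z => (dot z.1 z.1 - d%:R * s2) ^+ 4 +
   (dot z.2 z.2 - d%:R * s2) ^+ 4) by exact: (L1D i1 i2).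
have iB := L1D iD4 iA.
apply: (@le_trans _ _ (\int[(G d \x G d)%E]_z (8 * (c4 * (dot z.1 z.2 ^+ 4 +
    ((dot z.1 z.1 - d%:R * s2) ^+ 4 + (dot z.2 z.2 - d%:R * s2) ^+ 4)) +
    (row_mean t z.1 - p) ^+ 4 * (row_mean t z.2 - p) ^+ 4)))).
  apply: le_RintegralT => [||z].
  - apply: L1_corr; first exact: measurable_edge_dev.
    by move=> z; exact: normr_edge_dev_le1.
  - by apply: L1Z; apply: L1D => //; exact: L1Z.
  - rewrite corr_decomp -[X in _ + X]opprK.
    apply: (le_trans (quartic_sub_le _ _)); rewrite ler_wpM2l//.
    have -> : (- ((row_mean t z.1 - p) * (row_mean t z.2 - p))) ^+ 4 =
      (row_mean t z.1 - p) ^+ 4 * (row_mean t z.2 - p) ^+ 4 by ring.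
    by rewrite lerD2r; exact: cov4_bound.
rewrite RintegralZl//; last by apply: L1D => //; exact: L1Z.
rewrite RintegralD//; last exact: L1Z.
rewrite RintegralZl// RintegralD// RintegralD//.
rewrite (Rintegral_prod (P1 := G d) (P2 := G d) (ir 4) (ir 4)).
have -> : \int[(G d \x G d)%E]_z (dot z.1 z.1 - d%:R * s2) ^+ 4 =
    \int[G d]_x (dot x x - d%:R * s2) ^+ 4.
  rewrite (Fubini12 i1); apply: eq_Rintegral => x _ /=.
  exact: (Rintegral_cstT (G d)).
have -> : \int[(G d \x G d)%E]_z (dot z.2 z.2 - d%:R * s2) ^+ 4 =
    \int[G d]_x (dot x x - d%:R * s2) ^+ 4.
  rewrite (Fubini21 i2); apply: eq_Rintegral => x _ /=.
  exact: (Rintegral_cstT (G d)).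
rewrite -mulrA ler_wpM2l// mulrDl; apply: lerD.
  have -> : C1 * (K4 + (K + K)) / d%:R ^+ 2 =
      c4 * (K4 * d%:R ^+ 2 + (K * d%:R ^+ 2 + K * d%:R ^+ 2)).
    by rewrite /C1 /c4; field; rewrite !lt0r_neq0.
  rewrite ler_wpM2l//.
    apply: divr_ge0; last by apply: exprn_ge0; apply: mulr_ge0 => //; exact: ltW.
    by apply: mulr_ge0 => //; apply: addr_ge0 => //; apply: mulr_ge0 => //; exact: exprn_ge0.
  by rewrite !lerD// K4E.
have v4 : \int[G d]_x (row_mean t x - p) ^+ 4 <= 4 * K / s2 ^+ 2 / d%:R.
  apply: le_trans (row_mean_var d0 tp KE2); apply: le_RintegralT => // x.
  rewrite -[4%N]/(2 + 2)%N exprD ler_piMr ?sqr_ge0//.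
  by rewrite -real_normK ?num_real// exprn_ile1.
have v40 : 0 <= \int[G d]_x (row_mean t x - p) ^+ 4.
  by apply: Rintegral_ge0 => x _; rewrite exprn_even_ge0.
by rewrite /C2 -expr_div_n expr2 ler_pM.
Qed.

End gaussian_correlation.

(** * Averages over latent vectors *)

Section pair_products.
Context (R : comPzSemiRingType) (n : nat).

(** Multiplicity of [x] in the pair [e]. A signed cycle on the rows [e] and the
    columns [f] is the product of all entries [(i, k)] with exponents
    [pairn e i * pairn f k], and a product of two cycles has the sum of the
    exponents; overlapping cycles need no case distinction at this stage. *)
Definition pairn (e : 'I_n * 'I_n) (x : 'I_n) : nat := (x == e.1) + (x == e.2).

Lemma pairnC a b : pairn (a, b) = pairn (b, a).
Proof. by apply/funext => x; rewrite /pairn addnC. Qed.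

Lemma prod_supp (r : seq 'I_n) (F : 'I_n -> R) : uniq r ->
  (forall x, x \notin r -> F x = 1) -> \prod_x F x = \prod_(x <- r) F x.
Proof.
move=> ur F1; rewrite (bigID (mem r))/= [X in _ * X]big1 ?mulr1//.
by rewrite big_uniq.
Qed.

Lemma prod_pairn (G : 'I_n -> nat -> R) a b : a != b ->
  (forall x, G x 0%N = 1) -> \prod_x G x (pairn (a, b) x) = G a 1%N * G b 1%N.
Proof.
move=> ab G0; rewrite (@prod_supp [:: a; b]) ?big_cons ?big_nil ?mulr1.
- by rewrite /pairn/= !eqxx (negbTE ab) eq_sym (negbTE ab).
- by rewrite /= inE ab.
- by move=> x; rewrite !inE negb_or /pairn/= => /andP[/negbTE-> /negbTE->].
Qed.

Lemma prod_pairn_disjoint (G : 'I_n -> nat -> nat -> R) a b a' b' :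
  uniq [:: a; b; a'; b'] -> (forall x, G x 0%N 0%N = 1) ->
  \prod_x G x (pairn (a, b) x) (pairn (a', b') x) =
  G a 1%N 0%N * (G b 1%N 0%N * (G a' 0%N 1%N * G b' 0%N 1%N)).
Proof.
move=> u G0; rewrite (@prod_supp [:: a; b; a'; b'])// ?big_cons ?big_nil ?mulr1.
- move: u; rewrite /pairn/= !inE !negb_or => /and4P[/and3P[ab aa' ab'] /andP[ba' bb'] a'b' _].
  rewrite !eqxx ![b == a]eq_sym ![a' == a]eq_sym ![a' == b]eq_sym.
  rewrite ![b' == a]eq_sym ![b' == b]eq_sym ![b' == a']eq_sym.
  by rewrite (negbTE ab) (negbTE aa') (negbTE ab') (negbTE ba') (negbTE bb') (negbTE a'b').
- move=> x; rewrite !inE !negb_or /pairn/=.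
  by move=> /and4P[/negbTE-> /negbTE-> /negbTE-> /negbTE->].
Qed.

Lemma prod_pairn_share (G : 'I_n -> nat -> nat -> R) a b b' :
  uniq [:: a; b; b'] -> (forall x, G x 0%N 0%N = 1) ->
  \prod_x G x (pairn (a, b) x) (pairn (a, b') x) =
  G a 1%N 1%N * (G b 1%N 0%N * G b' 0%N 1%N).
Proof.
move=> u G0; rewrite (@prod_supp [:: a; b; b'])// ?big_cons ?big_nil ?mulr1.
- move: u; rewrite /pairn/= !inE !negb_or => /and3P[/andP[ab ab'] bb' _].
  rewrite !eqxx ![b == a]eq_sym ![b' == a]eq_sym ![b' == b]eq_sym.
  by rewrite (negbTE ab) (negbTE ab') (negbTE bb').
- move=> x; rewrite !inE !negb_or /pairn/=.
  by move=> /and3P[/negbTE-> /negbTE-> /negbTE->].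
Qed.

Lemma prod_pairn_equal (G : 'I_n -> nat -> nat -> R) a b : a != b ->
  (forall x, G x 0%N 0%N = 1) ->
  \prod_x G x (pairn (a, b) x) (pairn (a, b) x) = G a 1%N 1%N * G b 1%N 1%N.
Proof. by move=> ab G0; rewrite (@prod_pairn (fun x k => G x k k)). Qed.

End pair_products.

Section latent_matrix.
Context d (T : measurableType d) (R : realType) (P : probability T R).
Variable w : T * T -> bool.
Hypothesis mw : measurable_fun setT (fun z => (w z)%:R : R).

Lemma measurable_bool_comp d' (X : measurableType d') (b : X -> bool) (g : bool -> R) :
  measurable_fun setT (fun x => (b x)%:R : R) -> measurable_fun setT (fun x => g (b x)).
Proof.
move=> mb; rewrite (_ : (fun x => _) = (fun x => g false + (g true - g false) * (b x)%:R)).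
  by apply: measurable_funD => //; exact: measurable_funM.
by apply/funext => x; case: (b x); rewrite /= ?mulr1 ?mulr0 ?addr0// subrKC.
Qed.

Definition latent_mean n m (phi : 'I_n -> 'I_m -> bool -> R) : R :=
  \int[(iid_prob P n \x iid_prob P m)%E]_z
    \prod_i \prod_k phi i k (w (tnth z.1 i, tnth z.2 k)).

Section expansion.
Variables (n m : nat) (phi : 'I_n -> 'I_m -> bool -> R).
Hypothesis phi1 : forall i k b, `|phi i k b| <= 1.

Lemma normr_prod_le1 (I : finType) (F : I -> R) : (forall i, `|F i| <= 1) ->
  `|\prod_i F i| <= 1.
Proof.
by move=> F1; rewrite normr_prod prodr_ile1// => i _; rewrite normr_ge0 F1.
Qed.

Lemma measurable_latent_integrand : measurable_fun setT
  (fun z : n.-tuple T * m.-tuple T =>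
    \prod_i \prod_k phi i k (w (tnth z.1 i, tnth z.2 k))).
Proof.
apply: measurable_prod => i _; apply: measurable_prod => k _.
apply: measurable_bool_comp; apply: (measurableT_comp mw).
apply: measurable_fun_pair.
  by apply: (measurableT_comp (@measurable_tnth _ T n i)).
by apply: (measurableT_comp (@measurable_tnth _ T m k)).
Qed.

Lemma L1_latent_integrand : L1 (iid_prob P n \x iid_prob P m)%E
  (fun z : n.-tuple T * m.-tuple T =>
    \prod_i \prod_k phi i k (w (tnth z.1 i, tnth z.2 k))).
Proof.
apply: (L1_bounded _ measurable_latent_integrand (M := 1)) => z.
by do 2 apply: normr_prod_le1 => ?.
Qed.

Lemma measurable_row_prod (xs : n.-tuple T) k :
  measurable_fun setT (fun y => \prod_i phi i k (w (tnth xs i, y))).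
Proof.
apply: measurable_prod => i _; apply: measurable_bool_comp.
exact: (measurable_section1 (tnth xs i) mw).
Qed.

(** Given the latent vectors of the rows, the columns are independent. *)
Lemma latent_mean_rows : latent_mean phi =
  \int[iid_prob P n]_xs \prod_k \int[P]_y \prod_i phi i k (w (tnth xs i, y)).
Proof.
rewrite /latent_mean (Fubini12 L1_latent_integrand); apply: eq_Rintegral => xs _ /=.
under eq_Rintegral do rewrite exchange_big/=.
rewrite (Rintegral_iid_prod P (g := fun k y => \prod_i phi i k (w (tnth xs i, y))) (M := 1))//.
- by move=> k; exact: measurable_row_prod.
- by move=> k y; exact: normr_prod_le1.
Qed.

Lemma L1_rows_mean : L1 (iid_prob P n)
  (fun xs => \prod_k \int[P]_y \prod_i phi i k (w (tnth xs i, y))).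
Proof.
have := L1_section1 L1_latent_integrand; congr (L1 _ _); apply/funext => xs /=.
under eq_Rintegral do rewrite exchange_big/=.
rewrite (Rintegral_iid_prod P (g := fun k y => \prod_i phi i k (w (tnth xs i, y))) (M := 1))//.
- by move=> k; exact: measurable_row_prod.
- by move=> k y; exact: normr_prod_le1.
Qed.

End expansion.

Lemma latent_mean_transpose n m (phi : 'I_n -> 'I_m -> bool -> R) :
  (forall x y, w (x, y) = w (y, x)) -> (forall i k b, `|phi i k b| <= 1) ->
  latent_mean phi = latent_mean (fun k i => phi i k).
Proof.
move=> wC phi1; rewrite /latent_mean.
rewrite (Fubini12 (L1_latent_integrand phi1)).
rewrite (Fubini21 (L1_latent_integrand (phi := fun k i => phi i k) (fun k i => phi1 i k))).
apply: eq_Rintegral => xs _; apply: eq_Rintegral => ys _ /=.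
rewrite exchange_big/=; apply: eq_bigr => k _; apply: eq_bigr => i _.
by rewrite wC.
Qed.

End latent_matrix.

(** * Means of pairs of signed cycles *)

(** In this part [fm j b] is the mean of the [j]-th power of an entry whose
    geometric edge is [b], over mask and noise: an entry has conditional mean
    [c s] and conditional second moment at most [v]. *)
Section cycle_moments.
Context d (T : measurableType d) (R : realType) (P : probability T R).
Variables (w : T * T -> bool) (p : R).
Hypothesis mw : measurable_fun setT (fun z => (w z)%:R : R).
Hypothesis hp : 0 < p < 1.
Variables (fm : nat -> bool -> R) (c v : R).
Hypotheses (fm0 : forall b, fm 0 b = 1) (fm1 : forall b, fm 1 b = c * (b%:R - p)).
Hypotheses (fm2 : forall b, 0 <= fm 2 b <= v) (fm_le1 : forall j b, `|fm j b| <= 1).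
Hypothesis c01 : 0 <= c <= 1.

Let s z : R := (w z)%:R - p.
Let kappa := corr_moment P s 2.
Let H := corr_moment P s 4.

Let ms : measurable_fun setT s.
Proof. exact: measurable_funB. Qed.

Let s1 z : `|s z| <= 1.
Proof. exact: normr_bool_sub_le1. Qed.

Definition cycle_mean n m (r : 'I_n -> nat) (k : 'I_m -> nat) : R :=
  latent_mean P w (fun i j => fm (r i * k j)%N).

Definition cycle_pair_mean n m (r r' : 'I_n -> nat) (k k' : 'I_m -> nat) : R :=
  latent_mean P w (fun i j => fm (r i * k j + r' i * k' j)%N).

Section column_mean.
Variables (n : nat).
Implicit Types (r : 'I_n -> nat) (xs : n.-tuple T).

(** Contribution, given the rows, of a column that occurs [j] times in the
    first cycle and [j'] times in the second one. *)
Definition column_mean r r' xs j j' : R :=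
  \int[P]_y \prod_i fm (r i * j + r' i * j')%N (w (tnth xs i, y)).

Lemma measurable_column r r' xs j j' : measurable_fun setT
  (fun y => \prod_i fm (r i * j + r' i * j')%N (w (tnth xs i, y))).
Proof.
exact: (measurable_row_prod mw (fun i (_ : 'I_1) b => fm (r i * j + r' i * j')%N b) xs ord0).
Qed.

Lemma normr_column_mean_le r r' xs j j' M :
  (forall y, `|\prod_i fm (r i * j + r' i * j')%N (w (tnth xs i, y))| <= M) ->
  `|column_mean r r' xs j j'| <= M.
Proof. by apply: normr_Rintegral_le; exact: measurable_column. Qed.

Lemma column_mean00 r r' xs : column_mean r r' xs 0 0 = 1.
Proof.
rewrite -[RHS](Rintegral_cstT P 1); apply: eq_Rintegral => y _.
by rewrite big1// => i _; rewrite !muln0 fm0.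
Qed.

Lemma column_mean10 a b r' xs : a != b ->
  column_mean (pairn (a, b)) r' xs 1 0 = c ^+ 2 * corr P s (tnth xs a, tnth xs b).
Proof.
move=> ab; rewrite /corr -RintegralZl//; last exact: L1_kernel_pair.
apply: eq_Rintegral => y _ /=.
under eq_bigr do rewrite muln1 muln0 addn0.
rewrite (@prod_pairn _ _ (fun x k => fm k (w (tnth xs x, y))))// !fm1 /s.
by ring.
Qed.

Lemma column_mean01 a b r xs : a != b ->
  column_mean r (pairn (a, b)) xs 0 1 = c ^+ 2 * corr P s (tnth xs a, tnth xs b).
Proof.
move=> ab; rewrite -(column_mean10 r xs ab); apply: eq_Rintegral => y _.
by apply: eq_bigr => i _; rewrite addnC.
Qed.

Let fm1_le b : `|fm 1 b| <= c.
Proof.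
rewrite fm1 normrM ger0_norm; last by case/andP: c01.
rewrite ler_piMr//; last exact: normr_bool_sub_le1.
by case/andP: c01.
Qed.

Let fm2_le b : `|fm 2 b| <= v.
Proof. by have /andP[? ?] := fm2 b; rewrite ger0_norm. Qed.

Lemma column_mean11_share a b b' xs : uniq [:: a; b; b'] ->
  `|column_mean (pairn (a, b)) (pairn (a, b')) xs 1 1| <= v * c ^+ 2.
Proof.
move=> u; apply: normr_column_mean_le => y.
under eq_bigr do rewrite !muln1.
rewrite (@prod_pairn_share _ _ (fun x k k' => fm (k + k')%N (w (tnth xs x, y))))//=.
by rewrite !normrM ler_pM// expr2 ler_pM.
Qed.

Lemma column_mean11_equal a b xs : a != b ->
  `|column_mean (pairn (a, b)) (pairn (a, b)) xs 1 1| <= v ^+ 2.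
Proof.
move=> ab; apply: normr_column_mean_le => y.
under eq_bigr do rewrite !muln1.
rewrite (@prod_pairn_equal _ _ (fun x k k' => fm (k + k')%N (w (tnth xs x, y))))//=.
by rewrite !normrM expr2 ler_pM.
Qed.

End column_mean.

Section pair_of_cycles.
Variables (n m : nat).
Implicit Types (r : 'I_n -> nat) (k : 'I_m -> nat).
Implicit Types (a b : 'I_n) (u x : 'I_m) (xs : n.-tuple T).

Lemma cycle_pair_meanE r r' k k' : cycle_pair_mean r r' k k' =
  \int[iid_prob P n]_xs \prod_j column_mean r r' xs (k j) (k' j).
Proof. exact: (latent_mean_rows P mw (fun _ _ _ => fm_le1 _ _)). Qed.

Lemma L1_cycle_pair r r' k k' :
  L1 (iid_prob P n) (fun xs => \prod_j column_mean r r' xs (k j) (k' j)).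
Proof. exact: (L1_rows_mean P mw (phi := fun i j => fm (r i * k j + r' i * k' j)%N)). Qed.

Let measurable_corr_at a b :
  measurable_fun setT (fun xs : n.-tuple T => corr P s (tnth xs a, tnth xs b)).
Proof.
apply: (measurableT_comp (measurable_corr P ms s1)).
by apply: measurable_fun_pair; exact: measurable_tnth.
Qed.

Let L1_corr_at a b q :
  L1 (iid_prob P n) (fun xs => corr P s (tnth xs a, tnth xs b) ^+ q).
Proof.
apply: (L1_bounded _ (M := 1)) => [|xs]; first exact: measurable_funX.
by rewrite normrX exprn_ile1// normr_corr_le1.
Qed.

Let corr_at_moment a b q : a != b ->
  \int[iid_prob P n]_xs corr P s (tnth xs a, tnth xs b) ^+ q = corr_moment P s q.
Proof.
move=> ab.
rewrite (Rintegral_iid_pair P (f := fun z => corr P s z ^+ q) (M := 1) ab).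
- by rewrite /corr_moment Fubini12//; exact: L1_corr.
- by apply: measurable_funX; exact: measurable_corr.
- by move=> z; rewrite normrX exprn_ile1// normr_corr_le1.
Qed.

Lemma cycle_meanE a b u x : a != b -> u != x ->
  cycle_mean (pairn (a, b)) (pairn (u, x)) = c ^+ 4 * kappa.
Proof.
move=> ab ux.
have -> : cycle_mean (pairn (a, b)) (pairn (u, x)) =
    cycle_pair_mean (pairn (a, b)) (pairn (a, b)) (pairn (u, x)) (fun=> 0%N).
  rewrite /cycle_mean /cycle_pair_mean; congr latent_mean.
  by apply/funext => i; apply/funext => j; rewrite muln0 addn0.
rewrite cycle_pair_meanE /kappa -(corr_at_moment 2 ab).
rewrite -[RHS](RintegralZl _ _ (L1_corr_at a b 2))//.
apply: eq_Rintegral => xs _ /=.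
rewrite (@prod_pairn _ _ (fun _ j => column_mean (pairn (a, b)) (pairn (a, b)) xs j 0))//.
  by rewrite column_mean10//; ring.
by move=> _; rewrite column_mean00.
Qed.

Lemma prod_column_disjoint a b a' b' u x u' x' xs : a != b -> a' != b' ->
  uniq [:: u; x; u'; x'] ->
  \prod_(j < m) column_mean (pairn (a, b)) (pairn (a', b')) xs
    (pairn (u, x) j) (pairn (u', x') j) =
  c ^+ 8 * (corr P s (tnth xs a, tnth xs b) ^+ 2
            * corr P s (tnth xs a', tnth xs b') ^+ 2).
Proof.
move=> ab a'b' ux.
rewrite (@prod_pairn_disjoint _ _ (fun _ j j' => column_mean _ _ xs j j'))//.
  by rewrite column_mean10// column_mean01//; ring.
by move=> _; rewrite column_mean00.
Qed.

Lemma cycle_pair_mean_disjoint a b a' b' u x u' x' :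
  uniq [:: a; b; a'; b'] -> uniq [:: u; x; u'; x'] ->
  cycle_pair_mean (pairn (a, b)) (pairn (a', b')) (pairn (u, x)) (pairn (u', x')) =
  (c ^+ 4 * kappa) ^+ 2.
Proof.
move=> uab ux; have /and3P[/= + + _] := uab; rewrite !inE !negb_or.
have a'b' : a' != b' by move: uab; rewrite /= !inE => /and4P[].
move=> /andP[ab _] _.
rewrite cycle_pair_meanE.
under eq_Rintegral do rewrite (prod_column_disjoint _ ab a'b' ux).
pose f z := corr P s z ^+ 2.
have mf : measurable_fun setT f by apply: measurable_funX; exact: measurable_corr.
have f1 z : `|f z| <= 1 by rewrite normrX exprn_ile1// normr_corr_le1.
rewrite RintegralZl//; last first.
  apply: (L1_bounded _ (M := 1)) => [|xs]; last exact: normrM_le1 (f1 _) (f1 _).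
  by apply: measurable_funM; exact: measurable_funX.
rewrite (Rintegral_iid_pairs P uab mf mf f1 f1).
rewrite -[\int[P]_x _](Fubini12 (L1_corr P ms s1 2)).
by rewrite -/(corr_moment P s 2) -/kappa; ring.
Qed.

(** Disjoint columns give [c^8 h(a,b)^2 h(a',b')^2]. By the inequality
    [2 x^2 y^2 <= x^4 + y^4] only the laws of the two pairs of rows matter,
    however they overlap. *)
Lemma cycle_pair_mean_disjoint_le a b a' b' u x u' x' :
  a != b -> a' != b' -> uniq [:: u; x; u'; x'] ->
  cycle_pair_mean (pairn (a, b)) (pairn (a', b')) (pairn (u, x)) (pairn (u', x'))
  <= c ^+ 8 * H.
Proof.
move=> ab a'b' ux; rewrite cycle_pair_meanE.
pose h a b xs := corr P s (tnth xs a, tnth xs b).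
have -> : c ^+ 8 * H = \int[iid_prob P n]_xs (c ^+ 8 / 2 * (h a b xs ^+ 4 + h a' b' xs ^+ 4)).
  rewrite RintegralZl//; last by apply: L1D; exact: L1_corr_at.
  rewrite RintegralD//; [|exact: L1_corr_at..].
  by rewrite !corr_at_moment// -/H; field.
apply: le_RintegralT; first exact: L1_cycle_pair.
  by apply: L1Z; apply: L1D; exact: L1_corr_at.
move=> xs; rewrite prod_column_disjoint// -mulrA ler_wpM2l//.
  by rewrite exprn_ge0//; case/andP: c01.
rewrite -/(h a b xs) -/(h a' b' xs).
have : 0 <= (h a b xs ^+ 2 - h a' b' xs ^+ 2) ^+ 2 by exact: sqr_ge0.
by lra.
Qed.

(** The two columns that are not shared give [c^2 h(a,b)] and [c^2 h(a',b')],
    and [2 |h h'| <= h^2 + h'^2]; the shared column is bounded by [B] uniformly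
    in the rows. *)
Lemma cycle_pair_mean_share_le a b a' b' u x x' B :
  a != b -> a' != b' -> uniq [:: u; x; x'] ->
  (forall xs, `|column_mean (pairn (a, b)) (pairn (a', b')) xs 1 1| <= B) ->
  cycle_pair_mean (pairn (a, b)) (pairn (a', b')) (pairn (u, x)) (pairn (u, x'))
  <= B * c ^+ 4 * kappa.
Proof.
move=> ab a'b' ux DB; rewrite cycle_pair_meanE.
pose h a b xs := corr P s (tnth xs a, tnth xs b).
have -> : B * c ^+ 4 * kappa =
    \int[iid_prob P n]_xs (B * c ^+ 4 / 2 * (h a b xs ^+ 2 + h a' b' xs ^+ 2)).
  rewrite RintegralZl//; last by apply: L1D; exact: L1_corr_at.
  rewrite RintegralD//; [|exact: L1_corr_at..].
  by rewrite !corr_at_moment// -/kappa; field.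
apply: le_RintegralT; first exact: L1_cycle_pair.
  by apply: L1Z; apply: L1D; exact: L1_corr_at.
move=> xs; rewrite (@prod_pairn_share _ _ (fun _ j j' => column_mean _ _ xs j j'))//; last first.
  by move=> _; rewrite column_mean00.
rewrite column_mean10// column_mean01// -/(h a b xs) -/(h a' b' xs).
set D := column_mean _ _ _ _ _; apply: le_trans (ler_norm _) _.
rewrite normrM; apply: (le_trans (ler_wpM2r (normr_ge0 _) (DB xs))).
have B0 : 0 <= B by apply: le_trans (DB xs).
rewrite mulrACA -exprD normrM -[B * _ / 2]mulrA -[B * _ * _]mulrA ler_wpM2l// -[leRHS]mulrA.
rewrite (ger0_norm (exprn_ge0 _ _)); last by case/andP: c01.
rewrite ler_wpM2l//; first by rewrite exprn_ge0//; case/andP: c01.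
rewrite ler_norml; apply/andP; split.
  have : 0 <= (h a b xs + h a' b' xs) ^+ 2 by exact: sqr_ge0.
  by lra.
have : 0 <= (h a b xs - h a' b' xs) ^+ 2 by exact: sqr_ge0.
by lra.
Qed.

Lemma cycle_pair_mean_equal_le a b a' b' u x B :
  u != x ->
  (forall xs, `|column_mean (pairn (a, b)) (pairn (a', b')) xs 1 1| <= B) ->
  cycle_pair_mean (pairn (a, b)) (pairn (a', b')) (pairn (u, x)) (pairn (u, x))
  <= B ^+ 2.
Proof.
move=> ux DB; rewrite cycle_pair_meanE -[leRHS](Rintegral_cstT (iid_prob P n)).
apply: le_RintegralT; [exact: L1_cycle_pair|exact: L1_cst|].
move=> xs; rewrite (@prod_pairn_equal _ _ (fun _ j j' => column_mean _ _ xs j j'))//; last first.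
  by move=> _; rewrite column_mean00.
by rewrite (le_trans (ler_norm _))// normrM expr2 ler_pM.
Qed.

End pair_of_cycles.

Lemma cycle_pair_mean_transpose n m (r r' : 'I_n -> nat) (k k' : 'I_m -> nat) :
  (forall x y, w (x, y) = w (y, x)) ->
  cycle_pair_mean r r' k k' = cycle_pair_mean k k' r r'.
Proof.
move=> wC; rewrite /cycle_pair_mean (latent_mean_transpose P mw wC)//.
congr latent_mean; apply/funext => j; apply/funext => i.
by rewrite ![(k j * _)%N]mulnC ![(k' j * _)%N]mulnC.
Qed.

End cycle_moments.

(** * Variance of the signed cycle count *)

Section pair_overlap.
Variable n : nat.
Implicit Types e z : 'I_n * 'I_n.

Definition ordered e : bool := (e.1 < e.2)%N.

Definition meet_count e e' : nat :=
  (e.1 == e'.1) + (e.1 == e'.2) + (e.2 == e'.1) + (e.2 == e'.2).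

Lemma ordered_neq e : ordered e -> e.1 != e.2.
Proof. by rewrite /ordered; apply: contraTneq => ->; rewrite ltnn. Qed.

(** In the second case the pairs are reordered, which [pairn] does not see, so
    that the common vertex comes first in both. *)
Variant pair_overlap_spec e e' : Prop :=
| PairsDisjoint of uniq [:: e.1; e.2; e'.1; e'.2]
| PairsShare u x x' of uniq [:: u; x; x'] & pairn e = pairn (u, x)
    & pairn e' = pairn (u, x') & (0 < meet_count e e')%N
| PairsEqual of e = e'.

Lemma pair_overlapP e e' : ordered e -> ordered e' -> pair_overlap_spec e e'.
Proof.
case: e e' => [a b] [a' b']; rewrite /ordered/= => ab a'b'.
case: (eqVneq a a') => [eaa'|]; case: (eqVneq b b') => [ebb'|].
- by apply: PairsEqual; rewrite eaa' ebb'.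
- move=> bb'; apply: (@PairsShare _ _ a b b') => //; rewrite ?eaa'//.
    by move: bb' a'b' ab; rewrite eaa' /= !inE -!val_eqE/=; lia.
  by rewrite /meet_count/= eqxx.
- move=> aa'; apply: (@PairsShare _ _ b a a'); rewrite ?ebb' 1?pairnC//.
    by move: aa' a'b' ab; rewrite ebb' /= !inE -!val_eqE/=; lia.
  by rewrite /meet_count/= eqxx addn1.
- move=> bb' aa'; case: (eqVneq a b') => [eab'|ab'].
    apply: (@PairsShare _ _ a b a'); rewrite ?eab' 1?pairnC//.
    + by move: aa' bb' a'b' ab; rewrite eab' /= !inE -!val_eqE/=; lia.
    + by rewrite /meet_count/= eqxx; lia.
  case: (eqVneq b a') => [eba'|ba'].
    apply: (@PairsShare _ _ b a b'); rewrite ?eba' 1?pairnC//.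
    + by move: aa' bb' ab' a'b' ab; rewrite eba' /= !inE -!val_eqE/=; lia.
    + by rewrite /meet_count/= eqxx; lia.
  apply: PairsDisjoint.
  by move: aa' bb' ab' ba' a'b' ab; rewrite /= !inE -!val_eqE/=; lia.
Qed.

Lemma sum_delta (a : 'I_n) : (\sum_(x : 'I_n) (a == x) = 1)%N.
Proof.
by rewrite (bigD1 a)//= eqxx big1// => x /negbTE; rewrite eq_sym => ->.
Qed.

Lemma sum_cst_ord k : (\sum_(x : 'I_n) k = n * k)%N.
Proof. by rewrite sum_nat_const card_ord. Qed.

Lemma sum_pairE (F : 'I_n * 'I_n -> nat) :
  (\sum_e F e = \sum_(a < n) \sum_(b < n) F (a, b))%N.
Proof. by rewrite pair_bigA; apply: eq_bigr => -[]. Qed.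

Lemma sum_pair_pairs (F : 'I_n * 'I_n -> 'I_n * 'I_n -> nat) :
  (\sum_e \sum_e' F e e' =
   \sum_(a < n) \sum_(b < n) \sum_(a' < n) \sum_(b' < n) F (a, b) (a', b'))%N.
Proof.
by rewrite sum_pairE; apply: eq_bigr => a _; apply: eq_bigr => b _; exact: sum_pairE.
Qed.

Lemma sum_meet_count : (\sum_e \sum_e' meet_count e e' = 4 * n ^ 3)%N.
Proof.
have S1 (a : 'I_n) : (\sum_(x : 'I_n) (a == x) = 1)%N by exact: sum_delta.
rewrite sum_pair_pairs /meet_count/=.
transitivity (\sum_(a < n) \sum_(b < n) (4 * n))%N; last first.
  by rewrite !sum_cst_ord; lia.
apply: eq_bigr => a _; apply: eq_bigr => b _.
transitivity (\sum_(a' < n) (n * (a == a') + 1 + n * (b == a') + 1))%N.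
  by apply: eq_bigr => a' _; rewrite !big_split/= !sum_cst_ord !S1.
by rewrite !big_split/= -!big_distrr/= !S1 !sum_cst_ord; lia.
Qed.

Lemma sum_eq_pairs : (\sum_(e : 'I_n * 'I_n) \sum_(e' : 'I_n * 'I_n) (e == e') = n ^ 2)%N.
Proof.
transitivity (\sum_(e : 'I_n * 'I_n) 1)%N.
  apply: eq_bigr => e _.
  by rewrite (bigD1 e)//= eqxx big1// => x /negbTE; rewrite eq_sym => ->.
by rewrite sum1_card card_prod !card_ord.
Qed.

Lemma sum_ordered_le (F : 'I_n * 'I_n -> 'I_n * 'I_n -> nat) :
  (\sum_(e | ordered e) \sum_(e' | ordered e') F e e' <= \sum_e \sum_e' F e e')%N.
Proof.
rewrite big_mkcond; apply: leq_sum => e _; case: ifP => // _.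
by rewrite big_mkcond; apply: leq_sum => e' _; case: ifP.
Qed.

Lemma card_ordered : (2 * (\sum_(e : 'I_n * 'I_n) ordered e) + n = n ^ 2)%N.
Proof.
have sumC : (\sum_(e : 'I_n * 'I_n) ordered e = \sum_(a < n) \sum_(b < n) (b < a))%N.
  by rewrite sum_pairE exchange_big.
have sumE : (\sum_(e : 'I_n * 'I_n) ordered e = \sum_(a < n) \sum_(b < n) (a < b))%N.
  exact: sum_pairE.
have diag : (\sum_(a < n) \sum_(b < n) (a == b) = n)%N.
  by rewrite (eq_bigr (fun=> 1%N)) ?sum_cst_ord ?muln1// => a _; exact: sum_delta.
have : (\sum_(a < n) \sum_(b < n) ((b < a) + (a < b) + (a == b)) = n ^ 2)%N.
  rewrite (eq_bigr (fun=> n)) ?sum_cst_ord ?mulnn// => a _.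
  rewrite (eq_bigr (fun=> 1%N)) ?sum_cst_ord ?muln1// => b _.
  by rewrite -val_eqE/=; case: ltngtP.
under eq_bigr do rewrite !big_split/=.
by rewrite !big_split/= diag -sumC -sumE; move: (\sum_e _)%N => N <-; rewrite mul2n addnn.
Qed.

End pair_overlap.

Section variance.
Context d (T : measurableType d) (R : realType) (P : probability T R).
Variables (w : T * T -> bool) (p : R).
Hypothesis mw : measurable_fun setT (fun z => (w z)%:R : R).
Hypothesis wC : forall x y, w (x, y) = w (y, x).
Hypothesis hp : 0 < p < 1.
Variables (fm : nat -> bool -> R) (c v : R).
Hypotheses (fm0 : forall b, fm 0 b = 1) (fm1 : forall b, fm 1 b = c * (b%:R - p)).
Hypotheses (fm2 : forall b, 0 <= fm 2 b <= v) (fm_le1 : forall j b, `|fm j b| <= 1).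
Hypothesis c01 : 0 <= c <= 1.

Let s z : R := (w z)%:R - p.
Let kappa := corr_moment P s 2.
Let H := corr_moment P s 4.

Let kappa_ge0 : 0 <= kappa.
Proof. by apply: Rintegral_ge0 => z _; exact: sqr_ge0. Qed.

Let H_ge0 : 0 <= H.
Proof. by apply: Rintegral_ge0 => z _; rewrite exprn_even_ge0. Qed.

Let pair_mean n m (e e' : 'I_n * 'I_n) (f f' : 'I_m * 'I_m) :=
  cycle_pair_mean P w fm (pairn e) (pairn e') (pairn f) (pairn f').

Let v_ge0 : 0 <= v.
Proof. by have /andP[+ +] := fm2 true; exact: le_trans. Qed.

(** One summand for each way in which two distinct or equal cycles can overlap.
    Every summand is a product of a function of the rows and a function of the
    columns, so that the sum over all pairs of cycles factors. *)
Definition cycle_cov_bound n m (e e' : 'I_n * 'I_n) (f f' : 'I_m * 'I_m) : R :=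
  (meet_count e e')%:R * (c ^+ 8 * H) + (meet_count f f')%:R * (c ^+ 8 * H)
  + (meet_count e e')%:R * (meet_count f f')%:R * (c ^+ 6 * v * kappa)
  + (e == e')%:R * (meet_count f f')%:R * (c ^+ 4 * v ^+ 2 * kappa)
  + (meet_count e e')%:R * (f == f')%:R * (c ^+ 4 * v ^+ 2 * kappa)
  + (e == e')%:R * (f == f')%:R * v ^+ 4.

(** Integrating over the columns at fixed rows settles the cases in which the
    columns overlap at most as much as the rows; the other ones follow by
    exchanging rows and columns. *)
Lemma cycle_cov_le n m (e e' : 'I_n * 'I_n) (f f' : 'I_m * 'I_m) :
  ordered e -> ordered e' -> ordered f -> ordered f' ->
  pair_mean e e' f f' - (c ^+ 4 * kappa) ^+ 2 <= cycle_cov_bound e e' f f'.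
Proof.
move=> oe oe' of_ of'.
have c0 : 0 <= c by case/andP: c01.
have c4 : 0 <= c ^+ 4 by exact: exprn_ge0.
have c6 : 0 <= c ^+ 6 by exact: exprn_ge0.
have c8 : 0 <= c ^+ 8 by exact: exprn_ge0.
have v2 : 0 <= v ^+ 2 by exact: exprn_ge0.
have v4 : 0 <= v ^+ 4 by exact: exprn_ge0.
have t1 : 0 <= (meet_count e e')%:R * (c ^+ 8 * H) by rewrite !mulr_ge0.
have t2 : 0 <= (meet_count f f')%:R * (c ^+ 8 * H) by rewrite !mulr_ge0.
have t3 : 0 <= (meet_count e e')%:R * (meet_count f f')%:R * (c ^+ 6 * v * kappa).
  by rewrite !mulr_ge0.
have t4 : 0 <= (e == e')%:R * (meet_count f f')%:R * (c ^+ 4 * v ^+ 2 * kappa).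
  by rewrite !mulr_ge0.
have t5 : 0 <= (meet_count e e')%:R * (f == f')%:R * (c ^+ 4 * v ^+ 2 * kappa).
  by rewrite !mulr_ge0.
have t6 : 0 <= (e == e')%:R * (f == f')%:R * v ^+ 4 by rewrite !mulr_ge0.
have mu2 : 0 <= (c ^+ 4 * kappa) ^+ 2 by exact: sqr_ge0.
rewrite /cycle_cov_bound.
have grow (k l : nat) (x : R) : (0 < k)%N -> (0 < l)%N -> 0 <= x -> x <= k%:R * l%:R * x.
  by move=> k0 l0 x0; rewrite -natrM ler_peMl// ler1n muln_gt0 k0.
have grow1 (k : nat) (x : R) : (0 < k)%N -> 0 <= x -> x <= k%:R * x.
  by move=> k0 x0; rewrite ler_peMl// ler1n.
have ne := ordered_neq oe; have ne' := ordered_neq oe'.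
have nf := ordered_neq of_; have nf' := ordered_neq of'.
case: (pair_overlapP oe oe') => [De|a b b' ua pe pe' Ue|Ee].
- case: (pair_overlapP of_ of') => [Df|u x x' uf pf pf' Uf|Ef].
  + have := cycle_pair_mean_disjoint P mw hp fm0 fm1 fm_le1 De Df.
    rewrite -!surjective_pairing => E.
    rewrite /pair_mean E subrr; lra.
  + have := cycle_pair_mean_disjoint_le P mw hp fm0 fm1 fm_le1 c01 nf nf' De.
    rewrite -!surjective_pairing -cycle_pair_mean_transpose// -/(pair_mean e e' f f') -/H => E.
    have := grow1 _ (c ^+ 8 * H) Uf (mulr_ge0 c8 H_ge0).
    lra.
  + have := cycle_pair_mean_disjoint_le P mw hp fm0 fm1 fm_le1 c01 nf nf' De.
    rewrite -!surjective_pairing -cycle_pair_mean_transpose// -/(pair_mean e e' f f') -/H => E.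
    have Uf : (0 < meet_count f f')%N by rewrite Ef /meet_count eqxx.
    have := grow1 _ (c ^+ 8 * H) Uf (mulr_ge0 c8 H_ge0).
    lra.
- have ab : a != b by move: ua; rewrite /= !inE negb_or -andbA => /and3P[].
  have ab' : a != b' by move: ua; rewrite /= !inE negb_or -andbA => /and3P[].
  case: (pair_overlapP of_ of') => [Df|u x x' uf pf pf' Uf|Ef].
  + have := cycle_pair_mean_disjoint_le P mw hp fm0 fm1 fm_le1 c01 ne ne' Df.
    rewrite -!surjective_pairing -/(pair_mean e e' f f') -/H => E.
    have := grow1 _ (c ^+ 8 * H) Ue (mulr_ge0 c8 H_ge0).
    lra.
  + have := cycle_pair_mean_share_le mw hp fm0 fm1 fm_le1 c01 ab ab' uf
      (fun xs => column_mean11_share P mw hp fm0 fm1 fm2 c01 xs ua).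
    rewrite -pe -pe' -pf -pf' -/(pair_mean e e' f f') -/kappa => E.
    have : v * c ^+ 2 * c ^+ 4 * kappa = c ^+ 6 * v * kappa by ring.
    have := grow _ _ (c ^+ 6 * v * kappa) Ue Uf (mulr_ge0 (mulr_ge0 c6 v_ge0) kappa_ge0).
    lra.
  + have := cycle_pair_mean_share_le mw hp fm0 fm1 fm_le1 c01 nf nf ua
      (fun xs => column_mean11_equal P mw fm0 fm2 xs nf).
    rewrite -pe -pe' -!surjective_pairing -cycle_pair_mean_transpose// -/kappa.
    subst f'; rewrite -/(pair_mean e e' f f) => E.
    have : v ^+ 2 * c ^+ 4 * kappa = c ^+ 4 * v ^+ 2 * kappa by ring.
    have := grow1 _ (c ^+ 4 * v ^+ 2 * kappa) Ue (mulr_ge0 (mulr_ge0 c4 v2) kappa_ge0).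
    move: t1 t2 t3 t4 t6; rewrite eqxx/= ?mulr1 ?mul1r; lra.
- case: (pair_overlapP of_ of') => [Df|u x x' uf pf pf' Uf|Ef].
  + have := cycle_pair_mean_disjoint_le P mw hp fm0 fm1 fm_le1 c01 ne ne' Df.
    rewrite -!surjective_pairing -/(pair_mean e e' f f') -/H => E.
    have Ue : (0 < meet_count e e')%N by rewrite Ee /meet_count eqxx.
    have := grow1 _ (c ^+ 8 * H) Ue (mulr_ge0 c8 H_ge0).
    lra.
  + have := cycle_pair_mean_share_le mw hp fm0 fm1 fm_le1 c01 ne ne uf
      (fun xs => column_mean11_equal P mw fm0 fm2 xs ne).
    rewrite -pf -pf' -!surjective_pairing -/kappa.
    subst e'; rewrite -/(pair_mean e e f f') => E.
    have : v ^+ 2 * c ^+ 4 * kappa = c ^+ 4 * v ^+ 2 * kappa by ring.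
    have := grow1 _ (c ^+ 4 * v ^+ 2 * kappa) Uf (mulr_ge0 (mulr_ge0 c4 v2) kappa_ge0).
    move: t1 t2 t3 t5 t6; rewrite eqxx/= ?mulr1 ?mul1r; lra.
  + have := cycle_pair_mean_equal_le mw fm0 fm_le1 nf
      (fun xs => column_mean11_equal P mw fm0 fm2 xs ne).
    subst e' f'; rewrite -!surjective_pairing -/(pair_mean e e f f) => E.
    have : (v ^+ 2) ^+ 2 = v ^+ 4 by ring.
    move: t1 t2 t3 t4 t5; rewrite !eqxx/= ?mulr1 ?mul1r; lra.
Qed.

Lemma sum_prodr n m (g : 'I_n * 'I_n -> 'I_n * 'I_n -> R)
    (h : 'I_m * 'I_m -> 'I_m * 'I_m -> R) (x : R) :
  \sum_(e | ordered e) \sum_(e' | ordered e') \sum_(f | ordered f) \sum_(f' | ordered f')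
    g e e' * h f f' * x =
  (\sum_(e | ordered e) \sum_(e' | ordered e') g e e')
  * (\sum_(f | ordered f) \sum_(f' | ordered f') h f f') * x.
Proof.
rewrite !mulr_suml; apply: eq_bigr => e _; rewrite !mulr_suml; apply: eq_bigr => e' _.
rewrite mulr_sumr mulr_suml; apply: eq_bigr => f _.
by rewrite mulr_sumr mulr_suml.
Qed.

Lemma sum_cycle_cov_le n m :
  \sum_(e | ordered e) \sum_(e' | ordered e') \sum_(f | ordered f) \sum_(f' | ordered f')
    (@pair_mean n m e e' f f' - (c ^+ 4 * kappa) ^+ 2) <=
  4 * n%:R ^+ 3 * m%:R ^+ 4 * (c ^+ 8 * H) + 4 * n%:R ^+ 4 * m%:R ^+ 3 * (c ^+ 8 * H)
  + 16 * n%:R ^+ 3 * m%:R ^+ 3 * (c ^+ 6 * v * kappa)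
  + 4 * n%:R ^+ 2 * m%:R ^+ 3 * (c ^+ 4 * v ^+ 2 * kappa)
  + 4 * n%:R ^+ 3 * m%:R ^+ 2 * (c ^+ 4 * v ^+ 2 * kappa)
  + n%:R ^+ 2 * m%:R ^+ 2 * v ^+ 4.
Proof.
have c0 : 0 <= c by case/andP: c01.
have S k (F : 'I_k * 'I_k -> 'I_k * 'I_k -> nat) M :
    (\sum_e \sum_e' F e e' = M)%N ->
    0 <= \sum_(e | ordered e) \sum_(e' | ordered e') (F e e')%:R :> R
    /\ \sum_(e | ordered e) \sum_(e' | ordered e') (F e e')%:R <= M%:R :> R.
  move=> FM; split; first by do 2 apply: sumr_ge0 => ? _.
  rewrite -FM; apply: le_trans (_ : (\sum_(e | ordered e) \sum_(e' | ordered e') F e e')%N%:R <= _).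
    by rewrite natr_sum ler_sum// => e _; rewrite natr_sum.
  by rewrite ler_nat sum_ordered_le.
have SU k := S k (@meet_count k) _ (sum_meet_count k).
have SE k := S k (fun e e' => nat_of_bool (e == e')) _ (sum_eq_pairs k).
have S1 k : 0 <= \sum_(e : 'I_k * 'I_k | ordered e) \sum_(e' : 'I_k * 'I_k | ordered e') (1%N)%:R :> R
    /\ \sum_(e : 'I_k * 'I_k | ordered e) \sum_(e' : 'I_k * 'I_k | ordered e') (1%N)%:R <= (k ^ 4)%:R :> R.
  have := S k (fun _ _ => 1%N) (k ^ 4)%N; apply.
  by rewrite sum_pair_pairs !sum_cst_ord; lia.
apply: le_trans (_ : \sum_(e | ordered e) \sum_(e' | ordered e') \sum_(f | ordered f)
    \sum_(f' | ordered f') @cycle_cov_bound n m e e' f f' <= _).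
  by do 4 (apply: ler_sum => ? ?); exact: cycle_cov_le.
have -> : \sum_(e : 'I_n * 'I_n | ordered e) \sum_(e' : 'I_n * 'I_n | ordered e') \sum_(f : 'I_m * 'I_m | ordered f)
    \sum_(f' : 'I_m * 'I_m | ordered f') @cycle_cov_bound n m e e' f f' =
  \sum_(e : 'I_n * 'I_n | ordered e) \sum_(e' : 'I_n * 'I_n | ordered e') \sum_(f : 'I_m * 'I_m | ordered f) \sum_(f' : 'I_m * 'I_m | ordered f')
    ((meet_count e e')%:R * (1%N)%:R * (c ^+ 8 * H)
     + (1%N)%:R * (meet_count f f')%:R * (c ^+ 8 * H)
     + (meet_count e e')%:R * (meet_count f f')%:R * (c ^+ 6 * v * kappa)
     + (e == e')%:R * (meet_count f f')%:R * (c ^+ 4 * v ^+ 2 * kappa)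
     + (meet_count e e')%:R * (f == f')%:R * (c ^+ 4 * v ^+ 2 * kappa)
     + (e == e')%:R * (f == f')%:R * v ^+ 4).
  do 4 (apply: eq_bigr => ? _).
  by rewrite /cycle_cov_bound mulr1 mul1r.
under eq_bigr => e _ do under eq_bigr => e' _ do under eq_bigr => f _ do rewrite !big_split/=.
under eq_bigr => e _ do under eq_bigr => e' _ do rewrite !big_split/=.
under eq_bigr => e _ do rewrite !big_split/=.
rewrite !big_split/= !sum_prodr.
have b (x y z x' y' : R) : 0 <= x /\ x <= x' -> 0 <= y /\ y <= y' -> 0 <= z ->
    x * y * z <= x' * y' * z.
  by move=> [x0 xx'] [y0 yy'] z0; rewrite ler_wpM2r// ler_pM.
do ?apply: lerD.
- rewrite -[_ * n%:R ^+ 3 * _]/(4 * n%:R ^+ 3 * m%:R ^+ 4) -!natrX -!natrM.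
  by rewrite natrM b// mulr_ge0// exprn_ge0.
- rewrite [4 * _]mulrC -[n%:R ^+ 4 * 4 * _]mulrA -!natrX -!natrM.
  by rewrite natrM b// mulr_ge0// exprn_ge0.
- rewrite (_ : 16 * n%:R ^+ 3 * m%:R ^+ 3 = (4 * n ^ 3)%:R * (4 * m ^ 3)%:R); last first.
    by rewrite ?(natrM _ 4 (n ^ 3)) ?(natrM _ 4 (m ^ 3)) !natrX; ring.
  by rewrite b// !mulr_ge0// exprn_ge0.
- rewrite (_ : 4 * n%:R ^+ 2 * m%:R ^+ 3 = (n ^ 2)%:R * (4 * m ^ 3)%:R); last first.
    by rewrite ?(natrM _ 4 (n ^ 3)) ?(natrM _ 4 (m ^ 3)) !natrX; ring.
  by rewrite b// !mulr_ge0// exprn_ge0.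
- rewrite (_ : 4 * n%:R ^+ 3 * m%:R ^+ 2 = (4 * n ^ 3)%:R * (m ^ 2)%:R); last first.
    by rewrite ?(natrM _ 4 (n ^ 3)) ?(natrM _ 4 (m ^ 3)) !natrX; ring.
  by rewrite b// !mulr_ge0// exprn_ge0.
- by rewrite -!natrX b// exprn_ge0.
Qed.

End variance.

(** * Laws on matrices as a finite sample space *)

Section finite_laws.
Variable R : realType.
Notation gvec d := (d.-tuple (measurableTypeR R)).

Lemma sum_matrix_prod n m (F : 'I_n -> 'I_m -> bool -> R) :
  \sum_(A : 'M[bool]_(n, m)) \prod_i \prod_k F i k (A i k) =
  \prod_i \prod_k \sum_b F i k b.
Proof.
rewrite pair_bigA bigA_distr_bigA/=.
rewrite (reindex (fun f : {ffun 'I_n * 'I_m -> bool} => \matrix_(i, k) f (i, k)))/=.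
  apply: eq_bigr => f _; rewrite pair_bigA; apply: eq_bigr => -[i k] _.
  by rewrite mxE.
exists (fun A : 'M[bool]_(n, m) => [ffun z => A z.1 z.2]) => [f _|A _].
  by apply/ffunP => -[i k]; rewrite ffunE mxE.
by apply/matrixP => i k; rewrite mxE ffunE.
Qed.

Lemma bern_law_ge0 n m (p : R) (A : 'M[bool]_(n, m)) : 0 <= p <= 1 -> 0 <= bern_law p A.
Proof.
by move=> p01; do 2 (apply: prodr_ge0 => ? _); exact: bernoulli_pmf_ge0.
Qed.

Section geometric.
Variables (n m d : nat) (t : R).

Let P := (iid_prob (gauss_vec R d) n \x iid_prob (gauss_vec R d) m)%E.

Definition edge (z : gvec d * gvec d) : bool := scaled_dot z.1 z.2 <= t.

Lemma edgeC (x y : gvec d) : edge (x, y) = edge (y, x).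
Proof.
by rewrite /edge /scaled_dot; congr (_ * _ <= _); apply: eq_bigr => k _; rewrite mulrC.
Qed.

(** Writes equality of matrices as a product over entries, whose measurability
    in the latent vectors is already known. *)
Lemma matrix_eq_prod (A B : 'M[bool]_(n, m)) :
  (A == B)%:R = \prod_i \prod_k (A i k == B i k)%:R :> R.
Proof.
case: (boolP [exists i, exists k, A i k != B i k]) => [|noAB].
  move=> /existsP[i /existsP[k AB]].
  rewrite [RHS](bigD1 i)//= (bigD1 k)//= (negbTE AB) !mul0r.
  by case: (eqVneq A B) AB => // ->; rewrite eqxx.
have -> : A = B.
  apply/matrixP => i k; apply/eqP; apply: contraNT noAB => AB.
  by apply/existsP; exists i; apply/existsP; exists k.
by rewrite eqxx big1// => i _; rewrite big1// => k _; rewrite eqxx.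
Qed.

Lemma geom_mxE (z : n.-tuple (gvec d) * m.-tuple (gvec d)) (i : 'I_n) (k : 'I_m) :
  geom_mx t z i k = edge (tnth z.1 i, tnth z.2 k) :> bool.
Proof. by rewrite mxE. Qed.

Lemma measurable_geom_mx_eq (A : 'M[bool]_(n, m)) :
  measurable_fun setT (fun z : n.-tuple (gvec d) * m.-tuple (gvec d) =>
    (geom_mx t z == A)%:R : measurableTypeR R).
Proof.
have := @measurable_latent_integrand _ _ R edge (@measurable_edge R d t) n m
  (fun i k b => (b == A i k)%:R).
congr measurable_fun; apply/funext => z; rewrite matrix_eq_prod.
by do 2 (apply: eq_bigr => ? _); rewrite geom_mxE.
Qed.

Lemma L1_geom_mx_eq (A : 'M[bool]_(n, m)) : L1 P (fun z => (geom_mx t z == A)%:R).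
Proof.
apply: (L1_bounded _ (M := 1)) => [|z]; first exact: measurable_geom_mx_eq.
exact: normr_bool_le1.
Qed.

Lemma geom_lawE (A : 'M[bool]_(n, m)) :
  geom_law d t A = \int[P]_z (geom_mx t z == A)%:R.
Proof.
have mA : measurable [set z : n.-tuple (gvec d) * m.-tuple (gvec d) | geom_mx t z = A].
  have := @measurable_geom_mx_eq A measurableT [set 1] (measurable_set1 1).
  rewrite setTI; congr measurable; apply/seteqP; split => z /=.
    by case: eqP => // _ /eqP; rewrite eq_sym oner_eq0.
  by move=> ->; rewrite eqxx.
rewrite /geom_law -/P -(Rintegral_indic P mA); apply: eq_Rintegral => z _.
rewrite indicE; congr (_%:R); congr nat_of_bool.
by apply/idP/eqP => [/set_mem//|zA]; exact/mem_set.
Qed.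

Lemma sum_geom_law (F : 'M[bool]_(n, m) -> R) :
  \sum_A geom_law d t A * F A = \int[P]_z F (geom_mx t z).
Proof.
have -> : \int[P]_z F (geom_mx t z) = \int[P]_z \sum_A F A * (geom_mx t z == A)%:R.
  apply: eq_Rintegral => z _.
  rewrite (bigD1 (geom_mx t z))//= eqxx mulr1 big1 ?addr0// => A /negbTE.
  by rewrite eq_sym => ->; rewrite mulr0.
rewrite Rintegral_sum => [|A _]; last by apply: L1Z; exact: L1_geom_mx_eq.
apply: eq_bigr => A _; rewrite RintegralZl//; last exact: L1_geom_mx_eq.
by rewrite geom_lawE mulrC.
Qed.

Lemma geom_law_ge0 (A : 'M[bool]_(n, m)) : 0 <= geom_law d t A.
Proof. by rewrite geom_lawE; apply: Rintegral_ge0. Qed.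

End geometric.

Section sample_space.
Variables (n m d : nat) (t q p : R).
Hypotheses (q01 : 0 <= q <= 1) (p01 : 0 <= p <= 1).

(** A single product law on triples (mask, geometric matrix, noise) carries all
    the laws of the theorem, as images. *)
Definition sample := ('M[bool]_(n, m) * 'M[bool]_(n, m) * 'M[bool]_(n, m))%type.

Definition weight (z : sample) : R :=
  bern_law q z.1.1 * geom_law d t z.1.2 * bern_law p z.2.

Definition mean (X : sample -> R) : R := \sum_z weight z * X z.

Definition event_prob (E : pred sample) : R := \sum_(z | E z) weight z.

Lemma sum_sampleE (F : sample -> R) :
  \sum_z F z = \sum_M \sum_W \sum_B F (M, W, B).
Proof.
rewrite pair_bigA pair_bigA/=; apply: eq_bigr => -[[M W] B] _ //.
Qed.

(** The mask and the noise are averaged entry by entry, at fixed latent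
    vectors. *)
Lemma mean_prod (phi : 'I_n -> 'I_m -> bool -> bool -> bool -> R) :
  mean (fun z => \prod_i \prod_k phi i k (z.1.1 i k) (z.1.2 i k) (z.2 i k)) =
  latent_mean (gauss_vec R d) (edge t) (fun i k w =>
    \sum_x \sum_y bernoulli_pmf q x * bernoulli_pmf p y * phi i k x w y).
Proof.
rewrite /mean sum_sampleE exchange_big/= /latent_mean.
under eq_Rintegral do under eq_bigr do under eq_bigr do rewrite -geom_mxE.
rewrite -(sum_geom_law d t (fun W => \prod_i \prod_k
  \sum_x \sum_y bernoulli_pmf q x * bernoulli_pmf p y * phi i k x (W i k) y)).
apply: eq_bigr => W _.
rewrite -sum_matrix_prod mulr_sumr; apply: eq_bigr => M _.
rewrite -sum_matrix_prod mulr_sumr; apply: eq_bigr => B _.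
rewrite /weight/= /bern_law.
rewrite [_ * geom_law _ _ _]mulrC -!mulrA; congr (_ * _).
rewrite mulrA -!big_split/=; apply: eq_bigr => i _.
by rewrite -!big_split.
Qed.

Lemma weight_ge0 z : 0 <= weight z.
Proof. by rewrite !mulr_ge0// ?bern_law_ge0// geom_law_ge0. Qed.

Lemma sum_bern_law k l (r : R) : \sum_(A : 'M[bool]_(k, l)) bern_law r A = 1.
Proof.
rewrite /bern_law (sum_matrix_prod (fun _ _ => bernoulli_pmf r)).
by rewrite big1// => i _; rewrite big1// => j _; rewrite big_bool/= subrKC.
Qed.

Lemma sum_geom_law1 : \sum_(A : 'M[bool]_(n, m)) geom_law d t A = 1.
Proof.
have := sum_geom_law d t (fun _ : 'M[bool]_(n, m) => 1).
by rewrite Rintegral_cstT => <-; apply: eq_bigr => A _; rewrite mulr1.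
Qed.

Lemma mean_cst (x : R) : mean (fun=> x) = x.
Proof.
rewrite /mean -mulr_suml sum_sampleE /weight/=.
under eq_bigr => M _ do under eq_bigr => W _ do rewrite -mulr_sumr sum_bern_law mulr1.
under eq_bigr => M _ do rewrite -mulr_sumr sum_geom_law1 mulr1.
by rewrite sum_bern_law mul1r.
Qed.

Lemma mean_sum (I : Type) (r : seq I) (Q : pred I) (F : I -> sample -> R) :
  mean (fun z => \sum_(i <- r | Q i) F i z) = \sum_(i <- r | Q i) mean (F i).
Proof.
by rewrite /mean exchange_big/=; apply: eq_bigr => z _; rewrite mulr_sumr.
Qed.

Lemma eq_mean (X Y : sample -> R) : X =1 Y -> mean X = mean Y.
Proof. by move=> XY; apply: eq_bigr => z _; rewrite XY. Qed.

Lemma mean_covariance (X Y : sample -> R) (x : R) : mean X = x -> mean Y = x ->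
  mean (fun z => (X z - x) * (Y z - x)) = mean (fun z => X z * Y z) - x ^+ 2.
Proof.
move=> EX EY.
have -> : mean (fun z => (X z - x) * (Y z - x)) =
    mean (fun z => X z * Y z) - x * mean X - x * mean Y + mean (fun=> x ^+ 2).
  rewrite /mean !mulr_sumr -!sumrB -big_split/=; apply: eq_bigr => z _; ring.
by rewrite EX EY mean_cst; ring.
Qed.

Lemma markov_sqr (E : pred sample) (X : sample -> R) (r : R) : 0 < r ->
  (forall z, E z -> r ^+ 2 <= X z ^+ 2) ->
  event_prob E <= mean (fun z => X z ^+ 2) / r ^+ 2.
Proof.
move=> r0 EX; rewrite ler_pdivlMr ?exprn_gt0// /event_prob mulr_suml big_mkcond.
apply: ler_sum => z _; case: ifPn => [Ez|_].
  by rewrite ler_wpM2l ?weight_ge0// EX.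
by rewrite mulr_ge0 ?weight_ge0// sqr_ge0.
Qed.

Lemma Pr_mask_bern (E : 'M[bool]_(n, m) -> pred 'M[bool]_(n, m)) :
  Pr_mask q (fun=> bern_law p) E = event_prob (fun z => E z.1.1 z.2).
Proof.
rewrite /event_prob big_mkcond sum_sampleE; apply: eq_bigr => M _.
rewrite exchange_big/= /Pr mulr_sumr big_mkcond; apply: eq_bigr => B _.
case: ifP => _; last by rewrite big1.
rewrite /weight/= -mulr_suml -mulr_sumr sum_geom_law1; ring.
Qed.

Lemma Pr_mask_masked (E : 'M[bool]_(n, m) -> pred 'M[bool]_(n, m)) :
  Pr_mask q (fun M => masked_law p d t M) E =
  event_prob (fun z => E z.1.1 (mask_mx z.1.1 z.1.2 z.2)).
Proof.
rewrite /event_prob big_mkcond sum_sampleE; apply: eq_bigr => M _.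
rewrite /Pr /masked_law exchange_big/= mulr_sumr; apply: eq_bigr => W _.
under eq_bigr do rewrite big_mkcond.
rewrite exchange_big/= mulr_sumr; apply: eq_bigr => B _.
rewrite -big_mkcondr/=.
case: ifP => EM; last first.
  by rewrite big_pred0 ?mulr0// => A; case: eqP => [<-|]; rewrite ?EM ?andbF.
rewrite (big_pred1 (mask_mx M W B)); first by rewrite /weight/= mulrA.
by move=> A; rewrite /= [RHS]eq_sym; case: eqP => [<-|]; rewrite ?EM ?andbF.
Qed.

End sample_space.
End finite_laws.

(** * Error of the threshold test *)

(** In this part [a x w y] is the contribution to the statistic of an entry with
    mask [x], geometric edge [w] and noise [y]. *)
Section cycle_count.
Variables (R : realType) (n m d : nat) (t q p : R).
Hypotheses (q01 : 0 <= q <= 1) (hp : 0 < p < 1).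
Variables (a : bool -> bool -> bool -> R) (c v : R).
Hypothesis a_le1 : forall x w y, `|a x w y| <= 1.
Hypothesis c01 : 0 <= c <= 1.

Let p01 : 0 <= p <= 1.
Proof. by case/andP: hp => /ltW-> /ltW->. Qed.

Definition entry_moment j w : R :=
  \sum_x \sum_y bernoulli_pmf q x * bernoulli_pmf p y * a x w y ^+ j.

Hypothesis entry_mean : forall w, entry_moment 1 w = c * (w%:R - p).
Hypothesis entry_var : forall w, entry_moment 2 w <= v.

Let kappa := corr_moment (gauss_vec R d) (edge_dev p t) 2.
Let H := corr_moment (gauss_vec R d) (edge_dev p t) 4.
Let mean := @mean R n m d t q p.

Let pmf_ge0 x y : 0 <= bernoulli_pmf q x * bernoulli_pmf p y.
Proof. by rewrite mulr_ge0// bernoulli_pmf_ge0. Qed.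

Let pmf_total : \sum_x \sum_y bernoulli_pmf q x * bernoulli_pmf p y = 1.
Proof. by rewrite !big_bool/= /bernoulli_pmf; ring. Qed.

Lemma entry_moment0 w : entry_moment 0 w = 1.
Proof.
rewrite -pmf_total; apply: eq_bigr => x _; apply: eq_bigr => y _.
by rewrite mulr1.
Qed.

Lemma normr_entry_moment_le1 j w : `|entry_moment j w| <= 1.
Proof.
rewrite -pmf_total; apply: le_trans (ler_norm_sum _ _ _) _; apply: ler_sum => x _.
apply: le_trans (ler_norm_sum _ _ _) _; apply: ler_sum => y _.
by rewrite normrM ger0_norm// ler_piMr// normrX exprn_ile1.
Qed.

Let entry_var01 w : 0 <= entry_moment 2 w <= v.
Proof.
rewrite entry_var andbT; do 2 (apply: sumr_ge0 => ? _).
by rewrite mulr_ge0 ?sqr_ge0.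
Qed.

Definition cycle_dev (e : 'I_n * 'I_n) (f : 'I_m * 'I_m) (z : sample n m) : R :=
  \prod_i \prod_k a (z.1.1 i k) (z.1.2 i k) (z.2 i k) ^+ (pairn e i * pairn f k).

Definition cycle_count (z : sample n m) : R :=
  \sum_(e | ordered e) \sum_(f | ordered f) cycle_dev e f z.

Lemma mean_cycle_dev e f : ordered e -> ordered f ->
  mean (cycle_dev e f) = c ^+ 4 * kappa.
Proof.
move=> oe of_; rewrite /mean /cycle_dev.
rewrite (mean_prod d t q p (fun i k x w y => a x w y ^+ (pairn e i * pairn f k))).
have := cycle_meanE (gauss_vec R d) (@measurable_edge R d t) hp
  entry_moment0 entry_mean normr_entry_moment_le1 (ordered_neq oe) (ordered_neq of_).
by rewrite -!surjective_pairing.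
Qed.

Lemma mean_cycle_dev_pair e e' f f' :
  mean (fun z => cycle_dev e f z * cycle_dev e' f' z) =
  cycle_pair_mean (gauss_vec R d) (edge t) entry_moment
    (pairn e) (pairn e') (pairn f) (pairn f').
Proof.
transitivity (mean (fun z => \prod_i \prod_k a (z.1.1 i k) (z.1.2 i k) (z.2 i k) ^+
    (pairn e i * pairn f k + pairn e' i * pairn f' k))).
  apply: eq_mean => z; rewrite /cycle_dev -big_split/=; apply: eq_bigr => i _.
  by rewrite -big_split/=; apply: eq_bigr => k _; rewrite exprD.
exact: (mean_prod d t q p (fun i k x w y =>
  a x w y ^+ (pairn e i * pairn f k + pairn e' i * pairn f' k))).
Qed.

Definition cycle_count_mean : R :=
  \sum_(e : 'I_n * 'I_n | ordered e) \sum_(f : 'I_m * 'I_m | ordered f) c ^+ 4 * kappa.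

(** The square of the centred count is a sum over pairs of cycles, whose
    covariances are those of [cycle_cov_le]. *)
Lemma cycle_count_variance :
  mean (fun z => (cycle_count z - cycle_count_mean) ^+ 2) <=
  4 * n%:R ^+ 3 * m%:R ^+ 4 * (c ^+ 8 * H) + 4 * n%:R ^+ 4 * m%:R ^+ 3 * (c ^+ 8 * H)
  + 16 * n%:R ^+ 3 * m%:R ^+ 3 * (c ^+ 6 * v * kappa)
  + 4 * n%:R ^+ 2 * m%:R ^+ 3 * (c ^+ 4 * v ^+ 2 * kappa)
  + 4 * n%:R ^+ 3 * m%:R ^+ 2 * (c ^+ 4 * v ^+ 2 * kappa)
  + n%:R ^+ 2 * m%:R ^+ 2 * v ^+ 4.
Proof.
apply: le_trans (sum_cycle_cov_le (gauss_vec R d) (@measurable_edge R d t)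
  (@edgeC R d t) hp entry_moment0 entry_mean entry_var01 normr_entry_moment_le1 c01 n m).
rewrite le_eqVlt; apply/orP; left; apply/eqP.
rewrite (_ : (fun z => _) = (fun z => \sum_(e | ordered e) \sum_(e' | ordered e')
    \sum_(f | ordered f) \sum_(f' | ordered f')
    (cycle_dev e f z - c ^+ 4 * kappa) * (cycle_dev e' f' z - c ^+ 4 * kappa))).
  rewrite /mean mean_sum; apply: eq_bigr => e oe.
  rewrite mean_sum; apply: eq_bigr => e' oe'.
  rewrite mean_sum; apply: eq_bigr => f of_.
  rewrite mean_sum; apply: eq_bigr => f' of'.
  by rewrite (mean_covariance (mean_cycle_dev oe of_) (mean_cycle_dev oe' of'))
    -mean_cycle_dev_pair.
apply/funext => z; rewrite /cycle_count /cycle_count_mean -sumrB.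
under eq_bigr do rewrite -sumrB.
rewrite expr2 big_distrlr/=; apply: eq_bigr => e _; apply: eq_bigr => e' _.
by rewrite big_distrlr.
Qed.

End cycle_count.

Lemma card_ordered_ge k : (1 < k)%N -> (k ^ 2 <= 4 * \sum_(e : 'I_k * 'I_k) ordered e)%N.
Proof.
move=> k2; have := card_ordered k; move: (\sum_e _)%N => N E.
have : (2 * k <= k ^ 2)%N by rewrite -mulnn leq_mul2r k2 orbT.
by lia.
Qed.

(** The variance bound, divided by the square of the lower bound for the mean
    up to a constant. The terms with [H] give [C / x]; in the terms with one
    factor [k], one uses [q^2 <= v] and [1 <= x, y]. *)
Lemma variance_le_arith (R : realFieldType) (x y q k v H C : R) :
  1 <= x -> x <= y -> 0 < q -> 0 < k -> 0 <= H -> H <= C * k ^+ 2 -> q ^+ 2 <= v ->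
  4 * x ^+ 3 * y ^+ 4 * (q ^+ 8 * H) + 4 * x ^+ 4 * y ^+ 3 * (q ^+ 8 * H)
  + 16 * x ^+ 3 * y ^+ 3 * (q ^+ 6 * v * k)
  + 4 * x ^+ 2 * y ^+ 3 * (q ^+ 4 * v ^+ 2 * k)
  + 4 * x ^+ 3 * y ^+ 2 * (q ^+ 4 * v ^+ 2 * k) + x ^+ 2 * y ^+ 2 * v ^+ 4
  <= x ^+ 4 * y ^+ 4 * (q ^+ 8 * k ^+ 2)
     * (8 * C / x + 24 * (v ^+ 2 / (x * y * q ^+ 4 * k))
        + (v ^+ 2 / (x * y * q ^+ 4 * k)) ^+ 2).
Proof.
move=> x1 xy q0 k0 H0 HC qv.
have x0 : 0 < x by lra.
have y0 : 0 < y by lra.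
have v0 : 0 <= v by apply: le_trans qv; exact: sqr_ge0.
have -> : x ^+ 4 * y ^+ 4 * (q ^+ 8 * k ^+ 2)
     * (8 * C / x + 24 * (v ^+ 2 / (x * y * q ^+ 4 * k))
        + (v ^+ 2 / (x * y * q ^+ 4 * k)) ^+ 2) =
   4 * (x ^+ 3 * y ^+ 4 * (q ^+ 8 * (C * k ^+ 2)))
   + 4 * (x ^+ 3 * y ^+ 4 * (q ^+ 8 * (C * k ^+ 2)))
   + 16 * (x ^+ 3 * y ^+ 3 * (q ^+ 4 * v ^+ 2 * k))
   + 4 * (x ^+ 3 * y ^+ 3 * (q ^+ 4 * v ^+ 2 * k))
   + 4 * (x ^+ 3 * y ^+ 3 * (q ^+ 4 * v ^+ 2 * k)) + x ^+ 2 * y ^+ 2 * v ^+ 4.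
  by field; rewrite !gt_eqF.
have X3 : 0 <= x ^+ 3 by rewrite exprn_ge0// ltW.
have Y3 : 0 <= y ^+ 3 by rewrite exprn_ge0// ltW.
have Q4 : 0 <= q ^+ 4 by rewrite exprn_ge0// ltW.
have Q8 : 0 <= q ^+ 8 by rewrite exprn_ge0// ltW.
have K4 : 0 <= q ^+ 4 * v ^+ 2 * k by rewrite !mulr_ge0 ?sqr_ge0// ltW.
have X2 : x ^+ 2 <= x ^+ 3 by rewrite ler_weXn2l.
have Y2 : y ^+ 2 <= y ^+ 3 by rewrite ler_weXn2l// (le_trans x1).
have t1 : x ^+ 3 * y ^+ 4 * (q ^+ 8 * H) <= x ^+ 3 * y ^+ 4 * (q ^+ 8 * (C * k ^+ 2)).
  by rewrite ler_wpM2l ?ler_wpM2l// mulr_ge0// exprn_ge0// ltW.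
have t2 : x ^+ 4 * y ^+ 3 * (q ^+ 8 * H) <= x ^+ 3 * y ^+ 4 * (q ^+ 8 * (C * k ^+ 2)).
  apply: ler_pM; last exact: ler_wpM2l.
  - by apply: mulr_ge0 => //; rewrite exprn_ge0// ltW.
  - exact: mulr_ge0.
  have -> : x ^+ 4 * y ^+ 3 = x ^+ 3 * y ^+ 3 * x by ring.
  have -> : x ^+ 3 * y ^+ 4 = x ^+ 3 * y ^+ 3 * y by ring.
  by rewrite ler_wpM2l// mulr_ge0.
have t3 : x ^+ 3 * y ^+ 3 * (q ^+ 6 * v * k) <= x ^+ 3 * y ^+ 3 * (q ^+ 4 * v ^+ 2 * k).
  apply: ler_wpM2l; first exact: mulr_ge0.
  apply: ler_wpM2r; first exact: ltW.
  have -> : q ^+ 6 * v = q ^+ 4 * (q ^+ 2 * v) by ring.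
  by rewrite ler_wpM2l// expr2 ler_wpM2r.
have t4 : x ^+ 2 * y ^+ 3 * (q ^+ 4 * v ^+ 2 * k) <= x ^+ 3 * y ^+ 3 * (q ^+ 4 * v ^+ 2 * k).
  by rewrite ler_wpM2r// ler_wpM2r.
have t5 : x ^+ 3 * y ^+ 2 * (q ^+ 4 * v ^+ 2 * k) <= x ^+ 3 * y ^+ 3 * (q ^+ 4 * v ^+ 2 * k).
  by rewrite ler_wpM2r// ler_wpM2l.
have a4 (r s u : R) : 4 * r * s * u = 4 * (r * s * u) by ring.
have a16 (r s u : R) : 16 * r * s * u = 16 * (r * s * u) by ring.
rewrite !a4 a16 lerD2r; do ?apply: lerD; by rewrite ler_pM2l.
Qed.

Section detection.
Variables (R : realType) (n m d : nat) (t q p g : R).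
Hypotheses (q01 : 0 < q <= 1) (hp : 0 < p < 1) (g01 : 0 <= g <= 1).
Hypotheses (n2 : (1 < n)%N) (m2 : (n <= m)%N).

(** For [g = 1] the mask is ignored; for [g = 0] only entries in the mask
    count. *)
Definition mask_weight (x : bool) : R := if x then 1 else g.

Definition entry_dev (x b : bool) : R := mask_weight x * (b%:R - p).

Definition weighted_C4 (M A : 'M[bool]_(n, m)) : R :=
  \sum_(e | ordered e) \sum_(f | ordered f)
    \prod_i \prod_k entry_dev (M i k) (A i k) ^+ (pairn e i * pairn f k).

Let kappa := corr_moment (gauss_vec R d) (edge_dev p t) 2.
Let H := corr_moment (gauss_vec R d) (edge_dev p t) 4.
Let v := q + (1 - q) * g.

Lemma normr_entry_dev_le1 x b : `|entry_dev x b| <= 1.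
Proof.
apply: normrM_le1; last exact: normr_bool_sub_le1.
by case: x => /=; rewrite ?normr1// ger0_norm//; case/andP: g01.
Qed.

Let q01' : 0 <= q <= 1.
Proof. by case/andP: q01 => /ltW-> ->. Qed.

Lemma entry_dev_sqr_le x b : entry_dev x b ^+ 2 <= mask_weight x.
Proof.
have /andP[w0 w1] : 0 <= mask_weight x <= 1 by case: x => //=; rewrite ler01 lexx.
rewrite exprMn -[leRHS]mulr1 ler_pM ?sqr_ge0//.
  by rewrite expr2 ler_piMr.
by rewrite -real_normK ?num_real// exprn_ile1// normr_bool_sub_le1.
Qed.

Let null_entry (x w y : bool) := entry_dev x y.
Let planted_entry (x w y : bool) := entry_dev x (if x then w else y).

Let var_le (a : bool -> bool -> bool -> R) w :
  (forall x w y, a x w y ^+ 2 <= mask_weight x) -> entry_moment q p a 2 w <= v.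
Proof.
move=> a2; have [/andP[q0 q1] /andP[p0 p1]] := (q01', hp).
have -> : v = \sum_x \sum_y bernoulli_pmf q x * bernoulli_pmf p y * mask_weight x.
  by rewrite !big_bool/= /v /bernoulli_pmf; ring.
apply: ler_sum => x _; apply: ler_sum => y _; rewrite ler_wpM2l//.
by rewrite mulr_ge0// bernoulli_pmf_ge0// ltW// ltW.
Qed.

Let null_mean w : entry_moment q p null_entry 1 w = 0 * (w%:R - p).
Proof.
by rewrite /entry_moment !big_bool/= /bernoulli_pmf /null_entry /entry_dev/=; ring.
Qed.

Let planted_mean w : entry_moment q p planted_entry 1 w = q * (w%:R - p).
Proof.
by rewrite /entry_moment !big_bool/= /bernoulli_pmf /planted_entry /entry_dev/=; ring.
Qed.

Let mu := cycle_count_mean n m d t p q.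
Let L := v ^+ 2 / (n%:R * m%:R * q ^+ 4 * kappa).

Lemma null_cycle_count (z : sample n m) :
  cycle_count null_entry z = weighted_C4 z.1.1 z.2.
Proof. by []. Qed.

Lemma planted_cycle_count (z : sample n m) :
  cycle_count planted_entry z = weighted_C4 z.1.1 (mask_mx z.1.1 z.1.2 z.2).
Proof.
apply: eq_bigr => e _; apply: eq_bigr => f _; apply: eq_bigr => i _.
by apply: eq_bigr => k _; rewrite mxE.
Qed.

Hypothesis kappa_gt0 : 0 < kappa.

Let n0 : 0 < n%:R :> R. Proof. by rewrite ltr0n ltnW. Qed.
Let n1 : 1 <= n%:R :> R. Proof. by rewrite ler1n ltnW. Qed.
Let nm : n%:R <= m%:R :> R. Proof. by rewrite ler_nat. Qed.
Let m0 : 0 < m%:R :> R. Proof. exact: lt_le_trans n0 nm. Qed.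
Let q0 : 0 < q. Proof. by case/andP: q01. Qed.
Let q4 : 0 < q ^+ 4. Proof. exact: exprn_gt0. Qed.
Let v_ge_q2 : q ^+ 2 <= v.
Proof.
have [/andP[_ q1] /andP[g0 g1]] := (q01, g01).
have : 0 <= (1 - q) * g by rewrite mulr_ge0// subr_ge0.
have : 0 <= q * (1 - q) by rewrite mulr_ge0 ?subr_ge0// ltW.
by rewrite /v; lra.
Qed.
Let v0 : 0 <= v.
Proof. by apply: le_trans v_ge_q2; exact: sqr_ge0. Qed.

Lemma cycle_count_mean_ge :
  n%:R ^+ 2 * m%:R ^+ 2 * (q ^+ 4 * kappa) / 16 <= mu.
Proof.
have S k : (1 < k)%N -> k%:R ^+ 2 / 4 <= \sum_(e : 'I_k * 'I_k | ordered e) 1 :> R.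
  move=> k2.
  have -> : \sum_(e : 'I_k * 'I_k | ordered e) 1 = (\sum_(e : 'I_k * 'I_k) ordered e)%N%:R :> R.
    by rewrite natr_sum big_mkcond; apply: eq_bigr => e _; case: ifP.
  by have := card_ordered_ge k2; rewrite -(ler_nat R) natrM natrX; lra.
have -> : mu = (\sum_(e : 'I_n * 'I_n | ordered e) 1) *
    (\sum_(f : 'I_m * 'I_m | ordered f) 1) * (q ^+ 4 * kappa).
  rewrite /mu /cycle_count_mean !mulr_suml; apply: eq_bigr => e _.
  by rewrite mul1r mulr_suml; apply: eq_bigr => f _; rewrite mul1r.
have -> : n%:R ^+ 2 * m%:R ^+ 2 * (q ^+ 4 * kappa) / 16 =
  (n%:R ^+ 2 / 4) * (m%:R ^+ 2 / 4) * (q ^+ 4 * kappa) by field.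
rewrite ler_wpM2r//; first by rewrite mulr_ge0// ltW.
rewrite ler_pM//.
- exact: S.
- by apply: S; exact: leq_trans m2.
Qed.

Let D := n%:R ^+ 4 * m%:R ^+ 4 * (q ^+ 8 * kappa ^+ 2).

Let D_gt0 : 0 < D.
Proof. by rewrite !mulr_gt0// exprn_gt0. Qed.

Let mu_gt0 : 0 < mu.
Proof.
apply: lt_le_trans cycle_count_mean_ge.
by rewrite divr_gt0// !mulr_gt0// exprn_gt0.
Qed.

Let mu_sqr_ge : D / 1024 <= (mu / 2) ^+ 2.
Proof.
have h : n%:R ^+ 2 * m%:R ^+ 2 * (q ^+ 4 * kappa) / 32 <= mu / 2.
  by have := cycle_count_mean_ge; lra.
have -> : D / 1024 = (n%:R ^+ 2 * m%:R ^+ 2 * (q ^+ 4 * kappa) / 32) ^+ 2.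
  by rewrite /D; field.
rewrite ler_sqr ?nnegrE//; last by rewrite divr_ge0// ltW.
by rewrite divr_ge0// !mulr_ge0// ?exprn_ge0// ltW.
Qed.

Let chebyshev_scale V B : V <= D * B -> 0 <= B -> V / (mu / 2) ^+ 2 <= 1024 * B.
Proof.
move=> VB B0; rewrite ler_pdivrMr ?exprn_gt0 ?divr_gt0//.
apply: (le_trans VB); rewrite [leRHS]mulrAC ler_wpM2r//.
by have := mu_sqr_ge; lra.
Qed.

Let L0 : 0 <= L.
Proof. by rewrite divr_ge0 ?sqr_ge0// !mulr_ge0// ltW. Qed.

Let DL2 : D * L ^+ 2 = n%:R ^+ 2 * m%:R ^+ 2 * v ^+ 4.
Proof. by rewrite /D /L; field; rewrite !gt_eqF. Qed.

(** Under the null law an entry does not depend on the latent vectors and has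
    mean [0 = 0 * s], so that only pairs of equal cycles contribute to the
    variance. *)
Lemma null_error_le :
  event_prob d t q p (fun z : sample n m => mu / 2 <= weighted_C4 z.1.1 z.2) <= 1024 * L ^+ 2.
Proof.
have p01 : 0 <= p <= 1 by case/andP: hp => /ltW-> /ltW->.
have c01 : 0 <= (0 : R) <= 1 by rewrite lexx ler01.
have mu0 : cycle_count_mean n m d t p 0 = 0.
  by rewrite /cycle_count_mean big1// => e _; rewrite big1// => f _; rewrite expr0n mul0r.
have := @cycle_count_variance R n m d t q p q01' hp null_entry 0 v
  (fun x w y => normr_entry_dev_le1 x y) c01 null_mean
  (fun w => var_le w (fun x w y => entry_dev_sqr_le x y)).
rewrite mu0 !expr0n/= !mul0r !mulr0 !add0r => V.
have mu2 : 0 < mu / 2 by rewrite divr_gt0.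
apply: le_trans (chebyshev_scale (le_trans V _) _); last exact: sqr_ge0.
  apply: (markov_sqr _ _ _ _ mu2) => // z zE; rewrite subr0 null_cycle_count.
  by rewrite ler_sqr ?nnegrE// ?(ltW mu2)// (le_trans (ltW mu2)).
by rewrite DL2.
Qed.

Lemma planted_error_le C : H <= C * kappa ^+ 2 ->
  event_prob d t q p
    (fun z : sample n m => weighted_C4 z.1.1 (mask_mx z.1.1 z.1.2 z.2) < mu / 2)
  <= 1024 * (8 * C / n%:R + 24 * L + L ^+ 2).
Proof.
move=> HC.
have H0 : 0 <= H by apply: Rintegral_ge0 => z _; rewrite exprn_even_ge0.
have p01 : 0 <= p <= 1 by case/andP: hp => /ltW-> /ltW->.
have k2 : 0 < kappa ^+ 2 by exact: exprn_gt0.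
have C0 : 0 <= C by rewrite -(pmulr_lge0 _ k2) (le_trans H0).
have V := @cycle_count_variance R n m d t q p q01' hp planted_entry q v
  (fun x w y => normr_entry_dev_le1 x _) q01' planted_mean
  (fun w => var_le w (fun x w y => entry_dev_sqr_le x _)).
have mu2 : 0 < mu / 2 by rewrite divr_gt0.
apply: le_trans (chebyshev_scale (le_trans V _) _).
- apply: (markov_sqr _ _ _ _ mu2) => // z zE; rewrite planted_cycle_count -/mu -[leRHS]sqrrN opprB.
  rewrite ler_sqr ?nnegrE// ?(ltW mu2)//; move: zE mu2; rewrite /= -/mu; lra.
- exact: variance_le_arith.
- rewrite addr_ge0 ?sqr_ge0// addr_ge0//; last exact: mulr_ge0.
  by apply: divr_ge0; [exact: mulr_ge0|exact: ltW].
Qed.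

Lemma detection_error_le C : H <= C * kappa ^+ 2 ->
  Pr_mask q (fun=> bern_law p) (fun M A : 'M[bool]_(n, m) => mu / 2 <= weighted_C4 M A)
  + Pr_mask q (fun M => masked_law p d t M)
      (fun M A : 'M[bool]_(n, m) => weighted_C4 M A < mu / 2)
  <= 1024 * (8 * C / n%:R + 24 * L + 2 * L ^+ 2).
Proof.
move=> HC; rewrite (Pr_mask_bern d t q p (fun M A => mu / 2 <= weighted_C4 M A)).
rewrite (Pr_mask_masked d t q p (fun M A => weighted_C4 M A < mu / 2)).
have := null_error_le; have := planted_error_le HC; lra.
Qed.

End detection.

(** * Asymptotics *)

Section cycle_statistics.
Variables (R : realType) (n m : nat).

Lemma sum_ordered (F : 'I_n * 'I_n -> R) :
  \sum_(e | ordered e) F e = \sum_(i < n) \sum_(j < n | (i < j)%N) F (i, j).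
Proof.
rewrite (pair_big_dep xpredT (fun i j : 'I_n => (i < j)%N) (fun i j => F (i, j)))/=.
by apply: eq_big => -[i j].
Qed.

Lemma prod_cycle (a : 'I_n -> 'I_m -> R) (i j : 'I_n) (k l : 'I_m) : i != j -> k != l ->
  \prod_x \prod_y a x y ^+ (pairn (i, j) x * pairn (k, l) y) =
  a i k * a i l * a j k * a j l.
Proof.
move=> ij kl.
rewrite (@prod_pairn _ _ (fun x r => \prod_y a x y ^+ (r * pairn (k, l) y)))//.
  rewrite (@prod_pairn _ _ (fun y r => a i y ^+ (1 * r)))//.
  rewrite (@prod_pairn _ _ (fun y r => a j y ^+ (1 * r)))//.
  by rewrite !mulrA.
by move=> x; rewrite big1.
Qed.

End cycle_statistics.

Lemma weighted_C4_cycles (R : realType) n m (p g : R) (M A : 'M[bool]_(n, m)) :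
  weighted_C4 p g M A =
  \sum_(i < n) \sum_(j < n | (i < j)%N) \sum_(k < m) \sum_(l < m | (k < l)%N)
    (mask_weight g (M i k) * mask_weight g (M i l)
     * mask_weight g (M j k) * mask_weight g (M j l)) * signed_cycle p A i j k l.
Proof.
have neq k (x y : 'I_k) : (x < y)%N -> x != y by move=> xy; rewrite -val_eqE/= ltn_eqF.
rewrite /weighted_C4 sum_ordered; apply: eq_bigr => i _; apply: eq_bigr => j ij.
rewrite sum_ordered; apply: eq_bigr => k _; apply: eq_bigr => l kl.
rewrite (prod_cycle (fun x y => entry_dev p g (M x y) (A x y))) ?neq//.
rewrite /entry_dev /signed_cycle; ring.
Qed.

Lemma weighted_C4_unmasked (R : realType) n m (p : R) (M A : 'M[bool]_(n, m)) :
  weighted_C4 p 1 M A = C4 p A.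
Proof.
rewrite weighted_C4_cycles; do 4 (apply: eq_bigr => ? _).
by rewrite /mask_weight !if_same !mul1r.
Qed.

Lemma weighted_C4_masked (R : realType) n m (p : R) (M A : 'M[bool]_(n, m)) :
  weighted_C4 p 0 M A = C4_mask p M A.
Proof.
rewrite weighted_C4_cycles; apply: eq_bigr => i _; apply: eq_bigr => j _.
apply: eq_bigr => k _; rewrite [RHS]big_mkcondr; apply: eq_bigr => l _.
rewrite /mask_weight; case: (M i k) (M i l) (M j k) (M j l) => [] [] [] [];
  by rewrite /= ?mulr1 ?mul1r ?mulr0 ?mul0r.
Qed.

Lemma Pr_mask_cst (R : realType) n m (q : R) (mu : 'M[bool]_(n, m) -> mx_law R n m)
    (E : pred 'M[bool]_(n, m)) :
  Pr_mask q mu (fun=> E) = Pr (fun A => \sum_M bern_law q M * mu M A) E.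
Proof.
rewrite /Pr_mask /Pr [RHS]exchange_big/=.
by apply: eq_bigr => M _; rewrite mulr_sumr.
Qed.

Lemma Pr_mask_bern_law (R : realType) n m (q p : R) (E : pred 'M[bool]_(n, m)) :
  Pr_mask q (fun=> bern_law p) (fun=> E) = Pr (bern_law p) E.
Proof. by rewrite /Pr_mask -mulr_suml sum_bern_law mul1r. Qed.

Lemma Pr_mask_mixed_law (R : realType) n m (q p t : R) d (E : pred 'M[bool]_(n, m)) :
  Pr_mask q (fun M => masked_law p d t M) (fun=> E) = Pr (mixed_law q p d t) E.
Proof. exact: Pr_mask_cst. Qed.

Section asymptotics.
Variables (R : realType) (p : R) (tau : nat -> R) (m d : nat -> nat) (q : nat -> R).
Hypothesis hp : 0 < p < 1.
Hypothesis htau : forall k : nat, (0 < k)%N -> is_threshold k p (tau k).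
Hypothesis hm : forall n : nat, (0 < n)%N -> (n <= m n)%N.
Hypothesis hd : forall n : nat, (0 < n)%N -> (0 < d n)%N.
Hypothesis hq : forall n : nat, (0 < n)%N -> 0 < q n <= 1.
Variables (g : R) (X : nat -> R).
Hypothesis g01 : 0 <= g <= 1.
Hypothesis X_gt0 : forall n : nat, (0 < n)%N -> 0 < X n.
Hypothesis XE : forall n : nat, (0 < n)%N ->
  (q n + (1 - q n) * g) ^+ 2 / (n%:R * (m n)%:R * q n ^+ 4) = (X n)^-1.
Hypothesis dX : much_less (fun n => (d n)%:R) X.

Let threshold n := cycle_count_mean n (m n) (d n) (tau (d n)) p (q n) / 2.

Let error n :=
  Pr_mask (q n) (fun=> bern_law p)
    (fun M A : 'M[bool]_(n, m n) => threshold n <= weighted_C4 p g M A)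
  + Pr_mask (q n) (fun M => masked_law p (d n) (tau (d n)) M)
    (fun M A : 'M[bool]_(n, m n) => weighted_C4 p g M A < threshold n).

Lemma error_ge0 n : (0 < n)%N -> 0 <= error n.
Proof.
move=> n0; have q01 : 0 <= q n <= 1 by have /andP[/ltW-> ->] := hq n0.
have p01 : 0 <= p <= 1 by case/andP: hp => /ltW-> /ltW->.
rewrite /error (Pr_mask_bern (d n) (tau (d n)) (q n) p
  (fun M A => threshold n <= weighted_C4 p g M A)).
rewrite (Pr_mask_masked (d n) (tau (d n)) (q n) p
  (fun M A => weighted_C4 p g M A < threshold n)).
by rewrite addr_ge0//; apply: sumr_ge0 => z _; exact: weight_ge0.
Qed.

(** The bound of [detection_error_le] with [kappa >= c / d], so that [L] is at
    most [d / (c X)]. *)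
Lemma error_cvg0 : error n @[n --> \oo] --> (0 : R).
Proof.
have [c c0 kappa_ge] := corr_moment2_lower hp.
have [C C0 H_le] := corr_moment4_upper hp.
pose e n := (X n / (d n)%:R)^-1.
pose K := C / c ^+ 2.
pose bound n := 1024 * (16 * K * harmonic n + 24 * (c^-1 * e n)
  + 2 * ((c^-1 * e n) * (c^-1 * e n))).
have e0 : e n @[n --> \oo] --> (0 : R).
  apply/gtr0_cvgV0 => //; near=> n.
  have n0 : (0 < n)%N by near: n; exact: nbhs_infty_gt.
  by rewrite divr_gt0 ?X_gt0// ltr0n hd.
have b0 : bound n @[n --> \oo] --> (0 : R).
  have -> : (0 : R) = 1024 * (16 * K * 0 + 24 * (c^-1 * 0)
      + 2 * ((c^-1 * 0) * (c^-1 * 0))) by ring.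
  have ce : c^-1 * e n @[n --> \oo] --> c^-1 * 0 by apply: cvgM => //; exact: cvg_cst.
  apply: cvgM; first exact: cvg_cst.
  apply: cvgD; last by apply: cvgM; [exact: cvg_cst|exact: cvgM].
  apply: cvgD; first by apply: cvgM; [exact: cvg_cst|exact: cvg_harmonic].
  by apply: cvgM => //; exact: cvg_cst.
apply: (@squeeze_cvgr _ _ _ _ (fun=> 0) bound) => //; last exact: cvg_cst.
near=> n.
have n2 : (1 < n)%N by near: n; exact: nbhs_infty_gt.
have n0 : (0 < n)%N by exact: ltnW.
rewrite error_ge0//=.
have dn0 : (0 < d n)%N by exact: hd.
have d0 : 0 < (d n)%:R :> R by rewrite ltr0n.
have := kappa_ge _ _ dn0 (htau dn0); have := H_le _ _ dn0 (htau dn0).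
set kappa := corr_moment _ _ 2; set H := corr_moment _ _ 4 => HC kc.
have k0 : 0 < kappa by apply: lt_le_trans kc; rewrite divr_gt0.
have HK : H <= K * kappa ^+ 2.
  apply: (le_trans HC); rewrite /K -mulrA; apply: ler_wpM2l => //.
  rewrite ler_pdivlMl ?exprn_gt0// -expr_div_n ler_sqr ?nnegrE//.
    by rewrite divr_ge0 ?ltW.
  exact: ltW.
have := detection_error_le (hq n0) hp g01 n2 (hm n0) k0 HK; rewrite -/kappa.
set L := _ ^+ 2 / _ => E; apply: (le_trans E) => {E}.
have L0 : 0 <= L.
  have /andP[/ltW q0 _] := hq n0.
  by rewrite divr_ge0 ?sqr_ge0// !mulr_ge0 ?(ltW k0).
have Le : L <= c^-1 * e n.
  have -> : L = (X n)^-1 * kappa^-1 by rewrite /L invfM mulrA XE.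
  have -> : c^-1 * e n = (X n)^-1 * (c / (d n)%:R)^-1.
    by rewrite /e !invfM !invrK; ring.
  rewrite ler_wpM2l ?invr_ge0 ?(ltW (X_gt0 n0))// lef_pV2 ?posrE// divr_gt0//.
have K0 : 0 <= K by rewrite divr_ge0 ?sqr_ge0.
have hn : n%:R^-1 <= 2 * harmonic n :> R.
  rewrite /harmonic/= ler_pdivlMr ?ltr0n// -natr1 mulrDr mulVf ?pnatr_eq0 -?lt0n// mulr1.
  by rewrite lerD2l invf_le1 ?ltr0n// ler1n.
have scaled (x y z x' y' z' : R) : x <= x' -> y <= y' -> z <= z' ->
    1024 * (x + y + z) <= 1024 * (x' + y' + z').
  by move=> xx yy zz; rewrite ler_wpM2l ?ler0n// lerD// lerD.
apply: scaled.
- have -> : 16 * K * harmonic n = 8 * K * (2 * harmonic n) by ring.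
  by apply: ler_wpM2l hn; exact: mulr_ge0.
- by rewrite ler_pM2l.
- by rewrite ler_pM2l// expr2 ler_pM.
Unshelve. all: by end_near.
Qed.

End asymptotics.

Theorem theorem8p1 (R : realType) (p : R) (hp : 0 < p < 1)
    (tau : nat -> R)
    (htau : forall k : nat, (0 < k)%N -> is_threshold k p (tau k))
    (m d : nat -> nat) (q : nat -> R)
    (hm : forall n : nat, (0 < n)%N -> (n <= m n)%N)
    (hd : forall n : nat, (0 < n)%N -> (0 < d n)%N)
    (hq : forall n : nat, (0 < n)%N -> 0 < q n <= 1) :
  (much_less (fun n => ln (n%:R : R) ^+ 3) (fun n => (d n)%:R) ->
   much_less (fun n => (d n)%:R) (fun n => n%:R * (m n)%:R * q n ^+ 4) ->
   exists t : nat -> R,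
     Pr (bern_law p) (fun A : 'M[bool]_(n, m n) => t n <= C4 p A)
     + Pr (mixed_law (q n) p (d n) (tau (d n)))
         (fun A : 'M[bool]_(n, m n) => C4 p A < t n)
     @[n --> \oo] --> (0 : R))
  /\
  (much_less (fun n => ln (n%:R : R) ^+ 3) (fun n => (d n)%:R) ->
   much_less (fun n => (d n)%:R) (fun n => n%:R * (m n)%:R * q n ^+ 2) ->
   exists t : nat -> R,
     Pr_mask (q n) (fun _ => bern_law p)
       (fun M A : 'M[bool]_(n, m n) => t n <= C4_mask p M A)
     + Pr_mask (q n) (fun M => masked_law p (d n) (tau (d n)) M)
         (fun M A : 'M[bool]_(n, m n) => C4_mask p M A < t n)
     @[n --> \oo] --> (0 : R)).
Proof.
have X0 r n : (0 < n)%N -> 0 < n%:R * (m n)%:R * q n ^+ r.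
  move=> n0; have /andP[q0 _] := hq n n0.
  by rewrite !mulr_gt0 ?exprn_gt0// ltr0n// (leq_trans n0)// hm.
split=> _ dX; exists (fun n => cycle_count_mean n (m n) (d n) (tau (d n)) p (q n) / 2).
- have g01 : 0 <= (1 : R) <= 1 by rewrite ler01 lexx.
  have XE n : (0 < n)%N ->
      (q n + (1 - q n) * 1) ^+ 2 / (n%:R * (m n)%:R * q n ^+ 4) =
      (n%:R * (m n)%:R * q n ^+ 4)^-1.
    by move=> _; rewrite mulr1 subrKC expr1n mul1r.
  apply: cvg_trans (error_cvg0 hp htau hm hd hq g01 (X0 4) XE dX).
  apply: near_eq_cvg; near=> n; rewrite -Pr_mask_mixed_law -(Pr_mask_bern_law (q n)).
  by congr (_ + _); apply: eq_bigr => M _; congr (_ * _); apply: eq_bigl => A;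
    rewrite weighted_C4_unmasked.
- have g01 : 0 <= (0 : R) <= 1 by rewrite ler01 lexx.
  have XE n : (0 < n)%N ->
      (q n + (1 - q n) * 0) ^+ 2 / (n%:R * (m n)%:R * q n ^+ 4) =
      (n%:R * (m n)%:R * q n ^+ 2)^-1.
    move=> n0; have /andP[q0 _] := hq n n0; rewrite mulr0 addr0.
    have mn0 : (0 < m n)%N by rewrite (leq_trans n0)// hm.
    by field; rewrite !gt_eqF// ltr0n.
  apply: cvg_trans (error_cvg0 hp htau hm hd hq g01 (X0 2) XE dX).
  apply: near_eq_cvg; near=> n.
  by congr (_ + _); apply: eq_bigr => M _; congr (_ * _); apply: eq_bigl => A;
    rewrite weighted_C4_masked.
Unshelve. all: by end_near.
Qed.
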